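(* Let $n\ge1$, $\sigma\in J_n^+$, $\Lambda$ a continuous positive function on $[0,\infty)$, $\underline\vartheta,\overline\vartheta>0$, and let $V=V(x)\ge0$ be continuous and time-independent with $V(x)\ge\underline\vartheta\Lambda(t)|x|^\sigma$ for $|x|\ge1,t>0$ and $V(x)\le\overline\vartheta\Lambda(t)|x|^\sigma$ for $x\in\mathbb{R}^n,t>0$. Let $0<p<\varepsilon_0\underline\vartheta/\overline\vartheta$ ($p<1$), with $\varepsilon_0>0$ any constant such that $\int_{\{|x-y|\ge1\}}B(y)|x-y|^{\sigma+d}dy\ge\varepsilon_0|x|^{\sigma+d}$ for all $x$ and all $d\in[0,\frac{\sigma p}{1-p}]$, and let $a\ge\frac{\sigma}{1-p}$. Let $u_{*V}$ be the maximal s-solution of the problem $\partial_tu-\Delta\partial_tu=\Delta u+V u^p$, $u(\cdot,0)=0$. Then a function $0\le u\in\mathcal{Z}_{\infty,a}$ is a nontrivial (i.e. not identically zero) s-solution of this zero-data problem if and only if $u(x,t)=u_{*V}(x,[t-\kappa]_+)$ for some constant $\kappa\ge0$.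
   Context: $J_n^+=\{0\}\cup[1,\infty)$ if $n=1$, $[0,\infty)$ if $n\ge2$. $[s]_+=\max\{s,0\}$. $B=\mathcal{F}^{-1}((1+|\xi|^2)^{-1})$, $\mathcal{B}\varphi=B*\varphi$. $BC_a$: continuous functions with $|\varphi(x)|\le C|x|^a$ for large $|x|$; $\mathcal{Z}_{\infty,a}=C([0,\infty);BC_a)$. An s-solution of the zero-data problem is $0\le u$ with $\mu=e^tu\in\mathcal{Z}_{\infty,a}$ and $\mu(t)=\int_0^t\mathcal{B}\mu(\tau)d\tau+\int_0^te^{(1-p)\tau}\mathcal{B}[V\mu^p](\tau)d\tau$. A maximal s-solution is an s-solution dominating every s-solution pointwise; under the stated hypotheses it exists and is unique (a result of the same paper), and it is denoted $u_{*V}$. *)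

(* Defs.v *)
From HB Require Import structures.
From mathcomp Require Import all_boot all_order all_algebra.
From mathcomp Require Import all_classical all_reals all_analysis.
Set Implicit Arguments. Unset Strict Implicit. Unset Printing Implicit Defensive.
Import Order.TTheory GRing.Theory Num.Theory.
Import numFieldNormedType.Exports.
Local Open Scope classical_set_scope.
Local Open Scope ring_scope.

Section Defs.
Variable R : realType.

Definition enorm (n : nat) (x : 'rV[R]_n) : R :=
  Num.sqrt (\sum_(i < n) (x ord0 i) ^+ 2).

(* Lebesgue integral over R^n of a function with values in \bar R, written as
   an iterated integral of one-dimensional Lebesgue integrals (all integrands
   used below are nonnegative, so by Tonelli this is the Lebesgue integral on R^n). *)
Fixpoint int_Rn (n : nat) : ('rV[R]_n -> \bar R) -> \bar R :=
  match n with
  | 0 => fun f => f 0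
  | n'.+1 => fun f =>
      (\int[@lebesgue_measure R]_(t in [set: R])
          int_Rn (fun y : 'rV[R]_n' => f (row_mx (\row_(j < 1) t) y)))%E
  end.

(* Bessel kernel B = F^{-1}((1+|xi|^2)^{-1}), via its standard integral
   representation B(x) = int_0^oo (4 pi s)^{-n/2} e^{-s - |x|^2/(4s)} ds
   (value +oo allowed at x = 0 when n >= 2). *)
Definition Bker (n : nat) (x : 'rV[R]_n) : \bar R :=
  (\int[@lebesgue_measure R]_(s in `]0%R, +oo[%classic : set R)
     ((4 * pi * s) `^ (- (n%:R / 2)) * expR (- s - enorm x ^+ 2 / (4 * s)))%:E)%E.

Definition Bconv (n : nat) (phi : 'rV[R]_n -> R) (x : 'rV[R]_n) : \bar R :=
  int_Rn (fun y => (Bker y * (phi (x - y))%:E)%E).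

Definition Jplus (n : nat) (s : R) : Prop :=
  if n == 1%N then s = 0 \/ 1 <= s else 0 <= s.

Definition BC (n : nat) (a : R) (phi : 'rV[R]_n -> R) : Prop :=
  continuous phi /\
  exists C R0 : R, forall x, R0 <= enorm x -> `|phi x| <= C * enorm x `^ a.

(* Z_{infty,a} = C([0,oo); BC_a); a function of (t,x) written f t x.
   The topology of BC_a is given by the weighted sup norm
   sup_x |phi x| / (1 + |x|)^a. *)
Definition Zinf (n : nat) (a : R) (f : R -> 'rV[R]_n -> R) : Prop :=
  (forall t, 0 <= t -> BC a (f t)) /\
  (forall t, 0 <= t -> forall eps, 0 < eps -> exists2 delta, 0 < delta &
     forall s, 0 <= s -> `|s - t| < delta ->
       forall x, `|f s x - f t x| <= eps * (1 + enorm x) `^ a).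

Definition s_solution (n : nat) (V : 'rV[R]_n -> R) (p a : R)
    (u : R -> 'rV[R]_n -> R) : Prop :=
  let mu := fun t x => expR t * u t x in
  (forall t x, 0 <= t -> 0 <= u t x) /\
  Zinf a mu /\
  (forall t x, 0 <= t ->
     ((mu t x)%:E =
      \int[@lebesgue_measure R]_(tau in `[0%R, t]%classic : set R) Bconv (mu tau) x +
      \int[@lebesgue_measure R]_(tau in `[0%R, t]%classic : set R)
          ((expR ((1 - p) * tau))%:E * Bconv (fun y => (V y * (mu tau y) `^ p)%R) x))%E).

Definition maximal_s_solution (n : nat) (V : 'rV[R]_n -> R) (p a : R)
    (u : R -> 'rV[R]_n -> R) : Prop :=
  s_solution V p a u /\
  forall v, s_solution V p a v -> forall t x, 0 <= t -> v t x <= u t x.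

End Defs.

(* Main.v *)
Require Import Defs.
From HB Require Import structures.
From mathcomp Require Import all_boot all_order all_algebra.
From mathcomp Require Import all_classical all_reals all_analysis.
From mathcomp Require Import measurable_realfun ring lra.
Import Order.TTheory GRing.Theory Num.Theory.
Import numFieldNormedType.Exports.
Local Open Scope classical_set_scope.
Local Open Scope ring_scope.
Set Implicit Arguments. Unset Strict Implicit. Unset Printing Implicit Defensive.

(** Put mu = e^t u, so that s-solutions are the fixed points of the monotone map
    Phi mu = int_0^t B mu + int_0^t e^{(1-p)s} B[V mu^p], and mu is nondecreasing in t.
    Write r = 1/(1-p), b = sigma r.

    - A solution that is positive arbitrarily soon after t = 0 satisfies
      mu >= (E t |x|^sigma)^r with the sharp constant E = (1-p) eps0 vl: feeding a lower bound
      c t^r |x|^d into Phi returns E c^p t^r |x|^(sigma + p d), and iterating drives (c, d)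
      to the fixed point (E^r, b).  The iteration is started by a cruder one, which carries a
      constant lower bound on large cubes.
    - On the set of functions above this bound the concavity estimate
      V (v + h)^p <= V v^p + (q r / t) h, q = p vu / (eps0 vl) < 1, makes Phi a contraction in
      the norm with weight t^r e^{Nt} prod_i (e^{ep x_i} + e^{-ep x_i}): B multiplies the spatial
      weight by exactly 1/(1 - n ep^2), which is close to 1 for small ep.  As every solution is
      O(t^r), the maximal solution is the only one that is positive right after t = 0, and
      every nontrivial solution is a translate of it.
    - Iterating Phi downwards from the supersolution Q t^r e^{Nt} (1 + |x|_1)^b converges by
      the same contraction, so that a nontrivial solution exists.

    The lower integral (the supremum over simple functions below) is monotone, homogeneous, and
    subadditive as soon as one of the two summands is measurable.  This is all that is needed, so
    that no measurability of mu in space or in time has to be established. *)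

(** * Integrals of possibly non-measurable functions (suffix [_nm]) *)

(** As [p < 1], the source is not Lipschitz at zero and uniqueness does fail: a solution may stay at
    zero for any length of time. The lower bound restores uniqueness. A function v above (E t
    |x|^sigma)^r has v^(1-p) >= E t |x|^sigma, so the slope p V v^(p-1) of the source is at most p
    vu / (E t) = q r / t: the growth of V cancels against that of v and only a ratio of constants is
    left. This slope is not integrable at t = 0, hence the factor t^r in the weight: the integral of
    (q r / s) s^r over [0, t] is q t^r. Short times bring no gain, so q < 1 is needed, and a
    constant smaller than E would enlarge the factor. The value E = eps0 vl / r comes from
    integrating s^(r-1) over [0, t]. Existence serves one implication: if the maximal solution were
    zero, its translates would be trivial. Monotone convergence would ask for measurability, so the
    limit is carried through Phi by the geometric rate of the contraction. *)

Section lower_integral.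
Context d (T : measurableType d) (R : realType) (mu : {measure set T -> \bar R}).
Local Open Scope ereal_scope.
Import HBNNSimple.

Lemma ge0_le_integral_nm (D : set T) (f g : T -> \bar R) :
  (forall x, D x -> 0 <= f x) -> (forall x, D x -> f x <= g x) ->
  \int[mu]_(x in D) f x <= \int[mu]_(x in D) g x.
Proof.
move=> f0 fg; rewrite integral_mkcond [leRHS]integral_mkcond.
have g0 x : D x -> 0 <= g x by move=> Dx; exact: le_trans (f0 _ Dx) (fg _ Dx).
rewrite !ge0_integralTE; [|exact: erestrict_ge0..].
apply: ereal_sup_le => _ [h /= hf <-].
exists h => //= x; apply: le_trans (hf x) _.
by rewrite !patchE; case: ifPn => // /[!inE] /fg.
Qed.

(* A simple function h <= f + g is at most (h - g)^+ + g, where (h - g)^+ is measurable and below f. *)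
Lemma ge0_integralD_le_nm (D : set T) (f g : T -> \bar R) : measurable D ->
  (forall x, D x -> 0 <= f x) -> (forall x, D x -> 0 <= g x) ->
  measurable_fun D g ->
  \int[mu]_(x in D) (f x + g x) <= \int[mu]_(x in D) f x + \int[mu]_(x in D) g x.
Proof.
move=> mD f0 g0 /(measurable_restrictT _ mD) mg.
rewrite !(integral_mkcond D) erestrictD.
have F0 : forall x, 0 <= (f \_ D) x by exact: erestrict_ge0.
have G0 : forall x, 0 <= (g \_ D) x by exact: erestrict_ge0.
set F := f \_ D in F0 *; set G := g \_ D in mg G0 *.
rewrite [leLHS]ge0_integralTE; last by move=> x; exact: adde_ge0.
apply: ge_ereal_sup => _ [h /= hf <-].
pose k x := maxe ((h x)%:E - G x) 0.
have k0 x : 0 <= k x by rewrite /k le_max lexx orbT.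
have mk : measurable_fun setT k.
  apply: measurable_maxe => //; apply: emeasurable_funB => //.
  exact/measurable_EFinP.
have -> : sintegral mu h = \int[mu]_x (h x)%:E by rewrite integralT_nnsfun.
apply: (@le_trans _ _ (\int[mu]_x (k x + G x))).
  apply: ge0_le_integral_nm => x _; first by rewrite lee_fin.
  rewrite /k; have := G0 x; case: (G x) => [r| |] //= r0.
    by rewrite -leeBlDr// le_max lexx.
  by rewrite addey ?leey// gt_eqF// (@lt_le_trans _ _ 0) ?ltNyr// le_max lexx orbT.
rewrite ge0_integralD//; apply: leeD => //; apply: ge0_le_integral_nm => // x _.
rewrite /k ge_max F0 andbT; have : (h x)%:E <= F x + G x := hf x; have := G0 x.
case: (G x) => [r| |] r0 //; last by rewrite leNye.
by move=> H; rewrite leeBlDr.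
Qed.

(** Scaling the simple functions below f gives one inequality; the other is the same inequality for
    the factor 1/c. *)
Lemma ge0_integralZl_nm (D : set T) (f : T -> \bar R) (c : R) :
  (forall x, D x -> 0 <= f x) -> (0 <= c)%R ->
  \int[mu]_(x in D) (c%:E * f x) = c%:E * \int[mu]_(x in D) f x.
Proof.
move=> f0; rewrite le_eqVlt => /predU1P[<-|c0].
  by rewrite mul0e; under eq_integral do rewrite mul0e; rewrite integral0.
have main (b : R) (g : T -> \bar R) : (0 < b)%R -> (forall x, D x -> 0 <= g x) ->
    b%:E * \int[mu]_(x in D) g x <= \int[mu]_(x in D) (b%:E * g x).
  move=> b0 g0; rewrite -lee_pdivlMl//.
  rewrite [leLHS]integral_mkcond ge0_integralTE; last exact: erestrict_ge0.
  apply: ge_ereal_sup => _ [h /= hf <-]; rewrite lee_pdivlMl// -sintegralrM.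
  rewrite integral_mkcond ge0_integralTE; last first.
    by apply: erestrict_ge0 => x Dx; rewrite mule_ge0 ?g0// lee_fin ltW.
  apply: ereal_sup_ubound; exists (scale_nnsfun h (ltW b0)) => //= x.
  rewrite erestrict_scale EFinM.
  by apply: lee_wpmul2l => //; rewrite lee_fin ltW.
apply/eqP; rewrite eq_le main// andbT.
rewrite -lee_pdivrMl//.
have cf0 x : D x -> 0 <= c%:E * f x.
  by move=> Dx; rewrite mule_ge0 ?f0// lee_fin ltW.
have ci0 : (0 < c^-1)%R by rewrite invr_gt0.
apply: (le_trans (main _ _ ci0 cf0)).
apply: ge0_le_integral_nm => x Dx.
  by rewrite mule_ge0// ?cf0// lee_fin ltW.
by rewrite muleA -EFinM mulVf ?gt_eqF// mul1e.
Qed.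

Lemma ge0_subset_integral_nm (A B : set T) (f : T -> \bar R) :
  A `<=` B -> (forall x, B x -> 0 <= f x) ->
  \int[mu]_(x in A) f x <= \int[mu]_(x in B) f x.
Proof.
move=> AB f0; rewrite integral_mkcond [leRHS]integral_mkcond.
apply: ge0_le_integral_nm => x _; rewrite !patchE; case: ifPn => //.
  by rewrite inE => /AB/f0.
  by rewrite inE => /AB Bx; rewrite mem_set.
by move=> _; case: ifPn => //; rewrite inE => /f0.
Qed.

End lower_integral.

(** * Translation invariance of the one-dimensional integral *)

Section translation.
Variable R : realType.
Notation leb := (@lebesgue_measure R).
Local Open Scope ereal_scope.
Import HBNNSimple.

Definition shiftr (k : R) (x : measurableTypeR R) : measurableTypeR R := (x + k)%R.

Lemma measurable_shiftr k : measurable_fun [set: measurableTypeR R] (shiftr k).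
Proof. by have := measurable_funD (@measurable_id _ (measurableTypeR R) setT)
  (@measurable_cst _ _ (measurableTypeR R) R setT k). Qed.

HB.instance Definition _ k :=
  isMeasurableFun.Build _ _ _ _ (shiftr k) (measurable_shiftr k).

Lemma lebesgue_measure_shift (k : R) (A : set R) : measurable A ->
  pushforward leb (shiftr k) A = leb A.
Proof.
move=> mA; apply/esym/lebesgue_measure_unique => //= _ [[a b]] _ <-.
rewrite /pushforward/= (_ : shiftr k @^-1` `]a, b] = `](a - k)%R, (b - k)%R]%classic).
  rewrite !lebesgue_measure_itv/= !lte_fin ltrD2r; case: ifPn => // _.
  by rewrite -!EFinB opprB addrA subrK.
by apply/seteqP; split => x /=; rewrite !in_itv/= /shiftr ltrBlDr lerBrDr.
Qed.

Lemma ge0_integral_shift (k : R) (f : R -> \bar R) : measurable_fun setT f ->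
  (forall x, 0 <= f x) -> \int[leb]_x f (x + k)%R = \int[leb]_x f x.
Proof.
move=> mf f0.
transitivity (\int[pushforward leb (shiftr k)]_x f x).
  by rewrite (ge0_integral_pushforward (measurable_shiftr k)).
by apply: eq_measure_integral => A mA _; exact: lebesgue_measure_shift.
Qed.

(** Each simple function below the shifted f is shifted back, where the measurable case applies; the
    opposite shift gives the reverse inequality. *)
Lemma ge0_integral_shift_nm (k : R) (f : R -> \bar R) :
  (forall x, 0 <= f x) -> \int[leb]_x f (x + k)%R = \int[leb]_x f x.
Proof.
have main (l : R) (g : R -> \bar R) : (forall x, 0 <= g x) ->
    \int[leb]_x g (x + l)%R <= \int[leb]_x g x.
  move=> g0; rewrite [leLHS]ge0_integralTE//.
  apply: ge_ereal_sup => _ [h /= hg <-].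
  have -> : sintegral leb h = \int[leb]_x (h x)%:E by rewrite integralT_nnsfun.
  rewrite -(@ge0_integral_shift (- l)%R (fun x => (h x)%:E)).
  - apply: ge0_le_integral_nm => x _; first by rewrite lee_fin.
    by apply: le_trans (hg _) _; rewrite subrK.
  - apply/measurable_EFinP; exact: (measurable_funPT h).
  - by move=> x; rewrite lee_fin.
move=> f0; apply/eqP; rewrite eq_le main//=.
have := main (- k)%R (fun x => f (x + k)%R) (fun x => f0 _).
by under eq_integral do rewrite subrK.
Qed.

(** Meant for integrands that only start at time [k]: as f vanishes on [0, k), no mass is lost when
    the negative times produced by the shift are cut off. *)
Lemma ge0_integral_itv_shift_nm (k t : R) (f : R -> \bar R) :
  (forall x, (0 <= x <= t + k)%R -> 0 <= f x) -> (0 <= k)%R ->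
  (forall x, (0 <= x < k)%R -> f x = 0) ->
  \int[leb]_(x in (`[0%R, (t + k)%R]%classic : set R)) f x =
  \int[leb]_(x in (`[0%R, t]%classic : set R)) f (x + k)%R.
Proof.
move=> f0 k0 fk; rewrite integral_mkcond -(@ge0_integral_shift_nm k); last first.
  by apply: erestrict_ge0 => x /=; rewrite in_itv/=; exact: f0.
rewrite [RHS]integral_mkcond; apply: eq_integral => x _.
rewrite !patchE !mem_setE !in_itv/= lerD2r.
have [x0|x0] := leP 0%R x; first by rewrite addr_ge0.
rewrite /=; case: ifPn => // /andP[xk0 xt]; rewrite fk// xk0/=.
by rewrite gtrDr.
Qed.

End translation.

(** * Iterated integrals and the Bessel kernel *)

Section iterated_integral.
Variable R : realType.
Notation leb := (@lebesgue_measure R).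

Lemma row_mx_cons0 n (t : R) (y : 'rV[R]_n) :
  (row_mx (\row_(j < 1) t) y : 'rV[R]_n.+1) ord0 ord0 = t.
Proof.
transitivity ((\row_(j < 1) t) ord0 ord0 : R); last by rewrite mxE.
rewrite -(row_mxEl (\row_(j < 1) t) y).
have -> : lshift n (@ord0 0) = @ord0 n by apply: val_inj.
by [].
Qed.

Lemma row_mx_consS n (t : R) (y : 'rV[R]_n) (i : 'I_n) :
  (row_mx (\row_(j < 1) t) y : 'rV[R]_n.+1) ord0 (lift ord0 i) = y ord0 i.
Proof. by rewrite -rshift1; exact: (row_mxEr (\row_(j < 1) t) y ord0 i). Qed.

(* The condition on g under which [int_Rn (f + g) <= int_Rn f + int_Rn g] for every f >= 0. *)
Fixpoint Rn_measurable (n : nat) : ('rV[R]_n -> \bar R) -> Prop :=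
  match n with
  | 0 => fun=> True
  | n'.+1 => fun f =>
      (forall t, Rn_measurable (fun y : 'rV[R]_n' => f (row_mx (\row_(j < 1) t) y)))
      /\ measurable_fun [set: R]
           (fun t => int_Rn (fun y : 'rV[R]_n' => f (row_mx (\row_(j < 1) t) y)))
  end.

Local Open Scope ereal_scope.

Lemma int_Rn_ge0 n (f : 'rV[R]_n -> \bar R) :
  (forall y, 0 <= f y) -> 0 <= int_Rn f.
Proof.
elim: n f => [|n IH] f f0 //=.
by apply: integral_ge0 => t _; apply: IH.
Qed.

Lemma le_int_Rn n (f g : 'rV[R]_n -> \bar R) :
  (forall y, 0 <= f y) -> (forall y, f y <= g y) -> int_Rn f <= int_Rn g.
Proof.
elim: n f g => [|n IH] f g f0 fg //=.
by apply: ge0_le_integral_nm => t _; [exact: int_Rn_ge0|exact: IH].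
Qed.

Lemma int_RnD_le n (f g : 'rV[R]_n -> \bar R) :
  (forall y, 0 <= f y) -> (forall y, 0 <= g y) -> Rn_measurable g ->
  int_Rn (fun y => f y + g y) <= int_Rn f + int_Rn g.
Proof.
elim: n f g => [|n IH] f g f0 g0 //= [mg1 mg2].
rewrite -/int_Rn in mg2 *.
apply: (@le_trans _ _ (\int[leb]_t (int_Rn (fun y : 'rV[R]_n => f (row_mx (\row_(j < 1) t) y))
   + int_Rn (fun y : 'rV[R]_n => g (row_mx (\row_(j < 1) t) y))))).
  apply: ge0_le_integral_nm => t _; first by apply: int_Rn_ge0 => y; exact: adde_ge0.
  by apply: IH.
by apply: ge0_integralD_le_nm => // t _; exact: int_Rn_ge0.
Qed.

Lemma int_RnZl n (f : 'rV[R]_n -> \bar R) (c : R) :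
  (forall y, 0 <= f y) -> (0 <= c)%R ->
  int_Rn (fun y => c%:E * f y) = c%:E * int_Rn f.
Proof.
move=> + c0; elim: n f => [|n IH] f f0 //=.
rewrite -ge0_integralZl_nm//; last by move=> t _; exact: int_Rn_ge0.
by apply: eq_integral => t _; rewrite IH.
Qed.

Lemma eq_int_Rn n (f g : 'rV[R]_n -> \bar R) : f =1 g -> int_Rn f = int_Rn g.
Proof. by move=> /funext ->. Qed.

Lemma int_Rn_box n (al : 'I_n -> R) (l : R) : (0 <= l)%R ->
  int_Rn (fun y : 'rV[R]_n =>
    (\prod_(i < n) \1_(`[al i, (al i + l)%R]%classic : set R) (y ord0 i))%:E)
  = (l ^+ n)%:E.
Proof.
move=> l0; elim: n al => [|n IH] al /=; first by rewrite big_ord0 expr0.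
transitivity (\int[leb]_t ((l ^+ n)%:E * (\1_(`[al ord0, (al ord0 + l)%R]%classic : set R) t)%:E)).
  apply: eq_integral => t _.
  under eq_int_Rn => y.
    rewrite big_ord_recl row_mx_cons0.
    under eq_bigr do rewrite row_mx_consS.
    rewrite EFinM; over.
  rewrite int_RnZl//; last by move=> y; rewrite lee_fin; apply: prodr_ge0.
  by rewrite IH muleC.
rewrite ge0_integralZl//; last by rewrite lee_fin exprn_ge0.
  rewrite integral_indic//= setIT lebesgue_measure_itv/= lte_fin ltrDl.
  have [l1|l1] := ltP 0%R l; first by rewrite -EFinB addrAC subrr add0r -EFinM exprSr.
  by rewrite mule0 exprSr (le_anti (y := 0%R) (_ : (l <= 0 <= l)%R)) ?mulr0// l1.
by apply/measurable_EFinP; exact: measurable_indic.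
Qed.

End iterated_integral.

(** * One-dimensional Gaussian integrals *)

Section gauss.
Variable R : realType.
Notation leb := (@lebesgue_measure R).

Lemma integral_gauss_mean (m s : R) : 0 < s ->
  (\int[leb]_t (expR (- ((t - m) ^+ 2 / (4 * s))))%:E = ((4 * pi * s) `^ 2^-1)%:E)%E.
Proof.
(* The heat kernel at time s is the normal density of variance 2 s. *)
move=> s0; set sd := Num.sqrt (2 * s).
have sd2 : sd ^+ 2 = 2 * s by rewrite sqr_sqrtr// mulr_ge0// ltW.
have sd0 : sd != 0 by rewrite sqrtr_eq0 -ltNge mulr_gt0.
have pk0 := normal_peak_gt0 sd0.
have E : normal_peak sd = ((4 * pi * s) `^ 2^-1)^-1.
  rewrite /normal_peak sd2 powR12_sqrt ?mulr_ge0 ?pi_ge0 ?(ltW s0)//.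
  by congr (Num.sqrt _)^-1; rewrite -mulr_natl; ring.
have P0 : 0 < (4 * pi * s) `^ 2^-1 by rewrite powR_gt0// !mulr_gt0 ?pi_gt0.
have := integral_normal_pdf m sd.
rewrite normal_pdfE//.
under eq_integral do rewrite EFinM.
rewrite ge0_integralZl//; last first.
- by rewrite lee_fin ltW.
- by move=> x _; rewrite lee_fin expR_ge0.
- by apply/measurable_EFinP; exact: measurable_normal_fun.
rewrite E => H.
have -> : (fun t => (expR (- ((t - m) ^+ 2 / (4 * s))))%:E) = fun t => (normal_fun m sd t)%:E.
  apply/funext => t; rewrite /normal_fun sd2 mulNr; congr (expR (- (_ / _)))%:E.
  by rewrite -mulr_natl; ring.
set I := (\int[_]_x _)%E in H *.
rewrite -[LHS]mul1e -[1%E](_ : ((4 * pi * s) `^ 2^-1)%:E * (((4 * pi * s) `^ 2^-1)^-1)%:E = 1%E)%E.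
  by rewrite -muleA H mule1.
by rewrite -EFinM mulfV// gt_eqF.
Qed.

(** Twice a hyperbolic cosine: an eigenfunction of convolution with every centred Gaussian that is
    comparable to e^{ep |t|}. *)
Definition expch (ep t : R) : R := expR (ep * t) + expR (- (ep * t)).

Lemma expch_gt0 ep t : 0 < expch ep t.
Proof. by rewrite addr_gt0 ?expR_gt0. Qed.

Lemma measurable_expch ep : measurable_fun [set: R] (expch ep).
Proof.
apply: measurable_funD; apply: measurableT_comp => //.
by apply: measurable_funN.
Qed.

(** Completing the square: each of the two exponentials moves the mean of the Gaussian by 2 ep s and
    leaves the factor e^{ep^2 s}. *)
Lemma integral_gauss_expch (ep x s : R) : 0 < s ->
  (\int[leb]_t (expR (- (t ^+ 2 / (4 * s))) * expch ep (x - t))%:E =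
    ((4 * pi * s) `^ 2^-1 * expR (ep ^+ 2 * s) * expch ep x)%:E)%E.
Proof.
move=> s0.
pose g m t := (expR (- ((t - m) ^+ 2 / (4 * s))))%:E : \bar R.
have mg m : measurable_fun setT (g m).
  apply/measurable_EFinP; apply: measurableT_comp => //.
  apply: measurable_funN; apply: measurable_funM => //.
  by apply: measurable_funX; apply: measurable_funB.
have mkg (k m : R) : measurable_fun setT (fun t => k%:E * g m t)%E.
  by apply: measurable_funeM; exact: mg.
have g0 m t : (0 <= g m t)%E by rewrite lee_fin expR_ge0.
transitivity (\int[leb]_t ((expR (ep ^+ 2 * s + ep * x))%:E * g (- (2 * ep * s))%R t
   + (expR (ep ^+ 2 * s - ep * x))%:E * g (2 * ep * s)%R t))%E.
  apply: eq_integral => t _; rewrite -!EFinM -EFinD; congr EFin.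
  rewrite /expch mulrDr -!expRD; congr (expR _ + expR _); field;
    by rewrite gt_eqF.
rewrite ge0_integralD//=; last 4 first.
- by move=> t _; rewrite mule_ge0// lee_fin expR_ge0.
- exact: mkg.
- by move=> t _; rewrite mule_ge0// lee_fin expR_ge0.
- exact: mkg.
rewrite !ge0_integralZl//; try by rewrite lee_fin expR_ge0.
all: try exact: mg.
rewrite !integral_gauss_mean// -!EFinM -EFinD /expch !expRD; congr EFin; ring.
Qed.

End gauss.

(** * The Bessel kernel as a mixture of Gaussians, and its action on the exponential weight *)

Section gauss_mixture.
Variables (R : realType) (ep : R).
Notation leb := (@lebesgue_measure R).

(** The power -1 stands for division by 4 s, so that joint measurability on the plane follows from
    that of power functions. The two agree for s > 0, and the mixing densities used below vanish for
    s <= 0. *)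
Let gf (x t s : R) : R := expR (- (t ^+ 2 * (4 * s) `^ (-1))) * expch ep (x - t).
Let gi (x s : R) : R := (4 * pi * s) `^ 2^-1 * expR (ep ^+ 2 * s) * expch ep x.

Let gf_ge0 x t s : 0 <= gf x t s.
Proof. by rewrite mulr_ge0 ?expR_ge0// ltW// expch_gt0. Qed.

Let gi_ge0 x s : 0 <= gi x s.
Proof. by rewrite !mulr_ge0 ?expR_ge0 ?powR_ge0// ltW// expch_gt0. Qed.

Let measurable_iv : measurable_fun [set: R] (fun s : R => (4 * s) `^ (-1)).
Proof.
apply: (measurableT_comp (measurable_powR (-1))).
exact: mulrl_measurable.
Qed.

Let measurable_gf x : measurable_fun [set: R * R] (fun z : R * R => gf x z.1 z.2).
Proof.
apply: measurable_funM.
  apply: measurableT_comp => //; apply: measurable_funN; apply: measurable_funM.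
    by apply: measurable_funX; exact: measurable_fst.
  exact: (measurableT_comp measurable_iv measurable_snd).
apply: (measurableT_comp (measurable_expch ep)).
by apply: measurable_funB => //; exact: measurable_fst.
Qed.

Let measurable_gf2 x t : measurable_fun [set: R] (gf x t).
Proof.
exact: (measurableT_comp (measurable_gf x) (measurable_pair1 t)).
Qed.

Let measurable_gi x : measurable_fun [set: R] (gi x).
Proof.
apply: measurable_funM => //; apply: measurable_funM.
  by apply: (measurableT_comp (measurable_powR _)); exact: mulrl_measurable.
by apply: measurableT_comp => //; exact: mulrl_measurable.
Qed.

(* The Bessel kernel is a mixture over s of products of one-dimensional Gaussians, so Tonelli
   is only needed in the two variables (s, y_i), one coordinate at a time. *)
Lemma gauss_mixture n (x : 'I_n -> R) (c : R -> R) :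
  measurable_fun setT c -> (forall s, 0 <= c s) -> (forall s, s <= 0 -> c s = 0) ->
  let f (y : 'rV[R]_n) := (\int[leb]_s (c s * \prod_(i < n) gf (x i) (y ord0 i) s)%:E)%E in
  Rn_measurable f /\
  int_Rn f = (\int[leb]_s (c s * \prod_(i < n) gi (x i) s)%:E)%E.
Proof.
elim: n x c => [|n IH] x c mc c0 cneg f.
  split; [exact: I|apply: eq_integral => s _].
  by rewrite !big_ord0.
(* The factor of the first coordinate is absorbed into the mixing density; this is why the induction
   runs over all densities [c]. *)
pose ct t s := c s * gf (x ord0) t s.
have fE t (y : 'rV[R]_n) : f (row_mx (\row_(j < 1) t) y) =
    (\int[leb]_s (ct t s * \prod_(i < n) gf (x (lift ord0 i)) (y ord0 i) s)%:E)%E.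
  rewrite /f; apply: eq_integral => s _.
  rewrite big_ord_recl row_mx_cons0 mulrA; congr (_ * _)%:E.
  by apply: eq_bigr => i _; rewrite row_mx_consS.
have mct t : measurable_fun setT (ct t) by apply: measurable_funM.
have ct0 t s : 0 <= ct t s by rewrite mulr_ge0.
have ctneg t s : s <= 0 -> ct t s = 0 by move=> s0; rewrite /ct cneg// mul0r.
have IHt t := IH (fun i => x (lift ord0 i)) (ct t) (mct t) (ct0 t) (ctneg t).
pose h (z : R * R) := (ct z.1 z.2 * \prod_(i < n) gi (x (lift ord0 i)) z.2)%:E.
have mh : measurable_fun setT h.
  apply/measurable_EFinP; apply: measurable_funM.
    apply: measurable_funM; last exact: measurable_gf.
    exact: (measurableT_comp mc measurable_snd).
  apply: measurable_prod => i _.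
  exact: (measurableT_comp (measurable_gi _) measurable_snd).
have h0 z : (0 <= h z)%E by rewrite lee_fin mulr_ge0// prodr_ge0.
have intE t : int_Rn (fun y : 'rV[R]_n => f (row_mx (\row_(j < 1) t) y)) =
    (\int[leb]_s h (t, s))%E.
  rewrite (eq_int_Rn (fE t)) (IHt t).2 /h/=.
  by apply: eq_integral.
split.
  split => [t|].
    rewrite (_ : (fun y => _) = fun y : 'rV[R]_n =>
       (\int[leb]_s (ct t s * \prod_(i < n) gf (x (lift ord0 i)) (y ord0 i) s)%:E)%E).
      exact: (IHt t).1.
    by apply/funext => y; exact: fE.
  rewrite (_ : (fun t => _) = fun t => (\int[leb]_s h (t, s))%E); last exact/funext.
  exact: (@measurable_fun_fubini_tonelli_F _ _ _ _ R leb h mh h0).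
transitivity (\int[leb]_t \int[leb]_s h (t, s))%E.
  by apply: eq_integral => t _; rewrite -intE.
rewrite (@fubini_tonelli _ _ _ _ _ leb leb h mh h0); apply: eq_integral => s _.
have [s0|s0] := ltP 0 s; last first.
  rewrite cneg// mul0r; apply: integral0_eq => t _.
  by rewrite /h/= ctneg// mul0r.
transitivity (\int[leb]_t ((c s * \prod_(i < n) gi (x (lift ord0 i)) s)%:E *
   (expR (- (t ^+ 2 / (4 * s))) * expch ep (x ord0 - t))%:E))%E.
  apply: eq_integral => t _; rewrite /h/= -EFinM; congr EFin.
  rewrite /ct /gf powR_inv1 ?mulr_ge0 ?(ltW s0)//; ring.
rewrite ge0_integralZl_nm; last 2 first.
- by move=> t _; rewrite lee_fin mulr_ge0 ?expR_ge0// ltW// expch_gt0.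
- by rewrite mulr_ge0// prodr_ge0.
rewrite integral_gauss_expch// -EFinM; congr EFin.
by rewrite big_ord_recl -[X in _ * X = _]/(gi (x ord0) s); ring.
Qed.

Definition phi n (x : 'rV[R]_n) : R := \prod_(i < n) expch ep (x ord0 i).

Lemma phi_gt0 n (x : 'rV[R]_n) : 0 < phi x.
Proof. by apply: prodr_gt0 => i _; exact: expch_gt0. Qed.

Let cB (n : nat) (s : R) : R :=
  \1_(`]0, +oo[%classic : set R) s * ((4 * pi * s) `^ (- (n%:R / 2)) * expR (- s)).

Lemma Bker_phi_mixture n (x y : 'rV[R]_n) :
  (Bker y * (phi (x - y))%:E)%E =
  (\int[leb]_s (cB n s * \prod_(i < n) gf (x ord0 i) (y ord0 i) s)%:E)%E.
Proof.
have ev s : s \in (`]0, +oo[%classic : set R) -> 0 < s.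
  by rewrite inE/= in_itv/= andbT.
have -> : Bker y = (\int[leb]_(s in (`]0%R, +oo[%classic : set R)) ((4 * pi * s) `^ (- (n%:R / 2)) *
    expR (- s - enorm y ^+ 2 * (4 * s) `^ (-1)))%:E)%E.
  by apply: eq_integral => s /ev s0; rewrite powR_inv1// mulr_ge0// ltW.
rewrite muleC -ge0_integralZl_nm; last 2 first.
- by move=> s _; rewrite lee_fin mulr_ge0 ?powR_ge0 ?expR_ge0.
- by rewrite ltW// phi_gt0.
rewrite integral_mkcond; apply: eq_integral => s _.
rewrite patchE /cB indicE; case: ifPn => sin; last by rewrite !mul0r.
have s0 := ev _ sin.
rewrite mul1r -EFinM; congr EFin.
rewrite big_split/= /phi -expR_sum.
rewrite (_ : \sum_(i < n) _ = - (enorm y ^+ 2 * (4 * s) `^ (-1))); last first.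
  rewrite /enorm sqr_sqrtr ?sumr_ge0//; last by move=> i _; rewrite sqr_ge0.
  by rewrite mulr_suml -sumrN.
have -> : \prod_(i < n) expch ep ((x - y) ord0 i) = \prod_(i < n) expch ep (x ord0 i - y ord0 i).
  by apply: eq_bigr => i _; rewrite !mxE.
rewrite expRD; ring.
Qed.

Let measurable_cB n : measurable_fun [set: R] (cB n).
Proof.
apply: measurable_funM; first exact: measurable_indic.
apply: measurable_funM.
  by apply: (measurableT_comp (measurable_powR _)); exact: mulrl_measurable.
by apply: measurableT_comp => //; exact: measurable_funN.
Qed.

Let cB_ge0 n s : 0 <= cB n s.
Proof. by rewrite !mulr_ge0 ?powR_ge0 ?expR_ge0. Qed.

Let cB_le0 n s : s <= 0 -> cB n s = 0.
Proof.
move=> s0; rewrite /cB indicE memNset ?mul0r//=.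
by rewrite in_itv/= andbT => /lt_geF; rewrite s0.
Qed.

Lemma Rn_measurable_Bker_phi n (x : 'rV[R]_n) (c : R) : 0 <= c ->
  Rn_measurable (fun y => Bker y * (c * phi (x - y))%:E)%E.
Proof.
move=> c0.
rewrite (_ : (fun y => _) = fun y : 'rV[R]_n =>
  (\int[leb]_s ((c * cB n s) * \prod_(i < n) gf (x ord0 i) (y ord0 i) s)%:E)%E).
  apply: (@gauss_mixture n (x ord0) (fun s => c * cB n s) _ _ _).1.
  - exact: measurable_funM.
  - by move=> s; rewrite mulr_ge0.
  - by move=> s s0; rewrite cB_le0// mulr0.
apply/funext => y; rewrite EFinM muleCA Bker_phi_mixture -ge0_integralZl_nm//; last first.
  by move=> s _; rewrite lee_fin mulr_ge0// prodr_ge0.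
by apply: eq_integral => s _; rewrite -EFinM mulrA.
Qed.

(** [phi] is an eigenfunction of the Laplacian with eigenvalue n ep^2, and B inverts 1 - Laplacian.
    In the computation the powers of s cancel, and the exponential density of rate 1 - n ep^2
    remains. *)
Lemma Bconv_phi n (x : 'rV[R]_n) : n%:R * ep ^+ 2 < 1 ->
  Bconv (@phi n) x = ((1 - n%:R * ep ^+ 2)^-1 * phi x)%:E.
Proof.
move=> e1; set b := 1 - _; have b0 : 0 < b by rewrite subr_gt0.
rewrite /Bconv (eq_int_Rn (Bker_phi_mixture x)).
rewrite (gauss_mixture (x ord0) (measurable_cB n) (cB_ge0 n) (@cB_le0 n)).2.
transitivity (\int[leb]_s ((phi x * b^-1)%:E * (exponential_pdf b s)%:E))%E.
  pose G s := ((phi x * b^-1) * (b * expR (- b * s)))%:E : \bar R.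
  have mG D : measurable_fun D G.
    apply: measurable_funTS; apply/measurable_EFinP.
    apply: measurable_funM => //; apply: measurable_funM => //.
    by apply: measurableT_comp => //; exact: mulrl_measurable.
  transitivity (\int[leb]_(s in (`]0%R, +oo[%classic : set R)) G s)%E.
    rewrite [RHS]integral_mkcond; apply: eq_integral => s _.
    rewrite patchE /cB indicE; case: ifPn => sin; last by rewrite !mul0r.
    have s0 : 0 < s by move: sin; rewrite inE/= in_itv/= andbT.
    rewrite /G /gi big_split big_split/= !big_const_ord !iter_mulr_1 mul1r.
    rewrite -powR_mulrn ?powR_ge0// -powRrM -[_ ^+ n]expRM_natl powRN.
    rewrite (mulrC 2^-1) -/(phi x) -mulrA; congr EFin.
    have P0 : (4 * pi * s) `^ (n%:R / 2) != 0.
      by rewrite gt_eqF// powR_gt0// !mulr_gt0// pi_gt0.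
    rewrite (_ : - b * s = - s + n%:R * (ep ^+ 2 * s)) ?expRD; last by rewrite /b; ring.
    by field; rewrite P0 gt_eqF.
  rewrite integral_itv_obnd_cbnd// integral_mkcond; apply: eq_integral => s _.
  rewrite /exponential_pdf !patchE; case: ifPn => _; last by rewrite mule0.
  by rewrite -EFinM.
rewrite ge0_integralZl_nm; last 2 first.
- by move=> s _; rewrite lee_fin exponential_pdf_ge0// ltW.
- by rewrite ltW// divr_gt0// phi_gt0.
by rewrite integral_exponential_pdf// mule1 mulrC.
Qed.
End gauss_mixture.

(** * Real inequalities *)

Section real_analysis.
Variable R : realType.
Notation leb := (@lebesgue_measure R).
Implicit Types p r t x y : R.

Lemma le_geometric (th x y D : R) : 0 <= th < 1 ->
  (forall k, x <= y + th ^+ k * D) -> x <= y.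
Proof.
move=> /andP[th0 th1] H.
have cv : (fun k : nat => y + th ^+ k * D) @ \oo --> (y + 0 * D : R).
  apply: cvgD; first exact: cvg_cst.
  apply: cvgM; last exact: cvg_cst.
  by apply: cvg_expr; rewrite ger0_norm.
rewrite mul0r addr0 in cv.
by apply: (cvgr_to_ge cv); exact: nearW.
Qed.

(** In logarithms the iteration is an affine contraction of ratio p with fixed point ln E / (1 - p),
    so the starting value is forgotten in the limit. *)
Lemma powR_iter_ge (p E c0 m : R) : 0 < p < 1 -> 0 < E -> 0 < c0 ->
  (forall k, iter k (fun c => E * c `^ p) c0 <= m) -> E `^ (1 - p)^-1 <= m.
Proof.
move=> /andP[p0 p1] E0 c00 H.
have q0 : 0 < 1 - p by rewrite subr_gt0.
pose c k := iter k (fun c => E * c `^ p) c0.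
have cp k : 0 < c k by elim: k => [|k IH] //=; rewrite mulr_gt0 ?powR_gt0.
have m0 : 0 < m := lt_le_trans c00 (H 0%N).
set L := (1 - p)^-1 * ln E.
have lnc k : ln (c k) = L + p ^+ k * (ln c0 - L).
  elim: k => [|k IH]; first by rewrite expr0 mul1r addrC subrK.
  have -> : c k.+1 = E * c k `^ p by [].
  rewrite lnM ?posrE ?powR_gt0// ln_powR IH exprS /L.
  by field; rewrite gt_eqF.
rewrite /powR gt_eqF// -/L -[m]lnK ?posrE// ler_expR.
apply: (@le_geometric p _ _ (L - ln c0)); first by rewrite ltW.
move=> k; have : ln (c k) <= ln m by rewrite ler_ln ?posrE//; exact: H.
rewrite lnc => h; lra.
Qed.

Lemma powR_tangent (p a h : R) : 0 < p < 1 -> 0 < a -> 0 <= h ->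
  (a + h) `^ p <= a `^ p + p * (h / a `^ (1 - p)).
Proof.
move=> /andP[p0 p1] a0 h0.
have q0 : 0 < 1 - p by rewrite subr_gt0.
have z0 : 0 <= h / a by rewrite divr_ge0// ltW.
(* Bernoulli's inequality, as Young's inequality for (1 + h/a)^p and 1 with the exponents 1/p and
   1/(1-p). *)
have bern : (1 + h / a) `^ p <= 1 + p * (h / a).
  have := @conjugate_powR R ((1 + h / a) `^ p) 1 p^-1 (1 - p)^-1.
  rewrite powR_ge0 ler01 !invr_gt0 p0 q0 !invrK powR1 mulr1 mul1r => /(_ isT isT isT isT).
  rewrite -powRrM mulfV ?gt_eqF// powRr1 ?addr_ge0// => H.
  apply: le_trans (H _) _; lra.
have -> : a + h = a * (1 + h / a) by field; rewrite gt_eqF.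
rewrite powRM ?addr_ge0 ?(ltW a0)//.
have -> : a `^ p + p * (h / a `^ (1 - p)) = a `^ p * (1 + p * (h / a)).
  have -> : a `^ (1 - p) = a / a `^ p by rewrite powRB ?powRr1 ?(ltW a0)// gt_eqF// implybT.
  by field; rewrite !gt_eqF// powR_gt0.
by rewrite ler_pM2l// powR_gt0.
Qed.

Lemma powR_subadd (p a h : R) : 0 < p <= 1 -> 0 <= a -> 0 <= h ->
  (a + h) `^ p <= a `^ p + h `^ p.
Proof.
move=> /andP[p0 p1] a0 h0.
have [S0|S0] := eqVneq (a + h) 0.
  by rewrite S0 powR0 ?gt_eqF// addr_ge0 ?powR_ge0.
have Sp : 0 < a + h by rewrite lt_neqAle eq_sym S0 addr_ge0.
(* A share z = b / (a + h) lies in [0, 1], so z <= z^p; the shares of a and h add up to 1. *)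
have key b : 0 <= b -> b <= a + h -> (a + h) `^ p * (b / (a + h)) <= b `^ p.
  move=> b0 bS.
  have [->|bn] := eqVneq b 0; first by rewrite mul0r mulr0 powR_ge0.
  have bp : 0 < b by rewrite lt_neqAle eq_sym bn.
  have -> : b `^ p = (a + h) `^ p * (b / (a + h)) `^ p.
    by rewrite -powRM ?(ltW Sp) ?divr_ge0 ?(ltW Sp)// mulrC divfK.
  rewrite ler_pM2l ?powR_gt0//; apply: ger1_powR => //.
  by rewrite divr_gt0//= ler_pdivrMr// mul1r.
have ha := key a a0; have hh := key h h0; rewrite lerDl in ha; rewrite lerDr in hh.
apply: le_trans (lerD (ha h0) (hh a0)).
by rewrite -mulrDr -mulrDl divff// mulr1.
Qed.

Lemma powR_le_expR (b de : R) : 0 <= b -> 0 < de ->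
  exists2 C : R, 0 < C & forall y, 0 <= y -> (1 + y) `^ b <= C * expR (de * y).
Proof.
rewrite le_eqVlt => /predU1P[<-|b0] de0.
  by exists 1 => // y y0; rewrite powRr0 mul1r -[leLHS]expR0 ler_expR mulr_ge0// ltW.
(* With z = de y / b one has e^z >= 1 + z and (1 + b/de) (1 + z) >= 1 + y; then take the power b. *)
exists ((1 + b / de) `^ b).
  by rewrite powR_gt0// addr_gt0// divr_gt0.
move=> y y0.
have -> : expR (de * y) = (expR (de * y / b)) `^ b by rewrite -expRM; congr expR; field; rewrite gt_eqF.
have bd0 : 0 <= b / de by rewrite divr_ge0// ltW.
rewrite -powRM ?expR_ge0 ?addr_ge0//.
apply: ge0_ler_powR; rewrite ?nnegrE ?(ltW b0)// ?addr_ge0 ?mulr_ge0 ?addr_ge0 ?expR_ge0//.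
have h := expR_ge1Dx (de * y / b).
have z0 : 0 <= de * y / b by rewrite divr_ge0 ?mulr_ge0 ?(ltW de0) ?(ltW b0).
apply: (@le_trans _ _ ((1 + b / de) * (1 + de * y / b))); last first.
  by rewrite ler_wpM2l// addr_ge0.
have -> : (1 + b / de) * (1 + de * y / b) = 1 + y + (b / de + de * y / b).
  by field; rewrite !gt_eqF.
by rewrite lerDl addr_ge0.
Qed.

(** The fundamental theorem of calculus; r > 1 makes the derivative continuous up to 0. The time
    weights below are reproduced by this formula, and N = 0 serves the lower bounds. *)
Lemma integral_powR_expR (r N t : R) : 1 < r -> 0 <= t ->
  (\int[leb]_(s in (`[0%R, t]%classic : set R))
     ((r * s `^ (r - 1) + N * s `^ r) * expR (N * s))%:E)%E = (t `^ r * expR (N * t))%:E.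
Proof.
move=> r1; rewrite le_eqVlt => /predU1P[<-|t0].
  by rewrite set_itv1 integral_set1 powR0 ?mul0r// gt_eqF// (lt_trans _ r1).
have r0 : 0 < r by rewrite (lt_trans _ r1).
have cexp x : {for x, continuous (fun s : R => expR (N * s))}.
  apply: continuous_comp; last exact: continuous_expR.
  exact: mulrl_continuous.
have cpow q x : 0 < x -> {for x, continuous (fun s : R => s `^ q)}.
  move=> x0; apply: differentiable_continuous; apply/derivable1_diffP.
  by apply: derivable_powR; rewrite in_itv/= x0.
pose f s := (r * s `^ (r - 1) + N * s `^ r) * expR (N * s).
pose F s := s `^ r * expR (N * s).
have cf x : 0 < x -> {for x, continuous f}.
  move=> x0; apply: continuousM => //; apply: continuousD.
    by apply: continuousM; [exact: cvg_cst|exact: cpow].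
  by apply: continuousM; [exact: cvg_cst|exact: cpow].
have cF x : 0 < x -> {for x, continuous F}.
  by move=> x0; apply: continuousM => //; exact: cpow.
have p0 q : 0 < q -> s `^ q @[s --> 0^'+] --> 0 `^ q.
  by move=> q0; rewrite powR0 ?gt_eqF//; exact: powR_cvg0.
have e0 : expR (N * s) @[s --> 0^'+] --> expR (N * 0).
  by apply: cvg_at_right_filter; exact: cexp.
have F0 : F s @[s --> 0^'+] --> F 0 by apply: cvgM => //; exact: p0.
have f0 : f s @[s --> 0^'+] --> f 0.
  apply: cvgM => //; apply: cvgD; apply: cvgM; try exact: cvg_cst; apply: p0 => //.
  by rewrite subr_gt0.
rewrite (@continuous_FTC2 _ f F)//.
- by rewrite /F powR0 ?gt_eqF// mul0r sube0.
- apply/(continuous_within_itvP _ t0); split => //.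
    by move=> x; rewrite in_itv/= => /andP[x0 _]; exact: cf.
  by apply: cvg_at_left_filter; exact: cf.
- split; [|exact: F0|].
    move=> x; rewrite in_itv/= => /andP[x0 _]; apply: derivableM.
      by apply: derivable_powR; rewrite in_itv/= x0.
    by apply: ex_derive; apply: is_derive1_comp.
  by apply: cvg_at_left_filter; exact: cF.
- move=> x; rewrite in_itv/= => /andP[x0 _].
  have d1 := is_derive1_powR r x0.
  have d2 : is_derive x (1:R) (fun s : R => expR (N * s)) (N * expR (N * x)).
    have dl : is_derive x (1 : R) (fun s : R => N * s) N.
      by apply: is_derive_eq; rewrite scaler1.
    have := is_derive1_comp (is_derive_expR (N * x)) dl.
    by rewrite mulrC.
  have dF : is_derive x (1 : R) F (f x).
    apply: (@is_derive_eq _ _ _ _ _ _ _ _ (is_deriveM d1 d2)).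
    by rewrite /f /GRing.scale/=; ring.
  by rewrite derive1E; exact: (@derive_val _ _ _ _ _ _ _ dF).
Qed.
End real_analysis.

(** The condition says that the contraction factor q / (1 - n ep^2) is below 1; with q = 0 it only
    ensures that B acts on [phi]. *)
Lemma exists_exponent (R : realType) (n : nat) (q : R) : 0 <= q -> q < 1 ->
  exists2 ep : R, 0 < ep & n%:R * ep ^+ 2 < 1 - q.
Proof.
move=> q0 q1; pose a := 1 - q.
have a0 : 0 < a by rewrite subr_gt0.
have a1 : a <= 1 by rewrite gerBl.
have n0 : 0 < n.+1%:R :> R by rewrite ltr0n.
exists (a / n.+1%:R); first by rewrite divr_gt0.
have e0 : 0 < a / n.+1%:R by rewrite divr_gt0.
have h1 : n%:R * (a / n.+1%:R) < a.
  by rewrite mulrCA gtr_pMr// -natr1 ltr_pdivrMr ?ltr_wpDl// mul1r ltrDl.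
have h2 : a / n.+1%:R <= a.
  by rewrite ler_piMr ?(ltW a0)// invf_le1// ler1n.
rewrite expr2 mulrA; apply: (@lt_le_trans _ _ (a * (a / n.+1%:R))).
  by rewrite ltr_pM2r.
by apply: le_trans h2; rewrite ler_piMl// ltW.
Qed.

(** * Weights and convolution with the Bessel kernel *)

Section weights.
Variables (R : realType) (n : nat).
Implicit Types x y : 'rV[R]_n.

(** The norm adapted to product weights: e^{ep |x|_1} factors over the coordinates and is bounded by
    [phi]. *)
Definition l1 x : R := \sum_(i < n) `|x ord0 i|.

Lemma l1_ge0 x : 0 <= l1 x.
Proof. exact: sumr_ge0. Qed.

Lemma coord_le_l1 x i : `|x ord0 i| <= l1 x.
Proof. by rewrite /l1 (bigD1 i)//= lerDl sumr_ge0. Qed.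

Lemma l1B x y : l1 (x - y) <= l1 x + l1 y.
Proof. by rewrite /l1 -big_split/=; apply: ler_sum => i _; rewrite !mxE ler_normB. Qed.

Lemma enorm_ge0 x : 0 <= enorm x.
Proof. exact: sqrtr_ge0. Qed.

Lemma enorm_le_l1 x : enorm x <= l1 x.
Proof.
rewrite /enorm -[leRHS]ger0_norm ?l1_ge0// -sqrtr_sqr; apply: ler_wsqrtr.
rewrite expr2 {1}/l1 mulr_suml; apply: ler_sum => i _.
by rewrite -real_normK ?num_real// expr2 ler_wpM2l// coord_le_l1.
Qed.

Lemma coord_le_enorm x i : `|x ord0 i| <= enorm x.
Proof.
rewrite -sqrtr_sqr; apply: ler_wsqrtr.
by rewrite (bigD1 i)//= lerDl sumr_ge0// => j _; rewrite sqr_ge0.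
Qed.

Lemma l1_le_enorm x : l1 x <= n%:R * enorm x.
Proof.
rewrite -[n in n%:R]card_ord mulr_natl -sumr_const.
by apply: ler_sum => i _; exact: coord_le_enorm.
Qed.

Lemma expch_ge (ep t : R) : 0 <= ep -> expR (ep * `|t|) <= expch ep t.
Proof.
move=> ep0; rewrite /expch; case: (ger0P t) => t0; first by rewrite lerDl expR_ge0.
by rewrite mulrN lerDr expR_ge0.
Qed.

Lemma expch_le (ep t M : R) : 0 <= ep -> `|t| <= M -> expch ep t <= 2 * expR (ep * M).
Proof.
move=> ep0; rewrite ler_norml => /andP[h1 h2]; rewrite /expch mulr_natl mulr2n.
by apply: lerD; rewrite ler_expR -?mulrN; apply: ler_wpM2l => //; lra.
Qed.

Lemma phi_ge_l1 (ep : R) x : 0 <= ep -> expR (ep * l1 x) <= phi ep x.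
Proof.
move=> ep0; rewrite /phi /l1 mulr_sumr expR_sum; apply: ler_prod => i _.
by rewrite expR_ge0 expch_ge.
Qed.

Lemma phi_ge1 (ep : R) x : 0 <= ep -> 1 <= phi ep x.
Proof.
move=> ep0; apply: le_trans (phi_ge_l1 _ ep0).
by rewrite -[leLHS]expR0 ler_expR mulr_ge0// l1_ge0.
Qed.

Lemma phiN (ep : R) x : phi ep (- x) = phi ep x.
Proof. by apply: eq_bigr => i _; rewrite mxE /expch mulrN opprK addrC. Qed.

Lemma phi_le (ep : R) x M : 0 <= ep -> (forall i, `|x ord0 i| <= M) ->
  phi ep x <= (2 * expR (ep * M)) ^+ n.
Proof.
move=> ep0 xM; rewrite -[n in _ ^+ n]card_ord -prodr_const; apply: ler_prod => i _.
by rewrite ltW ?expch_gt0// expch_le.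
Qed.

(** The summand 1 makes the polynomial weight submultiplicative for b >= 0, so that convolutions can
    be estimated by pulling out the value at x. *)
Definition W (b : R) x : R := (1 + l1 x) `^ b.

Lemma W_gt0 b x : 0 < W b x.
Proof. by rewrite powR_gt0// ltr_pwDl// l1_ge0. Qed.

Lemma W_subM b x y : 0 <= b -> W b (x - y) <= W b x * W b y.
Proof.
move=> b0; have X0 := l1_ge0 x; have Y0 := l1_ge0 y.
rewrite /W -powRM ?addr_ge0//; apply: ge0_ler_powR => //.
- by rewrite nnegrE addr_ge0// l1_ge0.
- by rewrite nnegrE mulr_ge0// addr_ge0.
- have := l1B x y => h.
  have : 0 <= l1 x * l1 y by rewrite mulr_ge0.
  rewrite mulrDl mul1r mulrDr mulr1 => ?; lra.
Qed.

Lemma enorm_powR_le_W b x : 0 <= b -> enorm x `^ b <= W b x.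
Proof.
move=> b0; apply: ge0_ler_powR => //; rewrite ?nnegrE ?enorm_ge0 ?addr_ge0 ?l1_ge0//.
by rewrite (le_trans (enorm_le_l1 x))// lerDr.
Qed.

Lemma W_le_phi b (ep : R) : 0 <= b -> 0 < ep ->
  exists2 C : R, 0 < C & forall x, W b x <= C * phi ep x.
Proof.
move=> b0 ep0; have [C C0 H] := powR_le_expR b0 ep0.
exists C => // x; apply: le_trans (H _ (l1_ge0 x)) _.
by rewrite ler_pM2l// phi_ge_l1// ltW.
Qed.

End weights.

(** * Convolution with the Bessel kernel: order, error terms, positivity *)

Section Bconv_lemmas.
Variables (R : realType) (n : nat).
Notation leb := (@lebesgue_measure R).
Implicit Types x y : 'rV[R]_n.
Local Open Scope ereal_scope.

Lemma Bker_ge0 y : 0 <= Bker y.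
Proof.
by apply: integral_ge0 => s _; rewrite lee_fin mulr_ge0 ?powR_ge0 ?expR_ge0.
Qed.

Lemma Bker_bounded_below (M : R) : exists2 b : R, (0 < b)%R &
  forall y, (forall i, `|y ord0 i| <= M)%R -> b%:E <= Bker y.
Proof.
(* Only s in [1, 2] is kept: the power and e^{-s} are smallest at s = 2, the Gaussian factor at s =
   1, with |y|^2 <= n M^2. *)
pose b : R := (((8 * pi) `^ (- (n%:R / 2))) * expR (- 2 - (n%:R * M ^+ 2) / 4))%R.
have b0 : (0 < b)%R by rewrite mulr_gt0 ?expR_gt0// powR_gt0// mulr_gt0// pi_gt0.
exists b => // y yM.
apply: (@le_trans _ _ (\int[leb]_(s in (`[1%R, 2%R]%classic : set R)) b%:E)).
  rewrite -[X in _ <= X]/(\int[leb]_(s in (`[1%R, 2%R]%classic : set R)) (cst b%:E) s).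
  rewrite integral_cst//= lebesgue_measure_itv/= lte_fin ltr1n/= -EFinB -EFinM lee_fin.
  by rewrite (_ : 2 - 1 = 1 :> R)%R ?mulr1//; lra.
apply: (@le_trans _ _ (\int[leb]_(s in (`[1%R, 2%R]%classic : set R))
   ((4 * pi * s) `^ (- (n%:R / 2)) * expR (- s - enorm y ^+ 2 / (4 * s)))%:E)); last first.
  apply: ge0_subset_integral_nm.
    by move=> s /=; rewrite !in_itv/= andbT => /andP[s1 _]; rewrite (lt_le_trans _ s1).
  by move=> s _; rewrite lee_fin mulr_ge0 ?powR_ge0 ?expR_ge0.
apply: ge0_le_integral_nm => s; first by rewrite lee_fin ltW.
rewrite /= in_itv/= => /andP[s1 s2]; rewrite lee_fin.
have s0 : (0 < s)%R by rewrite (lt_le_trans _ s1).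
have eM : (enorm y ^+ 2 <= n%:R * M ^+ 2)%R.
  rewrite /enorm sqr_sqrtr; last by apply: sumr_ge0 => i _; rewrite sqr_ge0.
  rewrite -[n in n%:R]card_ord mulr_natl -sumr_const; apply: ler_sum => i _.
  have M0 : (0 <= M)%R := le_trans (normr_ge0 _) (yM i).
  by rewrite -real_normK ?num_real// lerXn2r ?nnegrE.
apply: ler_pM; rewrite ?powR_ge0 ?expR_ge0//.
  rewrite !powRN lef_pV2 ?posrE ?powR_gt0// ?mulr_gt0 ?pi_gt0//.
  apply: ge0_ler_powR; rewrite ?nnegrE ?mulr_ge0 ?pi_ge0 ?(ltW s0)//.
  have := pi_ge0 R => P0; nra.
rewrite ler_expR; apply: lerB; first by rewrite lerN2.
rewrite ler_pdivrMr ?mulr_gt0//.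
have -> : (n%:R * M ^+ 2 / 4 * (4 * s) = s * (n%:R * M ^+ 2))%R by field.
apply: le_trans eM _.
by rewrite ler_peMl// mulr_ge0// sqr_ge0.
Qed.

Lemma Bconv_ge0 (f : 'rV[R]_n -> R) x : (forall y, 0 <= f y)%R -> 0 <= Bconv f x.
Proof.
by move=> f0; apply: int_Rn_ge0 => y; rewrite mule_ge0 ?Bker_ge0// lee_fin.
Qed.

Lemma le_Bconv (f g : 'rV[R]_n -> R) x :
  (forall y, 0 <= f y)%R -> (forall y, f y <= g y)%R -> Bconv f x <= Bconv g x.
Proof.
move=> f0 fg; apply: le_int_Rn => y.
  by rewrite mule_ge0 ?Bker_ge0// lee_fin.
by apply: lee_wpmul2l; rewrite ?Bker_ge0// lee_fin.
Qed.

Lemma BconvZ (f : 'rV[R]_n -> R) (c : R) x :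
  (forall y, 0 <= f y)%R -> (0 <= c)%R ->
  Bconv (fun y => c * f y)%R x = c%:E * Bconv f x.
Proof.
move=> f0 c0; rewrite /Bconv -int_RnZl//; last first.
  by move=> y; rewrite mule_ge0 ?Bker_ge0// lee_fin.
by apply: eq_int_Rn => y; rewrite EFinM muleCA.
Qed.

Lemma Bconv0 x : Bconv (fun=> 0%R) x = 0.
Proof.
transitivity (Bconv (fun=> 0 * 0 : R)%R x); first by rewrite mulr0.
by rewrite BconvZ// mul0e.
Qed.

(** Only the error term has to be measurable. The three centres are kept apart because the
    contraction uses x = x' = z, whereas equicontinuity compares x' with x under a weight centred at
    z = 0. *)
Lemma Bconv_le_add (ep c : R) (f g : 'rV[R]_n -> R) x x' z :
  (n%:R * ep ^+ 2 < 1)%R -> (0 <= c)%R ->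
  (forall y, 0 <= f y)%R -> (forall y, 0 <= g y)%R ->
  (forall y, f (x' - y) <= g (x - y) + c * phi ep (z - y))%R ->
  Bconv f x' <= Bconv g x + (c * ((1 - n%:R * ep ^+ 2)^-1 * phi ep z))%:E.
Proof.
move=> e1 c0 f0 g0 fg.
have p0 y : (0 <= c * phi ep y)%R by rewrite mulr_ge0// ltW// phi_gt0.
apply: (@le_trans _ _ (int_Rn (fun y => Bker y * (g (x - y))%:E +
    Bker y * (c * phi ep (z - y))%:E))).
  apply: le_int_Rn => y; first by rewrite mule_ge0 ?Bker_ge0// lee_fin.
  rewrite -ge0_muleDr ?lee_fin//; apply: lee_wpmul2l; rewrite ?Bker_ge0//.
  by rewrite -EFinD lee_fin.
apply: le_trans (int_RnD_le _ _ _) _.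
- by move=> y; rewrite mule_ge0 ?Bker_ge0// lee_fin.
- by move=> y; rewrite mule_ge0 ?Bker_ge0// lee_fin.
- exact: Rn_measurable_Bker_phi.
rewrite leeD2l// -[leLHS]/(Bconv (fun y => c * phi ep y)%R z) BconvZ//.
  by rewrite Bconv_phi// -EFinM.
by move=> y; rewrite ltW// phi_gt0.
Qed.

(** Submultiplicativity takes W(x) out of the integral; what is left is a moment of B, bounded
    through [phi] at the origin. *)
Lemma Bconv_W (b : R) : (0 <= b)%R -> exists2 K : R, (0 < K)%R &
  forall x, Bconv (W b) x <= (K * W b x)%:E.
Proof.
move=> b0.
have [ep ep0 e1] := exists_exponent n (lexx 0) (@ltr01 R); rewrite subr0 in e1.
have [C C0 WC] := @W_le_phi R n b ep b0 ep0.
exists (C * ((1 - n%:R * ep ^+ 2)^-1 * phi ep (0 : 'rV[R]_n)))%R.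
  by rewrite !mulr_gt0 ?phi_gt0// invr_gt0 subr_gt0.
move=> x.
have H := @Bconv_le_add ep (W b x * C) (W b) (fun=> 0%R) x x 0 e1.
rewrite Bconv0 add0e in H.
rewrite (mulrC (C * _)%R) mulrA; apply: H => //.
- by rewrite mulr_ge0 ?(ltW C0)// ltW// W_gt0.
- by move=> y; rewrite ltW// W_gt0.
move=> y; rewrite add0r sub0r phiN; apply: le_trans (W_subM _ _ b0) _.
by rewrite -mulrA ler_pM2l ?W_gt0// WC.
Qed.

(** The box consists of displacements y on which kernel and shifted function are both bounded below;
    positivity is spread in space by this estimate. *)
Lemma Bconv_box (f : 'rV[R]_n -> R) x (al : 'I_n -> R) (l eta b : R) :
  (0 <= l)%R -> (0 <= eta)%R -> (0 <= b)%R -> (forall y, 0 <= f y)%R ->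
  (forall y, (forall i, al i <= y ord0 i <= al i + l)%R ->
     (eta <= f (x - y)%R)%R /\ b%:E <= Bker y) ->
  (b * eta * l ^+ n)%:E <= Bconv f x.
Proof.
move=> l0 e0 b0 f0 H.
have c0 : (0 <= b * eta)%R by rewrite mulr_ge0.
rewrite EFinM -(int_Rn_box al l0) -int_RnZl//; last first.
  by move=> y; rewrite lee_fin prodr_ge0.
apply: le_int_Rn => y; first by rewrite -EFinM lee_fin mulr_ge0// prodr_ge0.
have [yin|] := pselect (forall i, (al i <= y ord0 i <= al i + l)%R).
  rewrite big1 ?mule1; last first.
    by move=> i _; rewrite indicE mem_set//= in_itv/= yin.
  have [h1 h2] := H _ yin; rewrite EFinM; apply: lee_pmul => //; rewrite ?lee_fin//.
move=> /existsNP[i yi]; rewrite (bigD1 i)//= indicE memNset ?mul0r ?mule0//=.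
  by rewrite mule_ge0 ?Bker_ge0// lee_fin.
Qed.

End Bconv_lemmas.

(** * The integral operator and its contraction property *)

Section Phi.
Variables (R : realType) (n : nat) (V : 'rV[R]_n -> R) (p : R).
Hypotheses (V_ge0 : forall x, 0 <= V x) (p_gt0 : 0 < p).
Notation leb := (@lebesgue_measure R).
Implicit Types (x y : 'rV[R]_n) (v w mu : R -> 'rV[R]_n -> R).

Definition Phi mu (t : R) x : \bar R :=
  (\int[leb]_(tau in (`[0%R, t]%classic : set R)) Bconv (mu tau) x +
   \int[leb]_(tau in (`[0%R, t]%classic : set R))
     ((expR ((1 - p) * tau))%:E * Bconv (fun y => (V y * (mu tau y) `^ p)%R) x))%E.

Local Open Scope ereal_scope.

Let Bconv2_ge0 mu tau x : 0 <= Bconv (fun y => (V y * (mu tau y) `^ p)%R) x.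
Proof. by apply: Bconv_ge0 => y; rewrite mulr_ge0 ?powR_ge0. Qed.

Let exp_ge0 (s : R) : 0 <= (expR s)%:E.
Proof. by rewrite lee_fin expR_ge0. Qed.

Lemma le_Phi v w (t : R) x :
  (forall tau y, 0 <= tau <= t -> 0 <= v tau y <= w tau y)%R ->
  Phi v t x <= Phi w t x.
Proof.
move=> vw; apply: leeD; apply: ge0_le_integral_nm => tau; rewrite /= in_itv/= => tt.
- by apply: Bconv_ge0 => y; have /andP[] := vw tau y tt.
- by apply: le_Bconv => y; have /andP[] := vw tau y tt.
- by rewrite mule_ge0.
apply: lee_wpmul2l => //; apply: le_Bconv => y; first by rewrite mulr_ge0 ?powR_ge0.
have /andP[v0 vwy] := vw tau y tt.
by apply: ler_wpM2l => //; apply: ge0_ler_powR; rewrite ?nnegrE ?(ltW p_gt0)// (le_trans v0).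
Qed.

Lemma Phi_ge0 mu (t : R) x :
  (forall tau y, 0 <= tau <= t -> 0 <= mu tau y)%R -> 0 <= Phi mu t x.
Proof.
move=> m0; apply: adde_ge0; apply: integral_ge0 => tau; rewrite /= in_itv/= => tt.
  by apply: Bconv_ge0 => y; exact: m0.
by rewrite mule_ge0.
Qed.

Lemma Phi_nondecreasing mu (s t : R) x : (s <= t)%R ->
  (forall tau y, 0 <= tau <= t -> 0 <= mu tau y)%R -> Phi mu s x <= Phi mu t x.
Proof.
move=> st m0; apply: leeD; apply: ge0_subset_integral_nm => tau; rewrite /= !in_itv/=.
- by move=> /andP[-> /le_trans]; apply.
- by move=> tt; apply: Bconv_ge0 => y; exact: m0.
- by move=> /andP[-> /le_trans]; apply.
- by rewrite mule_ge0.
Qed.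

Lemma Phi0 mu x : Phi mu 0%R x = 0.
Proof. by rewrite /Phi set_itv1 !integral_set1 adde0. Qed.

(** All measurability is demanded of the error terms [G1] and [G2]. Two points x and x' are allowed
    so that the estimate serves both the contraction and the continuity in space. *)
Lemma Phi_le_add v w (t : R) x x' (G1 G2 : R -> R) :
  measurable_fun setT G1 -> measurable_fun setT G2 ->
  (forall tau y, 0 <= tau <= t -> 0 <= v tau y)%R ->
  (forall tau y, 0 <= tau <= t -> 0 <= w tau y)%R ->
  (forall tau, 0 <= tau <= t -> 0 <= G1 tau)%R ->
  (forall tau, 0 <= tau <= t -> 0 <= G2 tau)%R ->
  (forall tau, (0 <= tau <= t)%R -> Bconv (w tau) x' <= Bconv (v tau) x + (G1 tau)%:E) ->
  (forall tau, (0 <= tau <= t)%R -> Bconv (fun y => (V y * (w tau y) `^ p)%R) x' <=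
      Bconv (fun y => (V y * (v tau y) `^ p)%R) x + (G2 tau)%:E) ->
  Phi w t x' <= Phi v t x +
    \int[leb]_(tau in (`[0%R, t]%classic : set R)) (G1 tau + expR ((1 - p) * tau) * G2 tau)%:E.
Proof.
move=> mG1 mG2 v0 w0 G10 G20 H1 H2.
set D := (`[0%R, t]%classic : set R).
have mD : measurable D by exact: measurable_itv.
have inD tau : D tau -> (0 <= tau <= t)%R by rewrite /D/= in_itv.
have me2 : measurable_fun setT (fun tau => expR ((1 - p) * tau) * G2 tau)%R.
  by apply: measurable_funM => //; apply: measurableT_comp => //; exact: mulrl_measurable.
have e20 tau : D tau -> (0 <= (expR ((1 - p) * tau) * G2 tau)%:E).
  by move=> /inD Dt; rewrite lee_fin mulr_ge0 ?expR_ge0 ?G20.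
have G1e tau : D tau -> 0 <= (G1 tau)%:E by move=> /inD Dt; rewrite lee_fin G10.
have m1 : measurable_fun D (fun tau => (G1 tau)%:E).
  by apply: measurable_funTS; exact/measurable_EFinP.
have m2 : measurable_fun D (fun tau => (expR ((1 - p) * tau) * G2 tau)%:E).
  by apply: measurable_funTS; exact/measurable_EFinP.
have -> : \int[leb]_(tau in D) (G1 tau + expR ((1 - p) * tau) * G2 tau)%:E =
    \int[leb]_(tau in D) (G1 tau)%:E +
    \int[leb]_(tau in D) (expR ((1 - p) * tau) * G2 tau)%:E.
  by rewrite -(ge0_integralD leb mD G1e m1 e20 m2); apply: eq_integral => tau _.
have I1 : \int[leb]_(tau in D) Bconv (w tau) x' <=
    \int[leb]_(tau in D) Bconv (v tau) x + \int[leb]_(tau in D) (G1 tau)%:E.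
  apply: (@le_trans _ _ (\int[leb]_(tau in D) (Bconv (v tau) x + (G1 tau)%:E))).
    apply: ge0_le_integral_nm => tau /inD Dt; last exact: H1.
    by apply: Bconv_ge0 => y; exact: w0.
  apply: ge0_integralD_le_nm => // tau /inD Dt.
  by apply: Bconv_ge0 => y; exact: v0.
have I2 : \int[leb]_(tau in D) ((expR ((1 - p) * tau))%:E *
      Bconv (fun y => (V y * (w tau y) `^ p)%R) x') <=
    \int[leb]_(tau in D) ((expR ((1 - p) * tau))%:E *
      Bconv (fun y => (V y * (v tau y) `^ p)%R) x) +
    \int[leb]_(tau in D) (expR ((1 - p) * tau) * G2 tau)%:E.
  apply: (@le_trans _ _ (\int[leb]_(tau in D) ((expR ((1 - p) * tau))%:E *
      Bconv (fun y => (V y * (v tau y) `^ p)%R) x + (expR ((1 - p) * tau) * G2 tau)%:E))).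
    apply: ge0_le_integral_nm => tau /inD Dt; first by rewrite mule_ge0.
    rewrite EFinM -ge0_muleDr//; last by rewrite lee_fin G20.
    by apply: lee_wpmul2l => //; exact: H2.
  apply: ge0_integralD_le_nm => // tau /inD Dt.
  by rewrite mule_ge0.
by apply: le_trans (leeD I1 I2) _; rewrite addeACA.
Qed.

Lemma integral_itv_le_add (f : R -> \bar R) (s t C : R) :
  (0 <= s <= t)%R -> (0 <= C)%R ->
  (forall tau, (0 <= tau <= t)%R -> 0 <= f tau <= C%:E) ->
  \int[leb]_(tau in (`[0%R, t]%classic : set R)) f tau <=
  \int[leb]_(tau in (`[0%R, s]%classic : set R)) f tau + (C * (t - s))%:E.
Proof.
move=> /andP[s0 st] C0 fC.
(* The remainder is turned into the integral of a measurable function, as subadditivity of the lower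
   integral requires. *)
have -> : (C * (t - s))%:E = \int[leb]_tau (C%:E * (\1_(`[s, t]%classic : set R) tau)%:E).
  rewrite ge0_integralZl_nm//.
  rewrite integral_indic// setIT/= lebesgue_measure_itv/= lte_fin.
  case: ltP => [_|ts]; first by rewrite EFinM EFinB.
  by rewrite (le_anti (_ : (s <= t <= s)%R)) ?st// subrr mulr0 mule0.
rewrite integral_mkcond [X in _ <= X + _]integral_mkcond.
apply: (@le_trans _ _ (\int[leb]_tau ((f \_ (`[0%R, s]%classic : set R)) tau +
    C%:E * (\1_(`[s, t]%classic : set R) tau)%:E))); last apply: ge0_integralD_le_nm => //.
- apply: ge0_le_integral_nm => tau _.
    by apply: erestrict_ge0 => u; rewrite /= in_itv/= => /fC /andP[].
  rewrite !patchE !mem_setE !in_itv/= indicE mem_setE in_itv/=.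
  have [|] := boolP (0 <= tau <= t)%R => tt; last first.
    by rewrite adde_ge0//; [case: ifPn => // /andP[u0 us]; move: tt; rewrite u0 (le_trans us st)
      |rewrite -EFinM lee_fin mulr_ge0].
  have /andP[f0 fc] := fC _ tt; move: tt => /andP[tau0 taut]; rewrite tau0 taut andbT/=.
  have [us|us] := leP tau s.
    by rewrite leeDl// -EFinM lee_fin mulr_ge0.
  by rewrite (ltW us) add0e mule1.
- move=> tau _; apply: erestrict_ge0 => u; rewrite /= in_itv/= => /andP[u0 us].
  by have /fC /andP[] : (0 <= u <= t)%R by rewrite u0 (le_trans us).
- by move=> tau _; rewrite -EFinM lee_fin mulr_ge0.
- apply/measurable_EFinP; apply: measurable_funM => //; exact: measurable_indic.
Qed.

(** Gives the Lipschitz continuity in time of the constructed solution. *)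
Lemma Phi_time_add mu (s t C1 C2 : R) x : (p <= 1)%R -> (0 <= s <= t)%R ->
  (0 <= C1)%R -> (0 <= C2)%R ->
  (forall tau y, 0 <= tau <= t -> 0 <= mu tau y)%R ->
  (forall tau, (0 <= tau <= t)%R -> Bconv (mu tau) x <= C1%:E) ->
  (forall tau, (0 <= tau <= t)%R -> Bconv (fun y => (V y * (mu tau y) `^ p)%R) x <= C2%:E) ->
  Phi mu t x <= Phi mu s x + ((C1 + expR ((1 - p) * t) * C2) * (t - s))%:E.
Proof.
move=> p1 st C10 C20 m0 H1 H2.
have I1 := @integral_itv_le_add (fun tau => Bconv (mu tau) x) s t C1 st C10.
have I2 := @integral_itv_le_add (fun tau => (expR ((1 - p) * tau))%:E *
  Bconv (fun y => (V y * (mu tau y) `^ p)%R) x) s t (expR ((1 - p) * t) * C2) st.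
rewrite mulrDl EFinD; apply: le_trans (leeD (I1 _) (I2 _ _)) _; last by rewrite addeACA.
- move=> tau tt; rewrite H1// andbT.
  by apply: Bconv_ge0 => y; exact: m0.
- by rewrite mulr_ge0 ?expR_ge0.
move=> tau tt; rewrite mule_ge0//= EFinM; apply: lee_pmul => //; last exact: H2.
have /andP[_ t2] := tt.
by rewrite lee_fin ler_expR ler_wpM2l// subr_ge0.
Qed.

(** The source scales correctly because e^{(1-p)(s+k)} (e^k)^p = e^k e^{(1-p)s}; that V does not
    depend on time enters here. *)
Lemma Phi_shift mu nu (k t : R) x : (0 <= k)%R -> (0 <= t)%R ->
  (forall tau y, 0 <= tau <= t -> 0 <= nu tau y)%R ->
  (forall tau y, 0 <= tau <= t -> mu (tau + k) y = expR k * nu tau y)%R ->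
  (forall tau y, 0 <= tau < k -> mu tau y = 0)%R ->
  Phi mu (t + k)%R x = (expR k)%:E * Phi nu t x.
Proof.
move=> k0 t0 n0 mn mk.
have m0 tau y : (0 <= tau <= t + k)%R -> (0 <= mu tau y)%R.
  move=> /andP[u0 utk]; have [uk|uk] := ltP tau k; first by rewrite mk// u0.
  by rewrite -(subrK k tau) mn ?mulr_ge0 ?expR_ge0 ?n0// subr_ge0 uk lerBlDr.
have mkE tau : (0 <= tau < k)%R -> mu tau = fun=> 0%R.
  by move=> tk; apply/funext => y; exact: mk.
rewrite /Phi ge0_integral_itv_shift_nm//; last 2 first.
- by move=> tau tt; apply: Bconv_ge0 => y; exact: m0.
- by move=> tau /mkE ->; rewrite Bconv0.
rewrite ge0_integral_itv_shift_nm//; last 2 first.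
- by move=> tau tt; rewrite mule_ge0.
- move=> tau /mkE ->; rewrite powR0 ?gt_eqF//.
  by under [X in Bconv X]funext do rewrite mulr0; rewrite Bconv0 mule0.
rewrite ge0_muleDr; [|apply: integral_ge0 => tau; rewrite /= in_itv/= => tt..]; last 2 first.
- by apply: Bconv_ge0 => y; exact: n0.
- by rewrite mule_ge0.
apply: (congr2 (@adde R)); rewrite -ge0_integralZl_nm ?expR_ge0//.
- apply: eq_integral => tau; rewrite inE/= in_itv/= => tt.
  rewrite -BconvZ ?expR_ge0//; last by move=> y; exact: n0.
  by congr Bconv; apply/funext => y; exact: mn.
- by move=> tau; rewrite /= in_itv/= => tt; apply: Bconv_ge0 => y; exact: n0.
- apply: eq_integral => tau; rewrite inE/= in_itv/= => tt.
  rewrite [X in Bconv X](_ : _ = fun y => (expR (p * k) * (V y * nu tau y `^ p))%R).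
    rewrite BconvZ ?expR_ge0//; last by move=> y; rewrite mulr_ge0 ?powR_ge0.
    rewrite !muleA -!EFinM -!expRD; congr ((expR _)%:E * _); ring.
  apply/funext => y; rewrite mn// powRM ?expR_ge0 ?n0// mulrC -expRM (mulrC k); ring.
- by move=> tau _; rewrite mule_ge0.
Qed.

End Phi.

(** * Contraction above the lower bound, and the comparison principle *)

Section growth.
Variables (R : realType) (n : nat) (V : 'rV[R]_n -> R) (p sigma vl vu eps0 : R).
Hypotheses (V_ge0 : forall x, 0 <= V x) (p_gt0 : 0 < p) (p_lt1 : p < 1).
Hypotheses (sigma_ge0 : 0 <= sigma) (vl_gt0 : 0 < vl) (vu_gt0 : 0 < vu) (eps0_gt0 : 0 < eps0).
Hypothesis V_le : forall x, V x <= vu * enorm x `^ sigma.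
Notation leb := (@lebesgue_measure R).
Implicit Types (x y : 'rV[R]_n) (v w mu nu : R -> 'rV[R]_n -> R).

Let r := (1 - p)^-1.
Let E := (1 - p) * (eps0 * vl).
Let q := p * vu / (eps0 * vl).

(** At each y with |y|^sigma > 0 this is the solution, positive for t > 0, of z' = eps0 vl |y|^sigma
    z^p with z(0) = 0. *)
Definition subsol (t : R) y : R := (E * t * enorm y `^ sigma) `^ r.

Let q1_gt0 : 0 < 1 - p. Proof. by rewrite subr_gt0. Qed.
Let r_gt0 : 0 < r. Proof. by rewrite invr_gt0. Qed.
Let r_gt1 : 1 < r. Proof. by rewrite invf_gt1// gtrBl. Qed.
Let rp : r * p = r - 1. Proof. by rewrite /r; field; rewrite gt_eqF. Qed.
Let E_gt0 : 0 < E. Proof. by rewrite !mulr_gt0. Qed.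
Let q_gt0 : 0 < q. Proof. by rewrite divr_gt0 ?mulr_gt0. Qed.
Let g_ge0 y : 0 <= enorm y `^ sigma. Proof. exact: powR_ge0. Qed.

Lemma subsol_ge0 t y : 0 <= subsol t y.
Proof. exact: powR_ge0. Qed.

Lemma source_le (tau a b h : R) y : 0 < tau -> subsol tau y <= a -> 0 <= h ->
  0 <= b <= a + h -> V y * b `^ p <= V y * a `^ p + q * r * (h / tau).
Proof.
move=> tau0 sa h0 /andP[b0 bah].
have a0 : 0 <= a := le_trans (subsol_ge0 _ _) sa.
have c0 : 0 <= q * r * (h / tau).
  by apply: mulr_ge0; [apply: mulr_ge0; exact: ltW|apply: divr_ge0 => //; exact: ltW].
set g := enorm y `^ sigma.
(* Where |y|^sigma vanishes the lower bound says nothing, but V vanishes as well. *)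
have [g0|gn] := eqVneq g 0.
  have -> : V y = 0.
    by apply/eqP; rewrite eq_le V_ge0 andbT (le_trans (V_le y))// -/g g0 mulr0.
  by rewrite !mul0r add0r.
have gp : 0 < g by rewrite lt_neqAle eq_sym gn g_ge0.
have s0 : 0 < E * tau * g by rewrite !mulr_gt0.
have ap : 0 < a by apply: lt_le_trans sa; rewrite powR_gt0.
have a1p : E * tau * g <= a `^ (1 - p).
  have : subsol tau y `^ (1 - p) <= a `^ (1 - p).
    by apply: ge0_ler_powR; rewrite ?nnegrE ?subsol_ge0// ltW.
  by rewrite /subsol -powRrM mulVf ?gt_eqF// powRr1 ?(ltW s0).
have h1 : b `^ p <= a `^ p + p * (h / a `^ (1 - p)).
  apply: le_trans (powR_tangent _ ap h0); last by rewrite p_gt0.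
  by apply: ge0_ler_powR; rewrite ?nnegrE ?(ltW p_gt0) ?addr_ge0.
apply: (@le_trans _ _ (V y * (a `^ p + p * (h / a `^ (1 - p))))).
  by rewrite ler_wpM2l.
rewrite mulrDr lerD2l.
apply: (@le_trans _ _ (vu * g * (p * (h / (E * tau * g))))).
  apply: ler_pM => //; first by rewrite !mulr_ge0 ?invr_ge0 ?powR_ge0 ?(ltW p_gt0).
  by rewrite ler_wpM2l ?(ltW p_gt0)// ler_wpM2l// lef_pV2 ?posrE ?powR_gt0.
rewrite le_eqVlt; apply/orP; left; apply/eqP.
by rewrite /q /r /E; field; rewrite !gt_eqF.
Qed.

(* Chosen so that q N absorbs both B mu and the factor e^{(1-p)t} <= 1 + (1-p) e^{(1-p)T} t. *)
Definition contraction_rate (T : R) : R := (1 + q * r * ((1 - p) * expR ((1 - p) * T))) / q.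

Lemma contraction_rate_gt0 T : 0 < contraction_rate T.
Proof.
apply: divr_gt0 => //; apply: addr_gt0 => //.
by apply: mulr_gt0; apply: mulr_gt0 => //; exact: expR_gt0.
Qed.

(** A one-sided contraction: only v has to lie above [subsol], so w may be a solution about whose
    positivity nothing is known, or an iterate. *)
Lemma Phi_contraction (ep T M : R) v w : n%:R * ep ^+ 2 < 1 -> 0 <= M ->
  (forall tau y, 0 <= tau <= T -> subsol tau y <= v tau y) ->
  (forall tau y, 0 <= tau <= T ->
     0 <= w tau y <= v tau y + M * (tau `^ r * expR (contraction_rate T * tau)) * phi ep y) ->
  forall t x, 0 <= t <= T ->
  (Phi V p w t x <= Phi V p v t x +
    ((1 - n%:R * ep ^+ 2)^-1 * q * M * (t `^ r * expR (contraction_rate T * t)) * phi ep x)%:E)%E.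
Proof.
move=> e1 M0 vs wv t x /andP[t0 tT]; set N := contraction_rate T in wv *.
set K := (1 - _)^-1.
have K0 : 0 < K by rewrite invr_gt0 subr_gt0.
have ph0 y : 0 <= phi ep y by rewrite ltW// phi_gt0.
have tT' tau : 0 <= tau <= t -> 0 <= tau <= T.
  by move=> /andP[-> /le_trans]; apply.
(* [G1] is the image under B of the assumed gap h between w and v; [G2] is that of (q r / tau) h,
   which costs one power of tau. *)
pose G1 tau := M * (tau `^ r * expR (N * tau)) * (K * phi ep x).
pose G2 tau := q * r * M * (tau `^ (r - 1) * expR (N * tau)) * (K * phi ep x).
have mexp : measurable_fun setT (fun tau => expR (N * tau)).
  by apply: measurableT_comp => //; exact: mulrl_measurable.
have mpow a : measurable_fun setT (fun tau : R => tau `^ a) := measurable_powR a.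
have mG1 : measurable_fun setT G1.
  by apply: measurable_funM => //; apply: measurable_funM => //; apply: measurable_funM.
have mG2 : measurable_fun setT G2.
  by apply: measurable_funM => //; apply: measurable_funM => //; apply: measurable_funM.
have G10 tau : 0 <= G1 tau by rewrite !mulr_ge0 ?powR_ge0 ?expR_ge0 ?(ltW K0).
have qr0 : 0 <= q * r by apply: mulr_ge0; exact: ltW.
have G20 tau : 0 <= G2 tau.
  by rewrite /G2 mulr_ge0// mulr_ge0 ?(ltW K0)// mulr_ge0 ?powR_ge0 ?expR_ge0// mulr_ge0.
have v0 tau y : 0 <= tau <= t -> 0 <= v tau y.
  by move=> tt; exact: le_trans (subsol_ge0 _ _) (vs _ y (tT' _ tt)).
have w0 tau y : 0 <= tau <= t -> 0 <= w tau y.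
  by move=> tt; have /andP[] := wv _ y (tT' _ tt).
apply: le_trans (Phi_le_add V_ge0 (x := x) mG1 mG2 v0 w0 (fun tau _ => G10 tau) (fun tau _ => G20 tau) _ _) _.
- move=> tau tt; apply: Bconv_le_add => //.
  + by rewrite !mulr_ge0 ?powR_ge0 ?expR_ge0.
  + by move=> y; exact: w0.
  + by move=> y; exact: v0.
  + by move=> y; have /andP[] := wv tau (x - y) (tT' _ tt).
- move=> tau tt; apply: Bconv_le_add => //.
  + by apply: mulr_ge0; [apply: mulr_ge0|apply: mulr_ge0; rewrite ?powR_ge0 ?expR_ge0].
  + by move=> y; rewrite mulr_ge0 ?powR_ge0.
  + by move=> y; rewrite mulr_ge0 ?powR_ge0.
  move=> y; have := wv tau (x - y) (tT' _ tt).
  have /andP[tau0 _] := tt.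
  (* The slope q r / tau is meaningless at tau = 0, but there the gap is 0^r = 0. *)
  have [->|taun] := eqVneq tau 0.
    rewrite powR0 ?gt_eqF// mul0r mulr0 mul0r addr0 => /andP[wz wle].
    apply: (@le_trans _ _ (V (x - y) * v 0 (x - y) `^ p)).
      rewrite ler_wpM2l//; apply: ge0_ler_powR; rewrite ?nnegrE ?(ltW p_gt0)//.
      exact: le_trans wle.
    rewrite lerDl; apply: mulr_ge0 => //; apply: mulr_ge0; first exact: mulr_ge0.
    by rewrite mulr_ge0 ?powR_ge0 ?expR_ge0.
  have taup : 0 < tau by rewrite lt_neqAle eq_sym taun.
  move=> wle; apply: le_trans (source_le taup (vs _ _ (tT' _ tt)) _ wle) _.
    by rewrite !mulr_ge0 ?powR_ge0 ?expR_ge0.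
  rewrite lerD2l -(mulr_powRB1 tau0 r_gt0) le_eqVlt; apply/orP; left; apply/eqP.
  by field.
apply: leeD => //.
rewrite -(mulrA _ (t `^ r * _)) (mulrC (t `^ r * _)) mulrA EFinM.
rewrite -(integral_powR_expR N r_gt1 t0) -ge0_integralZl_nm; last 2 first.
- move=> tau; rewrite /= in_itv/= => /andP[tau0 _].
  by rewrite lee_fin mulr_ge0 ?expR_ge0// addr_ge0// mulr_ge0 ?powR_ge0 ?(ltW r_gt0)// ltW// contraction_rate_gt0.
- by do 3 apply: mulr_ge0 => //; exact: ltW.
apply: ge0_le_integral_nm => tau; rewrite /= in_itv/= => tt.
  by rewrite lee_fin addr_ge0// mulr_ge0// expR_ge0.
rewrite -EFinM lee_fin /G1 /G2.
have /andP[tau0 taut] := tt.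
set e := expR (N * tau); set a := tau `^ (r - 1).
have e0 : 0 <= e by rewrite expR_ge0.
have a0 : 0 <= a by rewrite powR_ge0.
rewrite -(mulr_powRB1 tau0 r_gt0) -/a.
set c1 := (1 - p) * expR ((1 - p) * T).
(* From e^{-z} >= 1 - z follows e^z <= 1 + z e^z, and the last exponential is taken at time T. *)
have ex : expR ((1 - p) * tau) <= 1 + c1 * tau.
  have h := expR_ge1Dx (- ((1 - p) * tau)).
  have hp := expR_gt0 ((1 - p) * tau).
  have h2 : expR ((1 - p) * tau) * (1 - (1 - p) * tau) <= 1.
    by rewrite -[leRHS](expRxMexpNx_1 ((1 - p) * tau)) ler_pM2l.
  have h3 : expR ((1 - p) * tau) <= expR ((1 - p) * T).
    by rewrite ler_expR ler_pM2l// (le_trans taut).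
  have h4 : expR ((1 - p) * tau) * ((1 - p) * tau) <= expR ((1 - p) * T) * ((1 - p) * tau).
    by rewrite ler_wpM2r// mulr_ge0// ltW.
  rewrite /c1; rewrite mulrBr mulr1 in h2; lra.
(* The terms carrying an extra factor tau, namely 1 from B mu and q r c1 from the exponential, add
   up to exactly q N; the leading term q r is untouched. *)
have NE : q * N = 1 + q * r * c1.
  by rewrite /N /contraction_rate mulrC divfK// gt_eqF.
have X0 : 0 <= M * a * e * K * phi ep x by rewrite !mulr_ge0 ?(ltW K0).
apply: (@le_trans _ _ (M * a * e * K * phi ep x * (tau + (1 + c1 * tau) * (q * r)))).
  rewrite mulrDr; apply: lerD.
    by rewrite le_eqVlt; apply/orP; left; apply/eqP; ring.
  have -> : expR ((1 - p) * tau) * (q * r * M * (a * e) * (K * phi ep x)) =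
    M * a * e * K * phi ep x * (expR ((1 - p) * tau) * (q * r)) by ring.
  apply: ler_wpM2l => //; apply: ler_wpM2r => //.
have -> : K * q * M * phi ep x * ((r * a + N * (tau * a)) * e) =
  M * a * e * K * phi ep x * (q * r + (q * N) * tau) by ring.
by rewrite NE; apply: ler_wpM2l => //; lra.
Qed.

(** The O(t^r) bound on mu starts the iteration; each use of [Phi_contraction] multiplies the excess
    of mu over nu by a factor below 1. *)
Lemma comparison (ep T M : R) mu nu : n%:R * ep ^+ 2 < 1 - q -> 0 <= M ->
  (forall t x, 0 <= t <= T -> subsol t x <= nu t x) ->
  (forall t x, 0 <= t <= T -> (Phi V p nu t x <= (nu t x)%:E)%E) ->
  (forall t x, 0 <= t <= T -> ((mu t x)%:E <= Phi V p mu t x)%E) ->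
  (forall t x, 0 <= t <= T -> 0 <= mu t x <= M * t `^ r * phi ep x) ->
  forall t x, 0 <= t <= T -> mu t x <= nu t x.
Proof.
move=> e1 M0 nus nuP muP muM t x tT.
have e1' : n%:R * ep ^+ 2 < 1 by apply: lt_trans e1 _; rewrite gtrBl.
set th := (1 - n%:R * ep ^+ 2)^-1 * q.
have th1 : th < 1.
  rewrite /th mulrC ltr_pdivrMr ?subr_gt0// mul1r.
  by move: e1; rewrite ltrBrDr addrC -ltrBrDr.
have th0 : 0 <= th.
  by apply: mulr_ge0; [rewrite invr_ge0 subr_ge0; exact: ltW|exact: ltW].
have ph0 y : 0 <= phi ep y by rewrite ltW// phi_gt0.
have key k : forall s y, 0 <= s <= T ->
    mu s y <= nu s y + (th ^+ k * M) * (s `^ r * expR (contraction_rate T * s)) * phi ep y.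
  elim: k => [|k IH] s y sT.
    have /andP[m0 mM] := muM s y sT; apply: le_trans mM _.
    have nu0 : 0 <= nu s y := le_trans (subsol_ge0 _ _) (nus _ _ sT).
    apply: ler_wpDl => //; rewrite expr0 mul1r ler_wpM2r// ler_wpM2l//.
    have /andP[s0 _] := sT.
    rewrite ler_peMr ?powR_ge0// -[leLHS]expR0 ler_expR; apply: mulr_ge0 => //.
    by apply: ltW; exact: contraction_rate_gt0.
  rewrite -lee_fin; apply: le_trans (muP _ _ sT) _.
  have c0 : 0 <= th ^+ k * M by rewrite mulr_ge0// exprn_ge0.
  apply: le_trans (Phi_contraction e1' c0 nus _ y sT) _.
    by move=> tau z tT0; rewrite IH// andbT; have /andP[] := muM tau z tT0.
  rewrite EFinD; apply: leeD; first exact: nuP.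
  by rewrite -/th exprS !mulrA lexx.
apply: (@le_geometric _ th _ _ (M * (t `^ r * expR (contraction_rate T * t)) * phi ep x)).
  by rewrite th0.
by move=> k; rewrite !mulrA; have := key k t x tT; rewrite !mulrA.
Qed.

End growth.

(** * Lower and upper bounds for solutions *)

Section lower_bound.
Variables (R : realType) (n : nat) (V : 'rV[R]_n -> R) (p sigma vl eps0 : R).
Hypotheses (n_gt0 : (0 < n)%N) (V_ge0 : forall x, 0 <= V x) (p_gt0 : 0 < p) (p_lt1 : p < 1).
Hypotheses (sigma_ge0 : 0 <= sigma) (vl_gt0 : 0 < vl) (eps0_gt0 : 0 < eps0).
Hypothesis V_ge : forall x, 1 <= enorm x -> vl * enorm x `^ sigma <= V x.
Hypothesis eps0_le : forall (x : 'rV[R]_n) d, 0 <= d -> d <= sigma * p / (1 - p) ->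
  ((eps0 * enorm x `^ (sigma + d))%:E <=
   int_Rn (fun y => if (1 <= enorm (x - y))%R then
                      (Bker y * (enorm (x - y) `^ (sigma + d))%:E)%E else 0%E))%E.
Notation leb := (@lebesgue_measure R).
Implicit Types (x y : 'rV[R]_n) (f : 'rV[R]_n -> R) (v w mu nu : R -> 'rV[R]_n -> R).

Let r := (1 - p)^-1.
Let q1_gt0 : 0 < 1 - p. Proof. by rewrite subr_gt0. Qed.
Let r_gt0 : 0 < r. Proof. by rewrite invr_gt0. Qed.
Let r_gt1 : 1 < r. Proof. by rewrite invf_gt1// gtrBl. Qed.
Let rp : r * p = r - 1. Proof. by rewrite /r; field; rewrite gt_eqF. Qed.

Lemma powRD_ge0 (x a b : R) : 0 <= a -> 0 <= b -> x `^ (a + b) = x `^ a * x `^ b.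
Proof.
move=> a0 b0; have [ab|ab] := eqVneq (a + b) 0; last by rewrite powRD// (negbTE ab).
have [-> ->] : a = 0 /\ b = 0 by split; lra.
by rewrite addr0 powRr0 mulr1.
Qed.

(** The convolution is restricted to |x - y| >= 1, where V has its lower bound; d <= sigma r is what
    keeps the exponent p d in the range where [eps0] is available. *)
Lemma Bconv_source_ge f (c d : R) x : 0 <= c -> 0 <= d -> d <= sigma * r ->
  (forall y, c * enorm y `^ d <= f y) ->
  ((eps0 * vl * c `^ p * enorm x `^ (sigma + p * d))%:E <=
    Bconv (fun y => V y * f y `^ p)%R x)%E.
Proof.
move=> c0 d0 dr fc.
have pd0 : 0 <= p * d by rewrite mulr_ge0// ltW.
have pdr : p * d <= sigma * p / (1 - p).
  by rewrite (mulrC sigma) -!mulrA ler_pM2l.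
have k0 : 0 <= vl * c `^ p by rewrite mulr_ge0 ?powR_ge0// ltW.
have H := eps0_le x pd0 pdr.
apply: (@le_trans _ _ ((vl * c `^ p)%:E * (eps0 * enorm x `^ (sigma + p * d))%:E)%E).
  by rewrite -EFinM lee_fin le_eqVlt; apply/orP; left; apply/eqP; ring.
apply: (le_trans (lee_wpmul2l _ H)); first by rewrite lee_fin.
have B0 y : (0 <= Bker y)%E := Bker_ge0 y.
rewrite -int_RnZl//; last first.
  by move=> y; case: ifP => // _; rewrite mule_ge0// lee_fin powR_ge0.
apply: le_int_Rn => y; case: ifPn => xy; rewrite ?mule0//.
- by rewrite !mule_ge0// lee_fin// powR_ge0.
- rewrite muleCA; apply: lee_wpmul2l => //; rewrite -EFinM lee_fin.
  set z := x - y in xy *.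
  have cd0 : 0 <= c * enorm z `^ d by rewrite mulr_ge0 ?powR_ge0.
  rewrite powRD_ge0//; apply: (@le_trans _ _ (vl * enorm z `^ sigma * (c * enorm z `^ d) `^ p)).
    rewrite powRM ?powR_ge0// -powRrM (mulrC d) le_eqVlt; apply/orP; left; apply/eqP; ring.
  apply: ler_pM; rewrite ?powR_ge0 ?V_ge//; first by rewrite mulr_ge0 ?powR_ge0// ltW.
  by apply: ge0_ler_powR; rewrite ?nnegrE ?(ltW p_gt0)// (le_trans cd0 (fc z)).
- by rewrite mule_ge0// lee_fin mulr_ge0 ?powR_ge0.
Qed.

(** The linear term is dropped and e^{(1-p) tau} is bounded below by 1; integrating tau^(r-1) yields
    the factor 1/r. The delay t0 allows an iteration that starts at a later time. *)
Lemma Phi_ge_pow mu (t0 s k : R) x : 0 <= t0 -> 0 <= s -> 0 <= k ->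
  (forall tau y, 0 <= tau <= s + t0 -> 0 <= mu tau y) ->
  (forall tau, 0 <= tau <= s ->
     ((k * tau `^ (r - 1))%:E <= Bconv (fun y => V y * mu (tau + t0) y `^ p)%R x)%E) ->
  ((k / r * s `^ r)%:E <= Phi V p mu (s + t0) x)%E.
Proof.
move=> t00 s0 k0 mu0 H.
pose F tau : \bar R := if t0 <= tau then (k * (tau - t0) `^ (r - 1))%:E else 0%E.
have F0 tau : (0 <= F tau)%E.
  by rewrite /F; case: ifP => // _; rewrite lee_fin mulr_ge0 ?powR_ge0.
have B0 tau y : (0 <= (expR ((1 - p) * tau))%:E * Bconv (fun y => V y * mu tau y `^ p)%R x)%E.
  rewrite mule_ge0 ?lee_fin ?expR_ge0//; apply: Bconv_ge0 => z.
  by rewrite mulr_ge0 ?powR_ge0.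
apply: (@le_trans _ _ (\int[leb]_(tau in (`[0%R, (s + t0)%R]%classic : set R)) F tau)%E).
  rewrite ge0_integral_itv_shift_nm//; last first.
    by move=> tau /andP[_ tt]; rewrite /F leNgt tt.
  have := integral_powR_expR 0 r_gt1 s0; rewrite mul0r expR0 mulr1 => IE.
  rewrite EFinM -IE -ge0_integralZl_nm; last 2 first.
  - by move=> tau _; rewrite lee_fin !mul0r expR0 mulr1 addr0 mulr_ge0 ?powR_ge0// ltW.
  - by apply: divr_ge0 => //; exact: ltW.
  apply: ge0_le_integral_nm => tau; rewrite /= in_itv/= => /andP[tau0 _].
    rewrite -EFinM lee_fin; apply: mulr_ge0; first by apply: divr_ge0 => //; exact: ltW.
    by rewrite !mul0r expR0 mulr1 addr0 mulr_ge0 ?powR_ge0// ltW.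
  rewrite /F lerDr tau0 addrK -EFinM lee_fin !mul0r expR0 mulr1 addr0.
  by rewrite mulrA divfK// gt_eqF.
apply: (@le_trans _ _ (\int[leb]_(tau in (`[0%R, (s + t0)%R]%classic : set R))
    ((expR ((1 - p) * tau))%:E * Bconv (fun y => V y * mu tau y `^ p)%R x))%E); last first.
  rewrite /Phi leeDr//; apply: integral_ge0 => tau; rewrite /= in_itv/= => tt.
  by apply: Bconv_ge0 => y; exact: mu0.
apply: ge0_le_integral_nm => tau; rewrite /= in_itv/= => /andP[tau0 tt] //.
rewrite /F; case: ifPn => [t0t|_]; last exact: B0.
have := H (tau - t0); rewrite subr_ge0 t0t lerBlDr tt subrK => /(_ isT) h.
apply: le_trans h _; rewrite -[leLHS]mul1e; apply: lee_wpmul2r.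
  by apply: Bconv_ge0 => y; rewrite mulr_ge0 ?powR_ge0.
by rewrite lee_fin -[leLHS]expR0 ler_expR mulr_ge0// ltW.
Qed.

(** Keeps the downward iteration above [subsol], so that its limit is not zero. *)
Lemma subsol_le_Phi t x : 0 <= t ->
  ((subsol p sigma vl eps0 t x)%:E <= Phi V p (subsol p sigma vl eps0) t x)%E.
Proof.
move=> t0; set E := (1 - p) * (eps0 * vl).
have E0 : 0 < E by rewrite !mulr_gt0.
have sE tau y : 0 <= tau -> subsol p sigma vl eps0 tau y = E `^ r * tau `^ r * enorm y `^ (sigma * r).
  move=> tau0; rewrite /subsol -/E powRM; [|exact: mulr_ge0 (ltW E0) tau0|exact: powR_ge0].
  by rewrite (powRM _ (ltW E0) tau0) -powRrM.
have := @Phi_ge_pow (subsol p sigma vl eps0) 0 t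
  (eps0 * vl * E `^ (r - 1) * enorm x `^ (sigma * r)) x.
rewrite addr0 => H; apply: le_trans; last apply: H => //.
- rewrite lee_fin sE// le_eqVlt; apply/orP; left; apply/eqP.
  rewrite -(mulr_powRB1 (ltW E0) r_gt0) /r invrK /E; ring.
- by rewrite !mulr_ge0 ?powR_ge0// ltW.
- by move=> tau y _; exact: powR_ge0.
move=> tau /andP[tau0 _]; rewrite addr0.
have c0 : 0 <= E `^ r * tau `^ r by rewrite mulr_ge0 ?powR_ge0.
have sr0 : 0 <= sigma * r by rewrite mulr_ge0// ltW.
apply: le_trans (Bconv_source_ge x c0 sr0 (lexx _) _); last first.
  by move=> y; rewrite sE.
rewrite lee_fin powRM ?powR_ge0// -!powRrM rp.
have -> : sigma + p * (sigma * r) = sigma * r.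
  by rewrite mulrCA (mulrC p) rp mulrBr mulr1 addrC subrK.
by rewrite le_eqVlt; apply/orP; left; apply/eqP; ring.
Qed.

(* From any point of the cube there is a unit box of displacements of size at most 2 that stays
   in the cube and avoids the unit ball, where V may vanish; k0 does not depend on rho. *)
Lemma Bconv_cube_ge : exists2 k0 : R, 0 < k0 & forall f (c rho : R) x,
  4 <= rho -> 0 <= c -> (forall y, 0 <= f y) ->
  (forall y, (forall i, `|y ord0 i| <= rho) -> c <= f y) ->
  (forall i, `|x ord0 i| <= rho) ->
  ((k0 * c `^ p)%:E <= Bconv (fun y => V y * f y `^ p)%R x)%E.
Proof.
have [b b0 bB] := Bker_bounded_below n (2 : R).
exists (b * vl); first by rewrite mulr_gt0.
move=> f c rho x rho4 c0 f0 fc xr.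
(* A coordinate z with |z| < 2 is pushed outwards by 1 to 2 and stays within 4 <= rho; any other is
   pulled inwards by at most 1 and keeps absolute value at least 1. *)
pose al i := let z := x ord0 i in
  if 0 <= z then (if z < 2 then - 2 else 0) else (if - 2 < z then 1 else - 1) : R.
have H := @Bconv_box R n (fun y => V y * f y `^ p) x al 1 (vl * c `^ p) b.
rewrite expr1n mulr1 mulrA in H; apply: H => //.
- by rewrite mulr_ge0 ?powR_ge0// ltW.
- exact: ltW.
- by move=> y; rewrite mulr_ge0 ?powR_ge0.
move=> y yal.
have coord i : 1 <= `|(x - y) ord0 i| <= rho /\ `|y ord0 i| <= 2.
  have := xr i; have := yal i; rewrite /al !mxE ler_norml.
  set z := x ord0 i; set yi := y ord0 i.
  case: (leP 0 z) => z0; case: ltP => z2 /andP[h1 h2] /andP[h3 h4];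
    (split; last by rewrite ler_norml; apply/andP; split; lra).
  - by rewrite ger0_norm; [apply/andP; split; lra|lra].
  - by rewrite ger0_norm; [apply/andP; split; lra|lra].
  - by rewrite ltr0_norm; [apply/andP; split; lra|lra].
  - by rewrite ltr0_norm; [apply/andP; split; lra|lra].
split; last by apply: bB => i; have [] := coord i.
have e1 : 1 <= enorm (x - y).
  apply: le_trans (coord_le_enorm _ (Ordinal n_gt0)).
  by have [/andP[]] := coord (Ordinal n_gt0).
apply: ler_pM; rewrite ?powR_ge0 ?(ltW vl_gt0)//.
  apply: le_trans (V_ge e1); rewrite ler_peMr ?(ltW vl_gt0)//.
  have -> : 1 = 1 `^ sigma :> R by rewrite powR1.
  by apply: ge0_ler_powR; rewrite ?nnegrE ?enorm_ge0.
apply: ge0_ler_powR; rewrite ?nnegrE ?(ltW p_gt0)//.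
by apply: fc => i; have [/andP[]] := coord i.
Qed.

(** * Lower bounds for solutions that are positive right after time zero *)

Section solution.
Variable nu : R -> 'rV[R]_n -> R.
Hypothesis nu_ge0 : forall t x, 0 <= t -> 0 <= nu t x.
Hypothesis nuE : forall t x, 0 <= t -> (nu t x)%:E = Phi V p nu t x.
Hypothesis nuC : forall t, 0 <= t -> continuous (nu t).
Hypothesis nu_pos : forall t, 0 < t -> exists s z, [/\ 0 <= s, s < t & 0 < nu s z].

Let nu_itv s tau y : 0 <= tau <= s -> 0 <= nu tau y.
Proof. by move=> /andP[tau0 _]; exact: nu_ge0. Qed.

Lemma solution_nondecreasing s t x : 0 <= s -> s <= t -> nu s x <= nu t x.
Proof.
move=> s0 st; rewrite -lee_fin !nuE ?(le_trans s0)//.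
by apply: Phi_nondecreasing => //; exact: nu_itv.
Qed.

(** A positive value at some earlier time s persists on a box by continuity and at later times by
    monotonicity; during [s, t0] the linear term spreads it to every cube. *)
Lemma solution_cube_pos (t0 rho : R) : 0 < t0 -> exists2 c : R, 0 < c &
  forall x, (forall i, `|x ord0 i| <= rho) -> c <= nu t0 x.
Proof.
move=> t00; have [s [z [s0 st nz]]] := nu_pos t00.
have [e e0 eP] : exists2 e : R, 0 < e & forall z' : 'rV[R]_n, (forall i, `|z' ord0 i - z ord0 i| <= e) ->
    nu s z / 2 <= nu s z'.
  have : nbhs z [set z' : 'rV[R]_n | nu s z / 2 < nu s z'].
    have cz : nu s z' @[z' --> z] --> nu s z by exact: nuC.
    apply: (cvgr_gt _ cz).
    by rewrite ltr_pdivrMr// ltr_pMr// ltr1n.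
  move=> /nbhs_ballP[e /= e0 eH]; exists (e / 2); first by rewrite divr_gt0.
  move=> z' z'e; apply/ltW/eH; split => // i j; rewrite (ord1 i) /ball/= distrC.
  by apply: le_lt_trans (z'e j) _; rewrite ltr_pdivrMr// ltr_pMr// ltr1n.
(* Bounds every displacement from the cube of size rho to the box of size e around z. *)
pose M := rho + l1 z + e.
have [b b0 bB] := Bker_bounded_below n M.
exists (b * (nu s z / 2) * (2 * e) ^+ n * (t0 - s)).
  by rewrite !mulr_gt0 ?divr_gt0 ?exprn_gt0 ?mulr_gt0 ?subr_gt0.
move=> x xr; set c := b * _ * _.
have c0 : 0 <= c by rewrite ltW// !mulr_gt0 ?divr_gt0 ?exprn_gt0 ?mulr_gt0.
have Bc tau : s <= tau -> (c%:E <= Bconv (nu tau) x)%E.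
  move=> stau; apply: (@Bconv_box R n (nu tau) x (fun i => x ord0 i - z ord0 i - e)).
  - by rewrite mulr_ge0// ltW.
  - by rewrite ltW// divr_gt0.
  - exact: ltW.
  - by move=> y; rewrite nu_ge0// (le_trans s0).
  move=> y yal; split.
    apply: le_trans (solution_nondecreasing _ s0 stau); apply: eP => i.
    by rewrite !mxE ler_norml; have /andP[h1 h2] := yal i; apply/andP; split; lra.
  apply: bB => i; have := xr i; have := yal i; have := coord_le_l1 z i; rewrite /M.
  by rewrite !ler_norml => /andP[a1 a2] /andP[a3 a4] /andP[a5 a6]; apply/andP; split; lra.
rewrite -lee_fin nuE ?(ltW t00)//.
apply: (@le_trans _ _ (\int[leb]_(tau in (`[0%R, t0]%classic : set R)) Bconv (nu tau) x)%E); last first.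
  rewrite /Phi leeDl//; apply: integral_ge0 => tau _.
  rewrite mule_ge0 ?lee_fin ?expR_ge0//; apply: Bconv_ge0 => y.
  by rewrite mulr_ge0 ?powR_ge0.
apply: (@le_trans _ _ (\int[leb]_(tau in (`[s, t0]%classic : set R)) Bconv (nu tau) x)%E); last first.
  apply: ge0_subset_integral_nm => tau; rewrite /= !in_itv/=.
    by move=> /andP[h ->]; rewrite (le_trans s0).
  by move=> /andP[h _]; apply: Bconv_ge0 => y; exact: nu_ge0.
apply: (@le_trans _ _ (\int[leb]_(tau in (`[s, t0]%classic : set R)) (cst c%:E) tau)%E).
  by rewrite integral_cst//= lebesgue_measure_itv/= lte_fin st -EFinB -EFinM.
by apply: ge0_le_integral_nm => tau; rewrite /= in_itv/= => /andP[h _]; [rewrite lee_fin|exact: Bc].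
Qed.

(** The first half of [0, t] supplies some positive bound on a cube around 0 containing x, the
    second half improves it by iteration. The limit depends only on k0 and r, hence not on x;
    halving the time costs 2^r. *)
Lemma solution_ge_cst : exists2 C : R, 0 < C & forall t x, 0 <= t -> C * t `^ r <= nu t x.
Proof.
have [k0 k00 kP] := Bconv_cube_ge.
exists ((k0 / r) `^ r / 2 `^ r).
  by apply: divr_gt0; apply: powR_gt0 => //; apply: divr_gt0.
move=> t x; rewrite le_eqVlt => /predU1P[<-|t0].
  by rewrite powR0 ?mulr0 ?nu_ge0// gt_eqF.
set s := t / 2; have s0 : 0 < s by rewrite divr_gt0.
pose rho := 4 + l1 x.
have rho4 : 4 <= rho by rewrite lerDl l1_ge0.
have [c c0 cP] := solution_cube_pos rho s0.
(* For tau <= s the first bound c tau^r / s^r is at most c. Its dependence on rho and s disappears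
   in the limit. *)
pose it k := iter k (fun c => k0 / r * c `^ p) (c / s `^ r).
have it0 k : 0 <= it k.
  elim: k => [|k IH] /=; first by rewrite divr_ge0 ?powR_ge0// ltW.
  by apply: mulr_ge0; [apply: divr_ge0; exact: ltW|exact: powR_ge0].
have key k : forall tau y, 0 <= tau <= s -> (forall i, `|y ord0 i| <= rho) ->
    it k * tau `^ r <= nu (tau + s) y.
  elim: k => [|k IH] tau y /andP[tau0 taus] yr.
    apply: (@le_trans _ _ c).
      rewrite /it /= -mulrA ler_piMr ?(ltW c0)// mulrC ler_pdivrMr ?powR_gt0// mul1r.
      by apply: ge0_ler_powR; rewrite ?nnegrE ?(ltW r_gt0) ?(ltW s0).
    apply: le_trans (cP y yr) _; apply: solution_nondecreasing; rewrite ?(ltW s0)//.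
    by rewrite lerDr.
  rewrite -lee_fin nuE ?addr_ge0 ?(ltW s0)//.
  apply: le_trans (@Phi_ge_pow nu s tau (k0 * it k `^ p) y _ _ _ _ _); rewrite ?(ltW s0)//.
  - rewrite lee_fin [it k.+1]/(k0 / r * it k `^ p).
    by rewrite (mulrAC k0).
  - by rewrite mulr_ge0 ?powR_ge0// ltW.
  - exact: nu_itv.
  move=> u /andP[u0 utau].
  have itu : 0 <= it k * u `^ r by rewrite mulr_ge0 ?powR_ge0.
  apply: le_trans (kP (nu (u + s)) _ rho y rho4 itu _ _ yr).
  - rewrite lee_fin powRM ?powR_ge0// -powRrM rp mulrA.
    by [].
  - by move=> z; apply: nu_ge0; rewrite addr_ge0// ltW.
  - by move=> z zr; apply: IH => //; rewrite u0 (le_trans utau).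
have xr i : `|x ord0 i| <= rho by rewrite (le_trans (coord_le_l1 x i))// lerDr.
have ts : t = s + s by rewrite /s; field.
have sr0 : 0 < s `^ r by rewrite powR_gt0.
have := @powR_iter_ge R p (k0 / r) (c / s `^ r) (nu t x / s `^ r).
rewrite p_gt0 p_lt1 => /(_ isT) H.
have : (k0 / r) `^ r <= nu t x / s `^ r.
  apply: H; rewrite ?divr_gt0//.
  move=> k; rewrite ler_pdivlMr// ts; apply: key => //.
  by rewrite lexx ltW.
rewrite ler_pdivlMr// => h; apply: le_trans h.
have -> : t `^ r = s `^ r * 2 `^ r by rewrite -powRM ?(ltW s0)// /s divfK.
rewrite mulrA mulrAC divfK// gt_eqF// powR_gt0//.
Qed.

Lemma subsol_le_solution t x : 0 <= t -> subsol p sigma vl eps0 t x <= nu t x.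
Proof.
rewrite le_eqVlt => /predU1P[<-|t0].
  by rewrite /subsol mulr0 mul0r powR0 ?nu_ge0// gt_eqF.
have [C C0 CP] := solution_ge_cst.
set g := enorm x `^ sigma; set E := (1 - p) * (eps0 * vl).
have E0 : 0 < E by rewrite !mulr_gt0.
have [g0|gn] := eqVneq g 0.
  rewrite /subsol -/g g0 mulr0 powR0 ?nu_ge0 ?(ltW t0)// gt_eqF//.
have gp : 0 < g by rewrite lt_neqAle eq_sym gn powR_ge0.
pose it k := iter k (fun c => E * c `^ p) C.
(* The exponents start from 0, the constant lower bound, and never exceed the fixed point sigma r,
   so [Bconv_source_ge] applies at every stage. *)
pose ex k := iter k (fun d => sigma + p * d) 0.
have itS k : it k.+1 = E * it k `^ p by [].
have exS k : ex k.+1 = sigma + p * ex k by [].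
have it0 k : 0 <= it k.
  by elim: k => [|k IH] /=; [exact: ltW|apply: mulr_ge0; [exact: ltW|exact: powR_ge0]].
have ex0 k : 0 <= ex k <= sigma * r.
  elim: k => [|k /andP[IH1 IH2]] /=; first by rewrite lexx mulr_ge0// ltW.
  rewrite addr_ge0 ?mulr_ge0 ?(ltW p_gt0)//=.
  have -> : sigma * r = sigma + p * (sigma * r).
    by rewrite mulrCA (mulrC p) rp mulrBr mulr1 addrC subrK.
  by rewrite lerD2l ler_pM2l.
have key k : forall s y, 0 <= s -> it k * s `^ r * enorm y `^ (ex k) <= nu s y.
  elim: k => [|k IH] s y s0; first by rewrite powRr0 mulr1; exact: CP.
  rewrite -lee_fin nuE//.
  have := @Phi_ge_pow nu 0 s (eps0 * vl * it k `^ p * enorm y `^ (ex k.+1)) y.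
  rewrite addr0 => H; apply: le_trans; last apply: H => //.
  - rewrite lee_fin itS /E /r invrK.
    by rewrite le_eqVlt; apply/orP; left; apply/eqP; ring.
  - by rewrite !mulr_ge0 ?powR_ge0// ltW.
  - exact: nu_itv.
  move=> u /andP[u0 us]; rewrite addr0.
  have c0 : 0 <= it k * u `^ r by rewrite mulr_ge0 ?powR_ge0.
  have /andP[e1 e2] := ex0 k.
  apply: le_trans (Bconv_source_ge y c0 e1 e2 _); last by move=> z; exact: IH.
  rewrite lee_fin powRM ?powR_ge0// -powRrM rp exS.
  by rewrite le_eqVlt; apply/orP; left; apply/eqP; ring.
(* At a fixed x constant and exponent combine into one scalar iteration with E |x|^sigma in place of
   E, so a single limit settles both. *)
have itE k : iter k (fun c => E * g * c `^ p) C = it k * enorm x `^ (ex k).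
  elim: k => [|k IH]; first by rewrite /= powRr0 mulr1.
  rewrite iterS IH itS exS.
  have /andP[e1 _] := ex0 k.
  rewrite powRM ?powR_ge0// -powRrM powRD_ge0 ?mulr_ge0 ?(ltW p_gt0)// (mulrC p (ex k)).
  by rewrite -/g; ring.
have tr0 : 0 < t `^ r by rewrite powR_gt0.
have := @powR_iter_ge R p (E * g) C (nu t x / t `^ r).
rewrite p_gt0 p_lt1 => /(_ isT) H.
have Eg0 : 0 < E * g by exact: mulr_gt0.
have : (E * g) `^ r <= nu t x / t `^ r.
  by apply: H => // k; rewrite itE ler_pdivlMr// mulrAC; apply: key; exact: ltW.
by rewrite ler_pdivlMr// -powRM ?(ltW Eg0) ?(ltW t0)// mulrAC.
Qed.


End solution.
End lower_bound.

(** * The O(t^r) bound and a supersolution *)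

Section upper_bound.
Variables (R : realType) (n : nat) (V : 'rV[R]_n -> R) (p sigma vl vu eps0 : R).
Hypotheses (V_ge0 : forall x, 0 <= V x) (p_gt0 : 0 < p) (p_lt1 : p < 1).
Hypotheses (sigma_ge0 : 0 <= sigma) (vl_gt0 : 0 < vl) (vu_gt0 : 0 < vu) (eps0_gt0 : 0 < eps0).
Hypothesis V_le : forall x, V x <= vu * enorm x `^ sigma.
Notation leb := (@lebesgue_measure R).
Implicit Types (x y : 'rV[R]_n) (v w mu nu : R -> 'rV[R]_n -> R).

Let r := (1 - p)^-1.
Let q1_gt0 : 0 < 1 - p. Proof. by rewrite subr_gt0. Qed.
Let r_gt0 : 0 < r. Proof. by rewrite invr_gt0. Qed.
Let r_gt1 : 1 < r. Proof. by rewrite invf_gt1// gtrBl. Qed.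
Let rp : r * p = r - 1. Proof. by rewrite /r; field; rewrite gt_eqF. Qed.

(** [Phi_le_add] against the zero function. *)
Lemma Phi_le_int w (t : R) x (G1 G2 : R -> R) :
  measurable_fun setT G1 -> measurable_fun setT G2 ->
  (forall tau y, 0 <= tau <= t -> 0 <= w tau y) ->
  (forall tau, 0 <= tau <= t -> 0 <= G1 tau) ->
  (forall tau, 0 <= tau <= t -> 0 <= G2 tau) ->
  (forall tau, 0 <= tau <= t -> (Bconv (w tau) x <= (G1 tau)%:E)%E) ->
  (forall tau, 0 <= tau <= t ->
     (Bconv (fun y => (V y * (w tau y) `^ p)%R) x <= (G2 tau)%:E)%E) ->
  (Phi V p w t x <= \int[leb]_(tau in (`[0%R, t]%classic : set R))
     (G1 tau + expR ((1 - p) * tau) * G2 tau)%:E)%E.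
Proof.
move=> mG1 mG2 w0 G10 G20 H1 H2.
have z2 : Bconv (fun y => V y * 0 `^ p) x = 0%E.
  rewrite (_ : (fun y => _) = fun=> 0) ?Bconv0//.
  by apply/funext => y; rewrite powR0 ?mulr0// gt_eqF.
have := @Phi_le_add _ _ _ p V_ge0 (fun _ _ => 0) w t x x G1 G2 mG1 mG2.
rewrite [X in _ -> _ -> _ -> _ -> _ -> _ -> (_ <= X + _)%E](_ : _ = 0%E).
  rewrite add0e; apply => // tau tt; first by rewrite Bconv0 add0e H1.
  by rewrite z2 add0e H2.
rewrite /Phi !integral0_eq ?adde0// => tau _; first by rewrite z2 mule0.
by rewrite Bconv0.
Qed.

(* S = sup nu / phi over [0, t] satisfies S <= t (K S + C2 S^p) <= t C' S^p. *)
Lemma apriori (ep T M0 : R) nu : n%:R * ep ^+ 2 < 1 -> 0 < ep -> 0 <= M0 ->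
  (forall t x, 0 <= t <= T -> 0 <= nu t x <= M0 * phi ep x) ->
  (forall t x, 0 <= t <= T -> ((nu t x)%:E <= Phi V p nu t x)%E) ->
  exists2 M : R, 0 <= M & forall t x, 0 <= t <= T -> nu t x <= M * t `^ r * phi ep x.
Proof.
move=> e1 ep0 M00 nuM nuP.
set K := (1 - n%:R * ep ^+ 2)^-1.
have K0 : 0 < K by rewrite invr_gt0 subr_gt0.
have ph0 y : 0 < phi ep y by exact: phi_gt0.
have sr0 : 0 <= sigma * r by apply: mulr_ge0 => //; exact: ltW.
have [C1 C10 C1P] := @W_le_phi R n (sigma * r) ep sr0 ep0.
(* Writing |y|^sigma as (|y|^(sigma r))^(1-p) bounds V by a multiple of phi^(1-p), so that V phi^p
   is again bounded by a multiple of phi. *)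
set C := vu * C1 `^ (1 - p).
have C0 : 0 <= C by rewrite mulr_ge0 ?powR_ge0// ltW.
have VC m y : 0 <= m -> V y * (m * phi ep y) `^ p <= C * m `^ p * phi ep y.
  move=> m0; apply: (@le_trans _ _ (vu * (C1 * phi ep y) `^ (1 - p) * (m * phi ep y) `^ p)).
    rewrite ler_wpM2r ?powR_ge0//; apply: le_trans (V_le y) _; rewrite ler_pM2l//.
    have -> : enorm y `^ sigma = (enorm y `^ (sigma * r)) `^ (1 - p).
      by rewrite -powRrM -mulrA mulVf ?mulr1// gt_eqF.
    apply: ge0_ler_powR; rewrite ?nnegrE ?powR_ge0 ?(ltW q1_gt0)//.
      by rewrite mulr_ge0 ?(ltW C10)// ltW.
    exact: le_trans (enorm_powR_le_W _ sr0) (C1P y).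
  rewrite !powRM ?(ltW C10) ?(ltW (ph0 y))// -/C.
  have E : phi ep y `^ (1 - p) * phi ep y `^ p = phi ep y.
    by rewrite -powRD ?subrK ?powRr1 ?(ltW (ph0 y))// oner_eq0.
  rewrite le_eqVlt; apply/orP; left; apply/eqP.
  by rewrite -[in RHS]E /C; ring.
set C2 := expR ((1 - p) * T) * (C * K).
have C20 : 0 <= C2 by apply: mulr_ge0; [exact: expR_ge0|apply: mulr_ge0 => //; exact: ltW].
(* From S <= M0 follows S <= M0^(1-p) S^p, which turns the linear term into a multiple of S^p;
   dividing by S^p leaves S^(1-p) <= C' t. *)
pose C' := K * M0 `^ (1 - p) + C2.
have C'0 : 0 <= C' by rewrite addr_ge0// mulr_ge0 ?powR_ge0// ltW.
exists (C' `^ r); first exact: powR_ge0.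
move=> t x tT; have /andP[t0 tleT] := tT.
pose A := [set z : R | exists tau y, 0 <= tau <= t /\ z = nu tau y / phi ep y].
have sub tau : 0 <= tau <= t -> 0 <= tau <= T.
  by move=> /andP[-> /le_trans]; apply.
have Aub : ubound A M0.
  move=> _ [tau [y [/sub tt ->]]]; rewrite ler_pdivrMr//.
  by have /andP[] := nuM tau y tt.
have Ane : A !=set0 by exists (nu t x / phi ep x), t, x; rewrite t0 lexx.
have Asup : has_sup A by split => //; exists M0.
set S := sup A.
have SM0 : S <= M0 by apply: ge_sup.
have nuS tau y : 0 <= tau <= t -> nu tau y <= S * phi ep y.
  by move=> tt; rewrite -ler_pdivrMr//; apply: ub_le_sup; [exists M0|exists tau, y].
have S0 : 0 <= S.
  have : 0 <= nu t x by have /andP[] := nuM t x tT.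
  by move=> /le_trans /(_ (nuS t x _)); rewrite t0 lexx => /(_ isT); rewrite pmulr_lge0.
have KS0 : 0 <= K * S + C2 * S `^ p.
  by apply: addr_ge0; apply: mulr_ge0 => //; [exact: ltW|exact: powR_ge0].
have step : S <= t * (K * S + C2 * S `^ p).
  apply: ge_sup => // _ [tau [y [tt ->]]]; rewrite ler_pdivrMr// -lee_fin.
  apply: le_trans (nuP tau y (sub _ tt)) _.
  have /andP[tau0 taut] := tt.
  have nu0 s z : 0 <= s <= tau -> 0 <= nu s z.
    move=> /andP[s0 st]; have ts : 0 <= s <= t by rewrite s0 (le_trans st).
    by have /andP[] := nuM s z (sub s ts).
  have st s : 0 <= s <= tau -> 0 <= s <= t by move=> /andP[-> /le_trans]; apply.
  have K'0 (z : 'rV[R]_n) : 0 <= K * phi ep z by apply: mulr_ge0; [exact: ltW|exact/ltW/ph0].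
  pose G1 := S * (K * phi ep y); pose G2 := C * S `^ p * (K * phi ep y).
  have G10 : 0 <= G1 by apply: mulr_ge0.
  have CS0 : 0 <= C * S `^ p by apply: mulr_ge0 => //; exact: powR_ge0.
  have G20 : 0 <= G2 by apply: mulr_ge0.
  have := @Phi_le_int nu tau y (cst G1) (cst G2) (@measurable_cst _ _ _ _ _ _) (@measurable_cst _ _ _ _ _ _) nu0 (fun _ _ => G10) (fun _ _ => G20) _ _.
  move=> H; apply: le_trans (H _ _) _.
  - move=> s tts; have := @Bconv_le_add R n ep S (nu s) (fun=> 0) y y y e1 S0.
    rewrite Bconv0 add0e; apply=> // z; first exact: nu0.
    by rewrite add0r; apply: nuS; exact: st.
  - move=> s tts; have := @Bconv_le_add R n ep (C * S `^ p) (fun z => V z * nu s z `^ p) (fun=> 0) y y y e1 CS0.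
    rewrite Bconv0 add0e; apply=> // z; first by rewrite mulr_ge0 ?powR_ge0.
    rewrite add0r; apply: le_trans (VC S _ S0); rewrite ler_wpM2l//.
    have := nuS s (y - z) (st _ tts) => h.
    by apply: ge0_ler_powR; [exact: ltW|rewrite nnegrE nu0|rewrite nnegrE (le_trans _ h)// nu0|exact: h].
  pose c := (K * S + C2 * S `^ p) * phi ep y.
  have c0 : 0 <= c.
    by rewrite mulr_ge0 ?(ltW (ph0 y))// KS0.
  apply: (@le_trans _ _ (\int[leb]_(s in (`[0%R, tau]%classic : set R)) (cst c%:E) s)%E).
    apply: ge0_le_integral_nm => s; rewrite /= in_itv/= => tts.
      by rewrite lee_fin addr_ge0// mulr_ge0// expR_ge0.
    have /andP[s0 stau] := tts.
    rewrite lee_fin /= /c /G1 /G2 [leRHS]mulrDl; apply: lerD.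
      by rewrite le_eqVlt; apply/orP; left; apply/eqP; ring.
    have -> : C2 * S `^ p * phi ep y = expR ((1 - p) * T) * (C * S `^ p * (K * phi ep y)).
      by rewrite /C2; ring.
    rewrite ler_wpM2r// ler_expR ler_pM2l//.
    by rewrite (le_trans stau)// (le_trans taut).
  rewrite integral_cst//= lebesgue_measure_itv/= lte_fin.
  have [_|_] := ltP 0 tau.
    rewrite -EFinB -EFinM lee_fin subr0 /c mulrC mulrA ler_wpM2r ?(ltW (ph0 y))//.
    by rewrite ler_wpM2r// KS0.
  rewrite mule0 lee_fin; apply: mulr_ge0; last exact: ltW.
  by rewrite mulr_ge0// KS0.
have SC : S <= C' `^ r * t `^ r.
  have [->|Sn] := eqVneq S 0; first by rewrite mulr_ge0 ?powR_ge0.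
  have Sp : 0 < S by rewrite lt_neqAle eq_sym Sn.
  have Sp0 : 0 < S `^ p by rewrite powR_gt0.
  have SE : S = S `^ (1 - p) * S `^ p by rewrite -powRD ?subrK ?powRr1// oner_eq0.
  have h : S `^ (1 - p) <= C' * t.
    rewrite -(ler_pM2r Sp0) -SE; apply: le_trans step _.
    have -> : C' * t * S `^ p = t * (K * (M0 `^ (1 - p) * S `^ p) + C2 * S `^ p).
      by rewrite /C'; ring.
    rewrite ler_wpM2l// lerD2r ler_pM2l// {1}SE ler_pM2r//.
    by apply: ge0_ler_powR; rewrite ?nnegrE ?(ltW q1_gt0).
  rewrite -powRM//; have -> : S = (S `^ (1 - p)) `^ r.
    by rewrite -powRrM mulfV ?gt_eqF// powRr1.
  by apply: ge0_ler_powR; rewrite ?nnegrE ?powR_ge0 ?(ltW r_gt0)// mulr_ge0.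
have := nuS t x; rewrite t0 lexx => /(_ isT) h; apply: le_trans h _.
by rewrite ler_wpM2r// ltW.
Qed.

Let b := sigma * r.

Let b_ge0 : 0 <= b. Proof. by apply: mulr_ge0 => //; exact: ltW. Qed.

(** The exponent b satisfies b = sigma + p b, so the source preserves this weight. *)
Lemma source_le_W (c : R) y : 0 <= c -> V y * (c * W b y) `^ p <= vu * c `^ p * W b y.
Proof.
move=> c0; have W0 := W_gt0 b y.
have -> : vu * c `^ p * W b y = vu * W sigma y * (c * W b y) `^ p.
  have L0 : 0 <= 1 + l1 y by rewrite addr_ge0// l1_ge0.
  have bp0 : 0 <= b * p by rewrite mulr_ge0// ltW.
  rewrite powRM ?(ltW W0)// /W -powRrM.
  have {1}-> : b = sigma + b * p by rewrite /b -mulrA rp mulrBr mulr1 addrC subrK.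
  by rewrite powRD_ge0//; ring.
rewrite ler_wpM2r ?powR_ge0//; apply: le_trans (V_le y) _.
by rewrite ler_pM2l// enorm_powR_le_W.
Qed.

Lemma supersolution : exists Q N K : R, [/\ 0 < Q, 0 < N, 0 < K,
  (forall x, (Bconv (W b) x <= (K * W b x)%:E)%E) &
  let S t x := Q * (t `^ r * expR (N * t)) * W b x in
  forall t x, 0 <= t ->
    (Phi V p S t x <= (S t x)%:E)%E /\ subsol p sigma vl eps0 t x <= S t x].
Proof.
have [K K0 KP] := @Bconv_W R n b b_ge0.
set E := (1 - p) * (eps0 * vl).
have E0 : 0 < E by rewrite !mulr_gt0.
(* Since Q^(1-p) = Q0, the first summand makes Q r dominate the source term Q^p vu K, and the second
   puts the supersolution above [subsol]. *)
pose Q0 := vu * K / r + E.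
have vK0 : 0 < vu * K / r by apply: divr_gt0 => //; exact: mulr_gt0.
have Q00 : 0 < Q0 by exact: addr_gt0.
pose Q := Q0 `^ r; pose N := K + 1.
have Q_gt0 : 0 < Q by exact: powR_gt0.
have N_gt0 : 0 < N by exact: addr_gt0.
exists Q, N, K; split => // S t x t0; split; last first.
  rewrite /subsol -/E powRM; [|exact: mulr_ge0 (ltW E0) t0|exact: powR_ge0].
  rewrite (powRM _ (ltW E0) t0) -powRrM /S.
  apply: ler_pM; rewrite ?mulr_ge0 ?powR_ge0//; last exact: enorm_powR_le_W.
  apply: ler_pM; rewrite ?powR_ge0//.
    apply: ge0_ler_powR; rewrite ?nnegrE ?(ltW r_gt0) ?(ltW E0) ?(ltW Q00)//.
    by rewrite /Q0 lerDr ltW.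
  by rewrite ler_peMr ?powR_ge0// -[leLHS]expR0 ler_expR mulr_ge0// ltW.
have W0 y : 0 <= W b y by rewrite ltW// W_gt0.
pose c tau := Q * (tau `^ r * expR (N * tau)).
have c0 tau : 0 <= c tau by rewrite !mulr_ge0 ?powR_ge0 ?expR_ge0.
pose G1 tau := c tau * (K * W b x); pose G2 tau := vu * c tau `^ p * (K * W b x).
have mc : measurable_fun setT c.
  apply: measurable_funM => //; apply: measurable_funM; first exact: measurable_powR.
  by apply: measurableT_comp => //; exact: mulrl_measurable.
have mG1 : measurable_fun setT G1 by apply: measurable_funM.
have mG2 : measurable_fun setT G2.
  apply: measurable_funM => //; apply: measurable_funM => //.
  exact: (measurableT_comp (measurable_powR p) mc).
have KW0 : 0 <= K * W b x by rewrite mulr_ge0// ltW.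
have G10 tau : 0 <= G1 tau by apply: mulr_ge0.
have G20 tau : 0 <= G2 tau.
  by apply: mulr_ge0 => //; apply: mulr_ge0; [exact: ltW|exact: powR_ge0].
have S0 tau y : 0 <= S tau y by apply: mulr_ge0 => //; exact: c0.
have := @Phi_le_int S t x G1 G2 mG1 mG2 (fun tau y _ => S0 tau y) (fun tau _ => G10 tau) (fun tau _ => G20 tau).
move=> H; apply: le_trans (H _ _) _.
- move=> tau _; have -> : Bconv (S tau) x = ((c tau)%:E * Bconv (W b) x)%E by exact: (BconvZ x W0 (c0 tau)).
  have -> : (G1 tau)%:E = ((c tau)%:E * (K * W b x)%:E)%E by rewrite -EFinM.
  by apply: lee_wpmul2l; rewrite ?lee_fin.
- move=> tau _.
  have vc0 : 0 <= vu * c tau `^ p by rewrite mulr_ge0 ?powR_ge0// ltW.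
  apply: (@le_trans _ _ (Bconv (fun y => (vu * c tau `^ p) * W b y) x)).
    apply: le_Bconv => y; first by rewrite mulr_ge0 ?powR_ge0.
    exact: (source_le_W y (c0 tau)).
  have -> : (G2 tau)%:E = ((vu * c tau `^ p)%:E * (K * W b x)%:E)%E by rewrite -EFinM.
  by rewrite (BconvZ _ W0 vc0); apply: lee_wpmul2l; rewrite ?lee_fin.
have QW0 : 0 <= Q * W b x by rewrite mulr_ge0// ltW.
have -> : (S t x)%:E = ((Q * W b x)%:E * (t `^ r * expR (N * t))%:E)%E.
  by rewrite -EFinM /S; congr EFin; ring.
rewrite -(integral_powR_expR N r_gt1 t0) -ge0_integralZl_nm//; last first.
  move=> tau _; rewrite lee_fin mulr_ge0 ?expR_ge0// addr_ge0// mulr_ge0 ?powR_ge0//; exact: ltW.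
apply: ge0_le_integral_nm => tau; rewrite /= in_itv/= => /andP[tau0 _].
  by rewrite lee_fin addr_ge0// mulr_ge0// expR_ge0.
rewrite -EFinM lee_fin /G1 /G2.
have cp : c tau `^ p = Q `^ p * (tau `^ (r - 1) * expR (p * (N * tau))).
  rewrite /c !powRM ?mulr_ge0 ?powR_ge0 ?expR_ge0 ?(ltW Q_gt0)// -!powRrM rp.
  by rewrite -expRM (mulrC p).
have QE : Q `^ p * (vu * K) <= Q * r.
  have QQ : Q = Q `^ p * Q0.
    rewrite /Q -powRrM rp -[X in _ * X](powRr1 (ltW Q00)) -powRD ?subrK//.
    by rewrite (negbTE (_ : r != 0)) ?gt_eqF.
  rewrite [X in _ <= X * _]QQ -mulrA ler_pM2l ?powR_gt0// /Q0 mulrDl divfK ?gt_eqF// lerDl.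
  by apply: mulr_ge0; exact: ltW.
set e := expR (N * tau); set a := tau `^ (r - 1).
have e0 : 0 <= e by exact: expR_ge0.
have a0 : 0 <= a by exact: powR_ge0.
(* This needs N >= 1, and the linear term needs N >= K; hence N = K + 1. *)
have ee : expR ((1 - p) * tau) * expR (p * (N * tau)) <= e.
  rewrite -expRD ler_expR -subr_ge0.
  have -> : N * tau - ((1 - p) * tau + p * (N * tau)) = (1 - p) * (K * tau) by rewrite /N; ring.
  by rewrite !mulr_ge0// ltW.
have h1 : c tau * (K * W b x) <= Q * W b x * (N * tau `^ r * e).
  have -> : Q * W b x * (N * tau `^ r * e) = c tau * (N * W b x) by rewrite /c -/e; ring.
  by rewrite ler_wpM2l// ler_wpM2r// lerDl.
have h2 : expR ((1 - p) * tau) * (vu * c tau `^ p * (K * W b x)) <= Q * W b x * (r * a * e).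
  rewrite cp -/a.
  have -> : expR ((1 - p) * tau) * (vu * (Q `^ p * (a * expR (p * (N * tau)))) * (K * W b x)) =
    (Q `^ p * (vu * K)) * (a * W b x) * (expR ((1 - p) * tau) * expR (p * (N * tau))) by ring.
  have -> : Q * W b x * (r * a * e) = (Q * r) * (a * W b x) * e by ring.
  apply: ler_pM => //.
  - by rewrite !mulr_ge0 ?powR_ge0// ltW.
  - by rewrite ler_wpM2r// mulr_ge0.
apply: le_trans (lerD h1 h2) _.
by rewrite le_eqVlt; apply/orP; left; apply/eqP; ring.
Qed.

End upper_bound.

(** * Existence of a nontrivial solution *)

Section rV_topology.
Variables (R : realType) (n : nat).
Implicit Types (x y : 'rV[R]_n).

Lemma nbhs_rVP x (P : set 'rV[R]_n) : nbhs x P <->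
  exists2 e : R, 0 < e & forall x', (forall i, `|x' ord0 i - x ord0 i| < e) -> P x'.
Proof.
split.
  move=> /nbhs_ballP[e /= e0 eH]; exists e => // x' x'e; apply: eH; split => // i j.
  by rewrite (ord1 i) /ball/= distrC.
move=> [e e0 eH]; apply/nbhs_ballP; exists e => //= x' [_ x'e]; apply: eH => i.
by have := x'e ord0 i; rewrite /ball/= distrC.
Qed.

Definition cube (L : R) : set 'rV[R]_n := [set y | forall i, `|y ord0 i| <= L].

Lemma compact_cube L : compact (cube L).
Proof.
rewrite (_ : cube L = [set v : 'rV[R]_n | forall i, (`[- L, L]%classic : set R) (v ord0 i)]).
  apply: (@rV_compact _ _ (fun=> `[- L, L]%classic)) => _.
  exact: segment_compact.
by apply/seteqP; split => y /= yL i; have := yL i; rewrite in_itv/= ler_norml.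
Qed.

Lemma continuous_bounded_on_cube (f : 'rV[R]_n -> R) L : continuous f ->
  exists2 M : R, 0 <= M & forall y, cube L y -> `|f y| <= M.
Proof.
move=> cf.
have : compact (f @` cube L).
  by apply: continuous_compact; [exact: continuous_subspaceT|exact: compact_cube].
move=> /compact_bounded[M [Mr MP]]; exists (`|M| + 1); first by rewrite addr_ge0.
move=> y yL; apply: (MP (`|M| + 1)); last by exists y.
by rewrite (le_lt_trans (ler_norm M))// ltrDl.
Qed.

Lemma BC_bound (a : R) (f : 'rV[R]_n -> R) : 0 <= a -> BC a f ->
  exists2 C : R, 0 <= C & forall x, `|f x| <= C * (1 + enorm x) `^ a.
Proof.
move=> a0 [cf [C [R0 CP]]].
have [M M0 MP] := continuous_bounded_on_cube R0 cf.
exists (`|C| + M); first by rewrite addr_ge0.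
move=> x; have e0 := enorm_ge0 x.
have ex0 : 0 <= (1 + enorm x) `^ a by exact: powR_ge0.
have [xR|xR] := leP R0 (enorm x).
  apply: le_trans (CP _ xR) _; apply: (@le_trans _ _ (`|C| * (1 + enorm x) `^ a)).
    apply: (@le_trans _ _ (`|C| * enorm x `^ a)); first by rewrite ler_wpM2r ?powR_ge0// ler_norm.
    rewrite ler_wpM2l//; apply: ge0_ler_powR; rewrite ?nnegrE ?addr_ge0//.
    by rewrite lerDr.
  by rewrite ler_wpM2r// lerDl.
have : `|f x| <= M.
  by apply: MP => i; rewrite (le_trans (coord_le_enorm x i))// ltW.
move=> /le_trans; apply; apply: (@le_trans _ _ (M * 1)); first by rewrite mulr1.
apply: ler_pM => //; first by rewrite lerDr.
have -> : 1 = 1 `^ a :> R by rewrite powR1.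
by apply: ge0_ler_powR; rewrite ?nnegrE ?addr_ge0 ?powR1// lerDl.
Qed.

Lemma enorm_powR_le_Wa (a : R) x : 0 <= a -> (1 + enorm x) `^ a <= W a x.
Proof.
move=> a0; apply: ge0_ler_powR; rewrite ?nnegrE ?addr_ge0 ?enorm_ge0 ?l1_ge0//.
by rewrite lerD2l enorm_le_l1.
Qed.

Lemma W_le_enorm (b a : R) x : 0 <= b -> b <= a ->
  W b x <= n.+1%:R `^ b * (1 + enorm x) `^ a.
Proof.
move=> b0 ba; have e0 := enorm_ge0 x.
apply: (@le_trans _ _ ((n.+1%:R * (1 + enorm x)) `^ b)).
  apply: ge0_ler_powR; rewrite ?nnegrE ?mulr_ge0 ?addr_ge0 ?l1_ge0//.
  have := l1_le_enorm x; rewrite -natr1; have : 0 <= n%:R :> R by [].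
  set N := n%:R; nra.
rewrite powRM ?addr_ge0//; apply: ler_wpM2l; first exact: powR_ge0.
by apply: ler_powR => //; rewrite lerDl.
Qed.

Lemma W_le_near (b : R) x x' : 0 <= b -> (forall i, `|x' ord0 i - x ord0 i| < 1) ->
  W b x' <= (1 + l1 x + n%:R) `^ b.
Proof.
move=> b0 xx'; apply: ge0_ler_powR; rewrite ?nnegrE ?addr_ge0 ?l1_ge0//.
rewrite -addrA lerD2l -[n in n%:R]card_ord -sumr_const -big_split/=.
apply: ler_sum => i _; have := xx' i.
by have := ler_normD (x' ord0 i - x ord0 i) (x ord0 i); rewrite subrK => h1 h2; lra.
Qed.

Definition equicont (I : Type) (D : set I) (F : I -> 'rV[R]_n -> R) : Prop :=
  forall x (eta : R), 0 < eta -> exists2 e : R, 0 < e &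
    forall x', (forall i, `|x' ord0 i - x ord0 i| < e) ->
      forall j, D j -> `|F j x' - F j x| <= eta.

(** For large y the growth W b is beaten by a small multiple of [phi]; on the remaining cube
    compactness makes the equicontinuity uniform. The sum is an error that [Bconv_le_add]
    accepts. *)
Lemma Bconv_equicont (I : Type) (D : set I) (F : I -> 'rV[R]_n -> R) (b C : R) :
  0 <= b -> 0 <= C -> (forall j y, D j -> 0 <= F j y <= C * W b y) -> equicont D F ->
  forall x (eta : R), 0 < eta -> exists2 e : R, 0 < e &
    forall x', (forall i, `|x' ord0 i - x ord0 i| < e) -> forall j, D j ->
      (Bconv (F j) x' <= Bconv (F j) x + eta%:E)%E /\
      (Bconv (F j) x <= Bconv (F j) x' + eta%:E)%E.
Proof.
move=> b0 C0 FC Feq x eta eta0.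
have [ep ep0 e1] := exists_exponent n (lexx 0) (@ltr01 R); rewrite subr0 in e1.
pose Kp := (1 - n%:R * ep ^+ 2)^-1 * phi ep (0 : 'rV[R]_n).
have Kp0 : 0 < Kp by rewrite mulr_gt0 ?phi_gt0// invr_gt0 subr_gt0.
pose eta' := eta / Kp.
have eta'0 : 0 < eta' by exact: divr_gt0.
have b10 : 0 <= b + 1 by rewrite addr_ge0.
(* The extra power of 1 + |y|_1 supplies the decay that makes the constant small beyond the radius
   L. *)
have [C1 C10 C1P] := @W_le_phi R n (b + 1) ep b10 ep0.
pose w := (1 + l1 x + n%:R) `^ b.
have w0 : 0 <= w by exact: powR_ge0.
pose L := C * w * C1 / eta'.
have L0 : 0 <= L by rewrite !mulr_ge0 ?invr_ge0// ltW.
have far x' y j : D j -> (forall i, `|x' ord0 i - x ord0 i| < 1) -> L <= l1 y ->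
    F j (x' - y) <= eta' * phi ep y.
  move=> Dj xx' Ly; have /andP[_ FCy] := FC j (x' - y) Dj; apply: le_trans FCy _.
  have ly0 : 0 < 1 + l1 y by rewrite ltr_pwDl// l1_ge0.
  have Wy : W b y * (1 + l1 y) <= C1 * phi ep y.
    apply: le_trans (C1P y); rewrite /W powRD_ge0// powRr1 ?(ltW ly0)//.
  have W1 := W_subM x' y b0; have W2 := W_le_near b0 xx'.
  have Wy0 : 0 <= W b y by rewrite ltW// W_gt0.
  apply: (@le_trans _ _ (C * (w * W b y))).
    rewrite ler_wpM2l//; apply: le_trans W1 _; rewrite ler_wpM2r//.
  rewrite -(ler_pM2r ly0).
  apply: (@le_trans _ _ (C * w * (C1 * phi ep y))).
    have -> : C * (w * W b y) * (1 + l1 y) = C * w * (W b y * (1 + l1 y)) by ring.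
    by rewrite ler_wpM2l// mulr_ge0.
  have -> : C * w * (C1 * phi ep y) = eta' * phi ep y * L.
    by rewrite /L; field; rewrite gt_eqF.
  apply: ler_wpM2l; last by rewrite (le_trans Ly)// lerDr.
  by apply: mulr_ge0; apply: ltW => //; exact: phi_gt0.
(* A neighbourhood of x is obtained from one at each y of the cube, uniformly by compactness; both
   values are compared with the one at the centre. *)
have near : nbhs x [set x' | cube L `<=` [set y | forall j, D j -> `|F j (x' - y) - F j (x - y)| <= eta']].
  have cov : near_covering (cube L) by apply/compact_near_coveringP; exact: compact_cube.
  apply: (cov _ (nbhs x) (fun x' => [set y | forall j, D j -> `|F j (x' - y) - F j (x - y)| <= eta'])).
  move=> y _.
  have h2 : 0 < eta' / 2 by rewrite divr_gt0.
  have [e e0 eP] := Feq (x - y) _ h2.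
  have e20 : 0 < e / 2 by rewrite divr_gt0.
  exists ([set y' : 'rV[R]_n | forall i, `|y' ord0 i - y ord0 i| < e / 2],
          [set x' : 'rV[R]_n | forall i, `|x' ord0 i - x ord0 i| < e / 2]) => /=.
    by split; apply/nbhs_rVP; exists (e / 2).
  move=> [y' x'] /= [hy hx] j Dj.
  have A1 : `|F j (x' - y') - F j (x - y)| <= eta' / 2.
    apply: eP => // i; rewrite !mxE.
    have := hy i; have := hx i; rewrite !ltr_norml => /andP[? ?] /andP[? ?].
    by apply/andP; split; lra.
  have A2 : `|F j (x - y') - F j (x - y)| <= eta' / 2.
    apply: eP => // i; rewrite !mxE.
    have := hy i; rewrite !ltr_norml => /andP[? ?].
    by apply/andP; split; lra.
  move: A1 A2; rewrite !ler_norml => /andP[? ?] /andP[? ?].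
  by apply/andP; split; lra.
have [e e0 eP] := (nbhs_rVP x _).1 near.
exists (Num.min e 1); first by rewrite lt_min e0 ltr01.
move=> x' xx' j Dj.
have xx'e i : `|x' ord0 i - x ord0 i| < e by have := xx' i; rewrite lt_min => /andP[].
have xx'1 i : `|x' ord0 i - x ord0 i| < 1 by have := xx' i; rewrite lt_min => /andP[].
have xx1 i : `|x ord0 i - x ord0 i| < 1 by rewrite subrr normr0.
have F0 y : 0 <= F j y by have /andP[] := FC j y Dj.
have ph1 y : 1 <= phi ep y by apply: phi_ge1; exact: ltW.
have eE : (eta%:E = (eta' * Kp)%:E)%E by rewrite divfK// gt_eqF.
have cmp y : `|F j (x' - y) - F j (x - y)| <= eta' * phi ep y.
  have [Ly|Ly] := leP L (l1 y).
    have h1 := far x' y j Dj xx'1 Ly; have h2 := far x y j Dj xx1 Ly.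
    have h3 := F0 (x' - y); have h4 := F0 (x - y).
    by rewrite ler_norml; apply/andP; split; lra.
  apply: (@le_trans _ _ (eta' * 1)); last by rewrite ler_pM2l.
  rewrite mulr1; apply: (eP x' xx'e y _ j Dj) => i.
  by rewrite (le_trans (coord_le_l1 y i))// ltW.
split; rewrite eE; apply: Bconv_le_add => // ; rewrite ?(ltW eta'0)// => y;
  rewrite sub0r phiN; have := cmp y; rewrite ler_norml => /andP[? ?]; lra.
Qed.

End rV_topology.

(** * The downward iteration and its limit *)

Section existence.
Variables (R : realType) (n : nat) (V : 'rV[R]_n -> R) (p sigma vl vu eps0 : R).
Hypotheses (V_ge0 : forall x, 0 <= V x) (V_cont : continuous V).
Hypotheses (p_gt0 : 0 < p) (p_lt1 : p < 1).
Hypotheses (sigma_ge0 : 0 <= sigma) (vl_gt0 : 0 < vl) (vu_gt0 : 0 < vu) (eps0_gt0 : 0 < eps0).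
Hypothesis V_le : forall x, V x <= vu * enorm x `^ sigma.
Hypothesis V_ge : forall x, 1 <= enorm x -> vl * enorm x `^ sigma <= V x.
Hypothesis eps0_le : forall (x : 'rV[R]_n) d, 0 <= d -> d <= sigma * p / (1 - p) ->
  ((eps0 * enorm x `^ (sigma + d))%:E <=
   int_Rn (fun y => if (1 <= enorm (x - y))%R then
                      (Bker y * (enorm (x - y) `^ (sigma + d))%:E)%E else 0%E))%E.
Hypothesis q_lt1 : p * vu / (eps0 * vl) < 1.
Notation leb := (@lebesgue_measure R).
Implicit Types (x y : 'rV[R]_n) (v w mu nu : R -> 'rV[R]_n -> R).

Let r := (1 - p)^-1.
Let b := sigma * r.
Let q := p * vu / (eps0 * vl).
Let q1_gt0 : 0 < 1 - p. Proof. by rewrite subr_gt0. Qed.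
Let r_gt0 : 0 < r. Proof. by rewrite invr_gt0. Qed.
Let b_ge0 : 0 <= b. Proof. by apply: mulr_ge0 => //; exact: ltW. Qed.
Let q_gt0 : 0 < q. Proof. by apply: divr_gt0; exact: mulr_gt0. Qed.

Lemma source_equicont v (T C : R) : 0 <= C ->
  (forall tau y, 0 <= tau <= T -> 0 <= v tau y <= C * W b y) ->
  equicont [set tau : R | 0 <= tau <= T] v ->
  equicont [set tau : R | 0 <= tau <= T] (fun tau y => V y * v tau y `^ p).
Proof.
move=> C0 vC veq x eta eta0.
pose w := (1 + l1 x + n%:R) `^ b.
pose B := (C * w) `^ p.
have B0 : 0 <= B by exact: powR_ge0.
pose eta1 := eta / (2 * (B + 1)).
have eta10 : 0 < eta1 by apply: divr_gt0 => //; rewrite mulr_gt0// ltr_wpDl.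
have [e1 e10 e1P] : exists2 e : R, 0 < e & forall x', (forall i, `|x' ord0 i - x ord0 i| < e) ->
    `|V x' - V x| <= eta1.
  have cV : V x' @[x' --> x] --> V x by exact: V_cont.
  have /cvgrPdist_le/(_ _ eta10)/nbhs_rVP[e e0 eP] := cV.
  by exists e => // x' /eP; rewrite distrC.
(* The power is Hölder continuous of order p by subadditivity, so v has to vary by the 1/p-th power
   of the tolerance. *)
pose eta2 := (eta / (2 * (V x + 1))) `^ p^-1.
have h0 : 0 < eta / (2 * (V x + 1)).
  by apply: divr_gt0 => //; rewrite mulr_gt0// ltr_wpDl.
have eta20 : 0 < eta2 by rewrite powR_gt0.
have [e2 e20 e2P] := veq x eta2 eta20.
exists (Num.min 1 (Num.min e1 e2)); first by rewrite !lt_min ltr01 e10 e20.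
move=> x' xx' tau tT.
have xx1 i : `|x' ord0 i - x ord0 i| < 1 by have := xx' i; rewrite !lt_min => /and3P[].
have xe1 i : `|x' ord0 i - x ord0 i| < e1 by have := xx' i; rewrite !lt_min => /and3P[].
have xe2 i : `|x' ord0 i - x ord0 i| < e2 by have := xx' i; rewrite !lt_min => /and3P[].
have dV := e1P x' xe1; have dv := e2P x' xe2 tau tT.
have /andP[a0 aC] := vC tau x' tT; have /andP[c0 _] := vC tau x tT.
set a := v tau x' in dv a0 aC *; set c := v tau x in dv c0 *.
have aB : a `^ p <= B.
  apply: ge0_ler_powR; rewrite ?nnegrE ?(ltW p_gt0) ?mulr_ge0 ?powR_ge0//.
  by apply: le_trans aC _; rewrite ler_wpM2l// W_le_near.
have dp : `|a `^ p - c `^ p| <= eta2 `^ p.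
  have key (s t : R) : 0 <= s -> 0 <= t -> s - t <= eta2 -> s `^ p - t `^ p <= eta2 `^ p.
    move=> s0 t0 st; rewrite lerBlDl.
    apply: le_trans (powR_subadd _ t0 (ltW eta20)); last by rewrite p_gt0 ltW.
    apply: ge0_ler_powR; rewrite ?nnegrE ?(ltW p_gt0)//; first by rewrite addr_ge0// ltW.
    by rewrite -lerBlDl.
  move: dv; rewrite !ler_norml => /andP[d1 d2]; rewrite key// andbT.
  by rewrite lerNl opprB key//; rewrite -[leLHS]opprB lerNl.
have eta2p : eta2 `^ p = eta / (2 * (V x + 1)).
  by rewrite -powRrM mulVf ?gt_eqF// powRr1// ltW.
have -> : V x' * a `^ p - V x * c `^ p = (V x' - V x) * a `^ p + V x * (a `^ p - c `^ p) by ring.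
apply: le_trans (ler_normD _ _) _; rewrite !normrM (ger0_norm (powR_ge0 _ _)) (ger0_norm (V_ge0 x)).
have t1 : `|V x' - V x| * a `^ p <= eta1 * B by apply: ler_pM; rewrite ?powR_ge0.
have t2 : V x * `|a `^ p - c `^ p| <= V x * (eta / (2 * (V x + 1))).
  by rewrite ler_wpM2l// -eta2p.
have t3 : eta1 * B <= eta / 2.
  have -> : eta1 * B = eta / 2 * (B / (B + 1)) by rewrite /eta1; field; rewrite gt_eqF// ltr_wpDl.
  rewrite ler_piMr//; first by apply: divr_ge0 => //; exact: ltW.
  by rewrite ler_pdivrMr ?ltr_wpDl// mul1r lerDl.
have t4 : V x * (eta / (2 * (V x + 1))) <= eta / 2.
  have -> : V x * (eta / (2 * (V x + 1))) = eta / 2 * (V x / (V x + 1)).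
    by field; rewrite gt_eqF// ltr_wpDl.
  rewrite ler_piMr//; first by apply: divr_ge0 => //; exact: ltW.
  by rewrite ler_pdivrMr ?ltr_wpDl// mul1r lerDl.
lra.
Qed.

Lemma Phi_equicont v (T C : R) : 0 <= T -> 0 <= C ->
  (forall tau y, 0 <= tau <= T -> 0 <= v tau y <= C * W b y) ->
  equicont [set tau : R | 0 <= tau <= T] v ->
  forall x (eta : R), 0 < eta -> exists2 e : R, 0 < e &
    forall x', (forall i, `|x' ord0 i - x ord0 i| < e) -> forall t, 0 <= t <= T ->
      (Phi V p v t x' <= Phi V p v t x + eta%:E)%E /\
      (Phi V p v t x <= Phi V p v t x' + eta%:E)%E.
Proof.
move=> T0 C0 vC veq x eta eta0.
pose Z := (T + 1) * (1 + expR ((1 - p) * T)).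
have Z0 : 0 < Z by apply: mulr_gt0; [rewrite ltr_wpDl|rewrite addr_gt0 ?expR_gt0].
pose eta1 := eta / Z.
have eta10 : 0 < eta1 by exact: divr_gt0.
have [e1 e10 e1P] := Bconv_equicont b_ge0 C0 vC veq x eta10.
have C'0 : 0 <= vu * C `^ p by rewrite mulr_ge0 ?powR_ge0// ltW.
have vC2 tau y : 0 <= tau <= T -> 0 <= V y * v tau y `^ p <= vu * C `^ p * W b y.
  move=> tT; rewrite mulr_ge0 ?powR_ge0//=.
  have /andP[v0 vCy] := vC tau y tT.
  apply: le_trans (source_le_W p_gt0 p_lt1 sigma_ge0 vu_gt0 V_le y C0).
  rewrite ler_wpM2l//; apply: ge0_ler_powR; rewrite ?nnegrE ?(ltW p_gt0)//.
  exact: le_trans vCy.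
have [e2 e20 e2P] := Bconv_equicont b_ge0 C'0 vC2 (source_equicont C0 vC veq) x eta10.
exists (Num.min e1 e2); first by rewrite lt_min e10 e20.
move=> x' xx' t /andP[t0 tT].
have xe1 i : `|x' ord0 i - x ord0 i| < e1 by have := xx' i; rewrite !lt_min => /andP[].
have xe2 i : `|x' ord0 i - x ord0 i| < e2 by have := xx' i; rewrite !lt_min => /andP[].
have sub tau : 0 <= tau <= t -> 0 <= tau <= T.
  by move=> /andP[-> /le_trans]; apply.
have v0 tau y : 0 <= tau <= t -> 0 <= v tau y.
  by move=> tt; have /andP[] := vC tau y (sub _ tt).
have intle : (\int[leb]_(tau in (`[0%R, t]%classic : set R))
     (cst eta1 tau + expR ((1 - p) * tau) * cst eta1 tau)%:E <= eta%:E)%E.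
  pose c := eta1 * (1 + expR ((1 - p) * T)).
  have c0 : 0 <= c.
    by apply: mulr_ge0; [exact: ltW|rewrite addr_ge0// expR_ge0].
  apply: (@le_trans _ _ (\int[leb]_(tau in (`[0%R, t]%classic : set R)) (cst c%:E) tau)%E).
    apply: ge0_le_integral_nm => tau; rewrite /= in_itv/= => /andP[tau0 taut].
      by rewrite lee_fin addr_ge0 ?(ltW eta10)// mulr_ge0 ?expR_ge0// ltW.
    rewrite lee_fin /c mulrDr mulr1 lerD2l mulrC ler_pM2l// ler_expR ler_pM2l//.
    exact: le_trans taut tT.
  rewrite integral_cst//= lebesgue_measure_itv/= lte_fin.
  case: ifPn => _; last by rewrite mule0 lee_fin ltW.
  rewrite -EFinB -EFinM lee_fin subr0.
  apply: (@le_trans _ _ (c * (T + 1))); first by rewrite ler_wpM2l// (le_trans tT)// lerDl.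
  rewrite le_eqVlt; apply/orP; left; apply/eqP.
  rewrite /c /eta1 -mulrA (mulrC (1 + _)) -/Z divfK// gt_eqF//.
have mcst : measurable_fun setT (cst eta1 : R -> R) by exact: measurable_cst.
have e0' (tau : R) : 0 <= tau <= t -> 0 <= cst eta1 tau by move=> _; exact: ltW.
split.
- apply: le_trans (Phi_le_add V_ge0 (x := x) mcst mcst v0 v0 e0' e0' _ _) _.
  + by move=> tau tt; case: (e1P x' xe1 tau (sub _ tt)) => h1 h2; exact: h1.
  + by move=> tau tt; case: (e2P x' xe2 tau (sub _ tt)) => h1 h2; exact: h1.
  + by apply: leeD.
- apply: le_trans (Phi_le_add V_ge0 (x := x') mcst mcst v0 v0 e0' e0' _ _) _.
  + by move=> tau tt; case: (e1P x' xe1 tau (sub _ tt)) => h1 h2; exact: h2.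
  + by move=> tau tt; case: (e2P x' xe2 tau (sub _ tt)) => h1 h2; exact: h2.
  + by apply: leeD.
Qed.

Lemma W_equicont (c : R -> R) (T cT : R) : (forall t, 0 <= t <= T -> 0 <= c t <= cT) ->
  equicont [set tau : R | 0 <= tau <= T] (fun t x => c t * W b x).
Proof.
move=> cP x eta eta0.
pose B := `|cT| + 1.
have B0 : 0 < B by rewrite ltr_wpDl.
have eB : 0 < eta / B by exact: divr_gt0.
have L0 : 0 < 1 + l1 x by rewrite ltr_pwDl// l1_ge0.
have cpow : s `^ b @[s --> 1 + l1 x] --> (1 + l1 x) `^ b.
  have : {for 1 + l1 x, continuous (fun s : R => s `^ b)}.
    apply: differentiable_continuous; apply/derivable1_diffP.
    by apply: derivable_powR; rewrite in_itv/= L0.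
  by [].
have /cvgrPdist_le/(_ _ eB)/nbhs_ballP[d /= d0 dP] := cpow.
have n0 : 0 < n.+1%:R :> R by rewrite ltr0n.
exists (d / n.+1%:R); first by rewrite divr_gt0.
move=> x' xx' t tT; have /andP[c0 ccT] := cP t tT.
have dl : `|l1 x' - l1 x| < d.
  have : `|l1 x' - l1 x| <= n%:R * (d / n.+1%:R).
    rewrite /l1 -sumrB; apply: le_trans (ler_norm_sum _ _ _) _.
    rewrite -[n in n%:R]card_ord mulr_natl -sumr_const; apply: ler_sum => i _.
    by apply: le_trans (ler_dist_dist _ _) _; exact: ltW.
  move=> /le_lt_trans; apply.
  by rewrite mulrCA gtr_pMr// -natr1 ltr_pdivrMr ?ltr_wpDl// mul1r ltrDl.
have dW : `|W b x - W b x'| <= eta / B.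
  by apply: dP; rewrite /ball/= opprD addrACA subrr add0r distrC.
rewrite -mulrBr normrM (ger0_norm c0) distrC.
apply: (@le_trans _ _ (B * (eta / B))).
  apply: ler_pM => //; apply: le_trans ccT _; rewrite /B.
  by rewrite (le_trans (ler_norm _))// lerDl.
by rewrite mulrC divfK// gt_eqF.
Qed.

Lemma small_geometric (th B eta : R) : 0 <= th < 1 -> 0 < eta ->
  exists k, th ^+ k * B <= eta.
Proof.
move=> th1 eta0; have [//|/forallNP H] := pselect (exists k, th ^+ k * B <= eta).
suff : eta <= 0 by rewrite leNgt eta0.
apply: (@le_geometric _ th _ _ B) => // k.
by rewrite add0r ltW// ltNge; apply/negP; exact: H.
Qed.

(** The growth and equicontinuity clauses prepare membership in [Zinf]. *)
Lemma exists_solution : exists mu : R -> 'rV[R]_n -> R,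
  [/\ forall t x, 0 <= t -> subsol p sigma vl eps0 t x <= mu t x,
      forall t x, 0 <= t -> (mu t x)%:E = Phi V p mu t x,
      forall T, 0 <= T -> exists2 C : R, 0 <= C &
        forall t x, 0 <= t <= T -> mu t x <= C * W b x &
      forall T, 0 <= T -> equicont [set tau : R | 0 <= tau <= T] mu].
Proof.
have [Q [N [K [Q0 N0 K0 KP SP]]]] := supersolution V_ge0 p_gt0 p_lt1 sigma_ge0 vl_gt0 vu_gt0 eps0_gt0 V_le.
pose S t x := Q * (t `^ r * expR (N * t)) * W b x.
pose sb := @subsol R n p sigma vl eps0.
have sb0 t x : 0 <= sb t x by exact: subsol_ge0.
have SPhi t x : 0 <= t -> (Phi V p S t x <= (S t x)%:E)%E by move=> t0; exact: (SP t x t0).1.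
have sbS t x : 0 <= t -> sb t x <= S t x by move=> t0; exact: (SP t x t0).2.
have sbPhi t x : 0 <= t -> ((sb t x)%:E <= Phi V p sb t x)%E.
  by move=> t0; apply: subsol_le_Phi.
(* [fine] loses nothing for t >= 0: monotonicity keeps every iterate between [sb] and [S], so Phi
   stays finite. *)
pose m k := iter k (fun v t x => fine (Phi V p v t x)) S.
have inv k : forall t x, 0 <= t -> sb t x <= m k t x <= S t x /\
    (m k.+1 t x)%:E = Phi V p (m k) t x.
  elim: k => [|k IH].
    move=> t x t0; split; first by rewrite sbS //= lexx.
    have h1 : (0 <= Phi V p S t x)%E.
      by apply: Phi_ge0 => // tau y /andP[tau0 _]; exact: le_trans (sb0 _ _) (sbS _ _ tau0).
    by rewrite /= fineK// ge0_fin_numE// (le_lt_trans (SPhi _ _ t0))// ltry.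
  have B t x : 0 <= t -> sb t x <= m k.+1 t x <= S t x.
    move=> t0; rewrite -!lee_fin (IH t x t0).2; apply/andP; split.
      apply: le_trans (sbPhi t x t0) _; apply: le_Phi => // tau y /andP[tau0 _].
      by rewrite sb0; have [/andP[]] := IH tau y tau0.
    apply: le_trans (SPhi t x t0); apply: le_Phi => // tau y /andP[tau0 _].
    have [/andP[h1 ->] _] := IH tau y tau0.
    by rewrite (le_trans (sb0 _ _) h1).
  move=> t x t0; split; first exact: B.
  have h1 : (0 <= Phi V p (m k.+1) t x)%E.
    apply: Phi_ge0 => // tau y /andP[tau0 _].
    by have /andP[h _] := B tau y tau0; exact: le_trans (sb0 _ _) h.
  have h2 : (Phi V p (m k.+1) t x <= (S t x)%:E)%E.
    apply: le_trans (SPhi t x t0); apply: le_Phi => // tau y /andP[tau0 _].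
    have /andP[h ->] := B tau y tau0; rewrite andbT.
    exact: le_trans (sb0 _ _) h.
  have -> : m k.+2 t x = fine (Phi V p (m k.+1) t x) by [].
  by rewrite fineK// ge0_fin_numE// (le_lt_trans h2)// ltry.
have m_0 : m 0%N = S by [].
clearbody m.
have mE k t x : 0 <= t -> (m k.+1 t x)%:E = Phi V p (m k) t x by move=> t0; exact: (inv k t x t0).2.
have msb k t x : 0 <= t -> sb t x <= m k t x by move=> t0; have [/andP[]] := inv k t x t0.
have mS k t x : 0 <= t -> m k t x <= S t x by move=> t0; have [/andP[]] := inv k t x t0.
have m0 k t x : 0 <= t -> 0 <= m k t x by move=> t0; exact: le_trans (sb0 _ _) (msb _ _ _ t0).
have dec k : forall t x, 0 <= t -> m k.+1 t x <= m k t x.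
  elim: k => [|k IH] t x t0; first by rewrite -lee_fin mE// m_0; exact: SPhi.
  rewrite -lee_fin (mE k.+1 t x t0) (mE k t x t0); apply: le_Phi => // tau y /andP[tau0 _].
  by rewrite m0// IH.
have dec_le k l t x : 0 <= t -> (k <= l)%N -> m l t x <= m k t x.
  move=> t0 /subnK <-; elim: (l - k)%N => [|j IH]; first by rewrite add0n.
  by rewrite addSn; apply: le_trans IH; exact: dec.
pose mu t x := inf (range (fun k => m k t x)).
have lb t x : 0 <= t -> has_lbound (range (fun k => m k t x)).
  by move=> t0; exists (sb t x) => _ [k _ <-]; exact: msb.
have ne t x : range (fun k => m k t x) !=set0 by exists (m 0%N t x), 0%N.
have mu_m k t x : 0 <= t -> mu t x <= m k t x.
  by move=> t0; apply: ge_inf; [exact: lb|exists k].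
have le_mu c t x : (forall k, c <= m k t x) -> c <= mu t x.
  by move=> h; apply: lb_le_inf => // _ [k _ <-].
have sb_mu t x : 0 <= t -> sb t x <= mu t x by move=> t0; apply: le_mu => k; exact: msb.
have mu0 t x : 0 <= t -> 0 <= mu t x by move=> t0; exact: le_trans (sb0 _ _) (sb_mu _ _ t0).
clearbody mu.
have [ep ep0 e1q] := exists_exponent n (ltW q_gt0) q_lt1.
have e1 : n%:R * ep ^+ 2 < 1 by apply: lt_trans e1q _; rewrite gtrBl.
have ph0 (x : 'rV[R]_n) : 0 <= phi ep x by rewrite ltW// phi_gt0.
have [C1 C10 C1P] := @W_le_phi R n b ep b_ge0 ep0.
pose th := (1 - n%:R * ep ^+ 2)^-1 * q.
have th1 : 0 <= th < 1.
  apply/andP; split.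
    by apply: mulr_ge0; [rewrite invr_ge0 subr_ge0; exact: ltW|exact: ltW].
  rewrite /th mulrC ltr_pdivrMr ?subr_gt0// mul1r.
  by move: e1q; rewrite ltrBrDr addrC -ltrBrDr.
have th_ge0 : 0 <= th by case/andP: th1.
have SM T t x : 0 <= t <= T -> S t x <= Q * expR (N * T) * C1 * (t `^ r * phi ep x).
  move=> /andP[t0 tT].
  have -> : Q * expR (N * T) * C1 * (t `^ r * phi ep x) =
    Q * (t `^ r * expR (N * T)) * (C1 * phi ep x) by ring.
  apply: ler_pM => //; first by rewrite !mulr_ge0 ?powR_ge0 ?expR_ge0// ltW.
    by rewrite ltW// W_gt0.
  rewrite ler_pM2l// ler_wpM2l ?powR_ge0// ler_expR ler_pM2l//.
(* The second estimate plays the role of a convergence theorem: it bounds Phi of the iterates by Phi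
   of the infimum without any measurability. *)
have conv T : 0 <= T -> exists2 M : R, 0 <= M & forall k t x, 0 <= t <= T ->
    m k t x <= mu t x + th ^+ k * (M * phi ep x) /\
    (Phi V p (m k) t x <= Phi V p mu t x + (th ^+ k * (M * phi ep x))%:E)%E.
  move=> T0; pose M := Q * expR (N * T) * C1.
  have M0 : 0 <= M by rewrite !mulr_ge0 ?expR_ge0// ltW.
  have SMT t x : 0 <= t <= T -> S t x <= M * (t `^ r * phi ep x) by exact: SM.
  clearbody M.
  pose rt := @contraction_rate R p vl vu eps0 T.
  have rt0 : 0 < rt by exact: contraction_rate_gt0.
  pose g t := t `^ r * expR (rt * t).
  have g0 t : 0 <= g t by rewrite mulr_ge0 ?powR_ge0 ?expR_ge0.
  have gT t : 0 <= t <= T -> g t <= g T.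
    move=> /andP[t0 tT]; apply: ler_pM; rewrite ?powR_ge0 ?expR_ge0//.
      by apply: ge0_ler_powR; rewrite ?nnegrE ?(ltW r_gt0).
    by rewrite ler_expR ler_pM2l.
  have tc k : 0 <= th ^+ k * M by rewrite mulr_ge0 ?exprn_ge0.
  (* The gap between iterates k and j + k is the k-fold image of the gap between 0 and j, which is
     at most S and hence O(t^r). *)
  have kc k j : forall t x, 0 <= t <= T -> m k t x <= m (j + k)%N t x + th ^+ k * M * g t * phi ep x.
    elim: k => [|k IH] t x tT; have /andP[t0 _] := tT.
      rewrite addn0 expr0 mul1r; apply: ler_wpDl; first exact: m0.
      rewrite m_0; apply: le_trans (SMT t x tT) _; rewrite -mulrA ler_wpM2l// ler_wpM2r//.
      by rewrite ler_peMr ?powR_ge0// -[leLHS]expR0 ler_expR mulr_ge0// ltW.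
    rewrite -lee_fin addnS EFinD (mE k t x t0) (mE (j + k)%N t x t0).
    have := @Phi_contraction R n V p sigma vl vu eps0 V_ge0 p_gt0 p_lt1 vl_gt0 vu_gt0 eps0_gt0 V_le
      ep T (th ^+ k * M) (m (j + k)%N) (m k) e1 (tc k).
    move=> /(_ _ _ t x tT) H; apply: le_trans (H _ _) _.
    - by move=> tau y /andP[tau0 _]; exact: msb.
    - by move=> tau y tauT; have /andP[tau0 _] := tauT; rewrite m0//= IH.
    - by apply: leeD => //; rewrite -/r -/rt -/q -/th exprS !mulrA.
  have limc k t x : 0 <= t <= T -> m k t x <= mu t x + th ^+ k * M * g t * phi ep x.
    move=> tT; have /andP[t0 _] := tT; rewrite -lerBlDr; apply: le_mu => l; rewrite lerBlDr.
    have [kl|kl] := leqP k l; first by have := kc k (l - k)%N t x tT; rewrite subnK.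
    apply: le_trans (dec_le l k t x t0 (ltnW kl)) _; rewrite lerDl.
    by apply: mulr_ge0 => //; apply: mulr_ge0 => //; exact: tc.
  exists (M * g T); first by rewrite mulr_ge0.
  have up k t x : 0 <= t <= T -> th ^+ k * M * g t * phi ep x <= th ^+ k * (M * g T * phi ep x).
    move=> tT; have -> : th ^+ k * (M * g T * phi ep x) = th ^+ k * M * g T * phi ep x by ring.
    by apply: ler_wpM2r => //; apply: ler_wpM2l; [exact: tc|exact: gT].
  move=> k t x tT; split; first by apply: le_trans (limc k t x tT) _; rewrite lerD2l up.
  have := @Phi_contraction R n V p sigma vl vu eps0 V_ge0 p_gt0 p_lt1 vl_gt0 vu_gt0 eps0_gt0 V_le
    ep T (th ^+ k * M) mu (m k) e1 (tc k).
  move=> /(_ _ _ t x tT) H; apply: le_trans (H _ _) _.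
  - by move=> tau y /andP[tau0 _]; exact: sb_mu.
  - by move=> tau y tauT; have /andP[tau0 _] := tauT; rewrite m0//= limc.
  apply: leeD => //; rewrite lee_fin -/r -/rt -/q -/th; apply: le_trans (up k t x tT).
  rewrite -/(g t).
  have -> : th * (th ^+ k * M) * g t * phi ep x = th * (th ^+ k * M * g t * phi ep x) by ring.
  apply: ler_piMl; last by case/andP: th1 => _ /ltW.
  by apply: mulr_ge0 => //; apply: mulr_ge0 => //; exact: tc.
(* Phi mu lies below every iterate, hence below mu; the geometric error gives the reverse
   inequality. *)
have muE t x : 0 <= t -> (mu t x)%:E = Phi V p mu t x.
  move=> t0; have [M M0 MP] := conv t t0.
  have h0 : (0 <= Phi V p mu t x)%E.
    by apply: Phi_ge0 => // tau y /andP[tau0 _]; exact: mu0.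
  have h1 k : (Phi V p mu t x <= (m k.+1 t x)%:E)%E.
    rewrite (mE k t x t0); apply: le_Phi => // tau y /andP[tau0 _].
    by rewrite mu0 //= mu_m.
  have fin : Phi V p mu t x \is a fin_num.
    by rewrite ge0_fin_numE// (le_lt_trans (h1 0%N))// ltry.
  rewrite -(fineK fin); congr EFin; apply/eqP; rewrite eq_le; apply/andP; split; last first.
    apply: le_mu => k; rewrite -lee_fin fineK//; apply: le_trans (h1 k) _.
    by rewrite lee_fin dec.
  have tt : 0 <= t <= t by rewrite t0 lexx.
  apply: (@le_geometric _ th _ _ (M * phi ep x)) => // k.
  rewrite -lee_fin EFinD fineK//; have [_ h2] := MP k t x tt.
  apply: le_trans h2; rewrite -(mE k t x t0) lee_fin; exact: mu_m.
have St T t x : 0 <= t <= T -> S t x <= Q * (T `^ r * expR (N * T)) * W b x.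
  move=> /andP[t0 tT]; rewrite ler_wpM2r ?(ltW (W_gt0 _ _))// ler_pM2l//.
  apply: ler_pM; rewrite ?powR_ge0 ?expR_ge0//.
    by apply: ge0_ler_powR; rewrite ?nnegrE ?(ltW r_gt0)// (le_trans t0).
  by rewrite ler_expR ler_pM2l.
have CT0 T : 0 <= Q * (T `^ r * expR (N * T)) by rewrite !mulr_ge0 ?powR_ge0 ?expR_ge0// ltW.
have meq k T : 0 <= T -> equicont [set tau : R | 0 <= tau <= T] (m k).
  move=> T0; elim: k => [|k IH].
    rewrite m_0; apply: (@W_equicont (fun t => Q * (t `^ r * expR (N * t))) T (Q * (T `^ r * expR (N * T)))).
    move=> t /andP[t0 tT]; rewrite CT0 ler_pM2l//.
    apply: ler_pM; rewrite ?powR_ge0 ?expR_ge0//.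
      by apply: ge0_ler_powR; rewrite ?nnegrE ?(ltW r_gt0).
    by rewrite ler_expR ler_pM2l.
  have bd tau y : 0 <= tau <= T -> 0 <= m k tau y <= Q * (T `^ r * expR (N * T)) * W b y.
    move=> tT; have /andP[tau0 _] := tT; rewrite m0//=.
    exact: le_trans (mS _ _ _ tau0) (St _ _ _ tT).
  move=> x eta eta0; have [e e0 eP] := Phi_equicont T0 (CT0 T) bd IH x eta0.
  exists e => // x' xx' t tT; have /andP[t0 _] := tT.
  have [] := eP x' xx' t tT; rewrite -(mE k t x t0) -(mE k t x' t0) -!EFinD !lee_fin => h1 h2.
  by rewrite ler_norml; apply/andP; split; lra.
exists mu; split => //.
- move=> T T0; exists (Q * (T `^ r * expR (N * T))) => // t x tT.
  have /andP[t0 _] := tT.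
  have h := mu_m 0%N t x t0; rewrite m_0 in h; exact: le_trans h (St _ _ _ tT).
move=> T T0 x eta eta0; have [M M0 MP] := conv T T0.
(* Bounds M phi on the unit neighbourhood of x, where the iterates therefore converge uniformly; an
   equicontinuous iterate then yields the claim with three errors eta / 3. *)
pose B := M * (2 * expR (ep * (l1 x + 1))) ^+ n.
have eta3 : 0 < eta / 3 by rewrite divr_gt0.
have [k kP] := small_geometric B th1 eta3.
have [e e0 eP] := meq k T T0 x (eta / 3) eta3.
exists (Num.min e 1); first by rewrite lt_min e0 ltr01.
move=> x' xx' t tT; have /andP[t0 _] := tT.
have xe i : `|x' ord0 i - x ord0 i| < e by have := xx' i; rewrite lt_min => /andP[].
have x1 i : `|x' ord0 i - x ord0 i| < 1 by have := xx' i; rewrite lt_min => /andP[].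
have close (z : 'rV[R]_n) : (forall i, `|z ord0 i| <= l1 x + 1) -> mu t z <= m k t z <= mu t z + eta / 3.
  move=> zl; rewrite mu_m//=; have [h _] := MP k t z tT; apply: le_trans h _.
  rewrite lerD2l; apply: le_trans kP; rewrite ler_wpM2l ?exprn_ge0// ler_wpM2l//.
  by apply: phi_le => //; exact: ltW.
have /andP[a1 a2] : mu t x <= m k t x <= mu t x + eta / 3.
  by apply: close => i; rewrite (le_trans (coord_le_l1 x i))// lerDl.
have /andP[a3 a4] : mu t x' <= m k t x' <= mu t x' + eta / 3.
  apply: close => i; have := x1 i; have := coord_le_l1 x i.
  by have := ler_normD (x' ord0 i - x ord0 i) (x ord0 i); rewrite subrK => ? ? ?; lra.
have := eP x' xe t tT; rewrite !ler_norml => /andP[a5 a6].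
by apply/andP; split; lra.
Qed.

End existence.

(** * Characterization of the nontrivial solutions *)

Section Zinf_lemmas.
Variables (R : realType) (n : nat) (a : R).
Hypothesis a_ge0 : 0 <= a.
Implicit Types (x : 'rV[R]_n) (f : R -> 'rV[R]_n -> R).

Lemma BC_scale (c : R) (g : 'rV[R]_n -> R) : BC a g -> BC a (fun x => c * g x).
Proof.
move=> [cg [C [R0 CP]]]; split.
  by move=> x; apply: continuousM; [exact: cst_continuous|exact: cg].
exists (`|c| * C), R0 => x xR; rewrite normrM -mulrA ler_wpM2l//; exact: CP.
Qed.

(** The theorem puts u itself into the space, whereas an s-solution is defined through e^t u. *)
Lemma Zinf_expR f : Zinf a f -> Zinf a (fun t x => expR t * f t x).
Proof.
move=> [fBC ft]; split => [t t0|t t0 eps eps0]; first exact/BC_scale/fBC.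
have [C C0 CP] := BC_bound a_ge0 (fBC t t0).
pose E := expR (t + 1).
have E0 : 0 < E by exact: expR_gt0.
have [d1 d10 d1P] : exists2 d : R, 0 < d & forall s, `|s - t| < d -> `|expR s - expR t| <= eps / (2 * (C + 1)).
  have e0 : 0 < eps / (2 * (C + 1)) by apply: divr_gt0 => //; rewrite mulr_gt0// ltr_wpDl.
  have /cvgrPdist_le/(_ _ e0)/nbhs_ballP[d /= d0 dP] : expR s @[s --> t] --> expR t.
    exact: continuous_expR.
  by exists d => // s st; rewrite distrC; apply: dP; rewrite /ball/= distrC.
have e20 : 0 < eps / (2 * E) by apply: divr_gt0 => //; exact: mulr_gt0.
have [d2 d20 d2P] := ft t t0 _ e20.
exists (Num.min 1 (Num.min d1 d2)); first by rewrite !lt_min ltr01 d10 d20.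
move=> s s0; rewrite !lt_min => /and3P[s1 s2 s3] x.
set w := (1 + enorm x) `^ a.
have w0 : 0 <= w by exact: powR_ge0.
have -> : expR s * f s x - expR t * f t x = expR s * (f s x - f t x) + (expR s - expR t) * f t x by ring.
apply: le_trans (ler_normD _ _) _; rewrite !normrM (ger0_norm (expR_ge0 s)).
have h1 : expR s * `|f s x - f t x| <= E * (eps / (2 * E) * w).
  apply: ler_pM; rewrite ?expR_ge0//; last exact: d2P.
  rewrite ler_expR; move: s1; rewrite ltr_norml => /andP[_ ?]; lra.
have h2 : `|expR s - expR t| * `|f t x| <= eps / (2 * (C + 1)) * (C * w).
  by apply: ler_pM => //; exact: d1P.
have h3 : E * (eps / (2 * E) * w) = eps / 2 * w by field; rewrite gt_eqF.
have h4 : eps / (2 * (C + 1)) * (C * w) <= eps / 2 * w.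
  have -> : eps / (2 * (C + 1)) * (C * w) = eps / 2 * w * (C / (C + 1)).
    by field; rewrite gt_eqF// ltr_wpDl.
  rewrite ler_piMr//; first by rewrite mulr_ge0// divr_ge0// ltW.
  by rewrite ler_pdivrMr ?ltr_wpDl// mul1r lerDl.
lra.
Qed.

Lemma Zinf_shift (k c : R) f : 0 <= k -> 0 <= c <= 1 -> Zinf a f ->
  Zinf a (fun t x => c * f (t + k) x).
Proof.
move=> k0 /andP[c0 c1] [fBC ft]; split => [t t0|t t0 eps eps0].
  by apply/BC_scale/fBC; rewrite addr_ge0.
have tk0 : 0 <= t + k by rewrite addr_ge0.
have [d d0 dP] := ft _ tk0 _ eps0; exists d => // s s0 st x.
have -> : c * f (s + k) x - c * f (t + k) x = c * (f (s + k) x - f (t + k) x) by ring.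
have h : `|f (s + k) x - f (t + k) x| <= eps * (1 + enorm x) `^ a.
  by apply: dP; rewrite ?addr_ge0// opprD addrACA subrr addr0.
by rewrite normrM (ger0_norm c0); apply: le_trans h; rewrite ler_piMl.
Qed.

End Zinf_lemmas.

(** * Time shifts, comparison with the maximal solution, and the characterization *)

Section zero_data_problem.
Variables (R : realType) (n : nat) (V : 'rV[R]_n -> R) (p sigma vl vu eps0 a : R).
Hypotheses (n_gt0 : (0 < n)%N) (V_ge0 : forall x, 0 <= V x) (V_cont : continuous V).
Hypotheses (p_gt0 : 0 < p) (p_lt1 : p < 1).
Hypotheses (sigma_ge0 : 0 <= sigma) (vl_gt0 : 0 < vl) (vu_gt0 : 0 < vu) (eps0_gt0 : 0 < eps0).
Hypothesis V_le : forall x, V x <= vu * enorm x `^ sigma.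
Hypothesis V_ge : forall x, 1 <= enorm x -> vl * enorm x `^ sigma <= V x.
Hypothesis eps0_le : forall (x : 'rV[R]_n) d, 0 <= d -> d <= sigma * p / (1 - p) ->
  ((eps0 * enorm x `^ (sigma + d))%:E <=
   int_Rn (fun y => if (1 <= enorm (x - y))%R then
                      (Bker y * (enorm (x - y) `^ (sigma + d))%:E)%E else 0%E))%E.
Hypothesis q_lt1 : p * vu / (eps0 * vl) < 1.
Hypothesis a_ge : sigma / (1 - p) <= a.
Implicit Types (x y : 'rV[R]_n) (u v mu nu : R -> 'rV[R]_n -> R).

Let r := (1 - p)^-1.
Let b := sigma * r.
Let q := p * vu / (eps0 * vl).
Let q1_gt0 : 0 < 1 - p. Proof. by rewrite subr_gt0. Qed.
Let r_gt0 : 0 < r. Proof. by rewrite invr_gt0. Qed.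
Let b_ge0 : 0 <= b. Proof. by apply: mulr_ge0 => //; exact: ltW. Qed.
Let a_ge0 : 0 <= a. Proof. exact: le_trans b_ge0 a_ge. Qed.
Let q_gt0 : 0 < q. Proof. by apply: divr_gt0; exact: mulr_gt0. Qed.

Lemma s_solution_Phi u : s_solution V p a u <->
  [/\ forall t x, 0 <= t -> 0 <= u t x, Zinf a (fun t x => expR t * u t x) &
      forall t x, 0 <= t -> (expR t * u t x)%:E = Phi V p (fun t x => expR t * u t x) t x].
Proof. by split => [[? [? ?]]|[? ? ?]]. Qed.

(** Ensures that the maximal solution, and hence each of its delays, is nontrivial. *)
Lemma exists_s_solution : exists2 u, s_solution V p a u & exists t x, 0 <= t /\ 0 < u t x.
Proof.
have [mu [sub muE muC mueq]] := exists_solution V_ge0 V_cont p_gt0 p_lt1 sigma_ge0 vl_gt0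
  vu_gt0 eps0_gt0 V_le V_ge eps0_le q_lt1.
have mu0 t x : 0 <= t -> 0 <= mu t x by move=> t0; exact: le_trans (subsol_ge0 _ _ _ _ _ _) (sub t x t0).
have mumono s t x : 0 <= s -> s <= t -> mu s x <= mu t x by exact: (solution_nondecreasing V_ge0 mu0 muE).
have EE : (fun t x => expR t * (expR (- t) * mu t x)) = mu.
  by apply/funext => t; apply/funext => x; rewrite mulrA expRxMexpNx_1 mul1r.
exists (fun t x => expR (- t) * mu t x); last first.
  (* Any time t > 0 and any point x other than 0 would do, as [subsol] is positive there. *)
  exists 1, (const_mx 1); split => //; rewrite mulr_gt0 ?expR_gt0//.
  apply: lt_le_trans (sub _ _ ler01); rewrite /subsol powR_gt0// !mulr_gt0//.
  rewrite powR_gt0//; apply: lt_le_trans (coord_le_enorm _ (Ordinal n_gt0)).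
  by rewrite mxE normr1.
apply/s_solution_Phi; rewrite EE; split.
- by move=> t x t0; rewrite mulr_ge0 ?expR_ge0// mu0.
- have NW (x : 'rV[R]_n) : W b x <= n.+1%:R `^ b * (1 + enorm x) `^ a by exact: W_le_enorm.
  have nb0 : 0 <= n.+1%:R `^ b :> R by exact: powR_ge0.
  split => [t t0|t t0 eps epsg0].
    split.
      move=> x; suff : mu t z @[z --> x] --> mu t x by [].
      have FF : Filter (nbhs x) by exact: nbhs_filter.
      apply/(@cvgrPdist_le _ _ _ _ FF) => eta eta0; apply/nbhs_rVP.
      have [e e0 eP] := mueq t t0 x eta eta0; exists e => // x' /eP/(_ t).
      by rewrite distrC; apply; rewrite /= t0 lexx.
    have [C C0 CP] := muC t t0.
    exists (C * (n.+1%:R `^ b * 2 `^ a)), 1 => x x1.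
    rewrite ger0_norm ?mu0//; apply: (@le_trans _ _ (C * W b x)); first by apply: CP; rewrite t0 lexx.
    rewrite -!mulrA ler_wpM2l//; apply: le_trans (NW x) _; rewrite ler_wpM2l//.
    rewrite -powRM ?enorm_ge0//; apply: ge0_ler_powR; rewrite ?nnegrE ?addr_ge0 ?mulr_ge0 ?enorm_ge0//.
    lra.
  have T0 : 0 <= t + 1 by rewrite addr_ge0.
  have [C C0 CP] := muC _ T0; set T := t + 1 in T0 CP.
  have [K K0 KP] := @Bconv_W R n b b_ge0.
  pose L := C * K + expR ((1 - p) * T) * (vu * C `^ p * K).
  have vC0 : 0 <= vu * C `^ p by rewrite mulr_ge0 ?powR_ge0// ltW.
  have L0 : 0 <= L.
    by rewrite addr_ge0 ?mulr_ge0 ?expR_ge0 ?powR_ge0// ltW.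
  (* Continuity in time with respect to the weighted norm: Lipschitz in the weight W b, which is
     controlled by (1 + |x|)^a because b <= a. *)
  have lip s s' x : 0 <= s -> s <= s' -> s' <= T -> `|mu s' x - mu s x| <= L * W b x * (s' - s).
    move=> s0 ss' s'T; have s'0 := le_trans s0 ss'.
    rewrite ger0_norm ?subr_ge0 ?mumono// lerBlDl -lee_fin EFinD !muE//.
    have W0 y : 0 <= W b y by rewrite ltW// W_gt0.
    have m0' tau y : 0 <= tau <= s' -> 0 <= mu tau y by move=> /andP[tau0 _]; exact: mu0.
    have muCW tau y : 0 <= tau <= s' -> mu tau y <= C * W b y.
      by move=> /andP[tau0 tau1]; apply: CP; rewrite tau0 (le_trans tau1).
    have C10 : 0 <= C * (K * W b x) by rewrite !mulr_ge0// ltW.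
    have C20 : 0 <= vu * C `^ p * (K * W b x) by apply: mulr_ge0 => //; rewrite mulr_ge0// ltW.
    have ss : 0 <= s <= s' by rewrite s0.
    apply: le_trans (Phi_time_add V_ge0 (ltW p_lt1) ss C10 C20 m0' _ _) _.
    - move=> tau tt; apply: (@le_trans _ _ (Bconv (fun y => C * W b y) x)).
        by apply: le_Bconv => y; [exact: m0'|exact: muCW].
      by rewrite BconvZ// [leRHS]EFinM; apply: lee_wpmul2l; rewrite ?lee_fin.
    - move=> tau tt; apply: (@le_trans _ _ (Bconv (fun y => vu * C `^ p * W b y) x)).
        apply: le_Bconv => y; first by rewrite mulr_ge0 ?powR_ge0.
        apply: le_trans (source_le_W p_gt0 p_lt1 sigma_ge0 vu_gt0 V_le y C0).
        rewrite ler_wpM2l//; apply: ge0_ler_powR; rewrite ?nnegrE ?(ltW p_gt0) ?m0' ?mulr_ge0 ?W0//.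
        exact: muCW.
      by rewrite BconvZ// [leRHS]EFinM; apply: lee_wpmul2l; rewrite ?lee_fin.
    apply: leeD => //; rewrite lee_fin ler_wpM2r ?subr_ge0// /L [leRHS]mulrDl; apply: lerD.
      by rewrite mulrA.
    rewrite -(mulrA (expR _)) -(mulrA (vu * _)); apply: ler_wpM2r => //.
    by rewrite ler_expR ler_pM2l.
  pose Z := L * n.+1%:R `^ b + 1.
  have Z0 : 0 < Z by rewrite ltr_wpDl// mulr_ge0.
  exists (Num.min 1 (eps / Z)); first by rewrite lt_min ltr01 divr_gt0.
  move=> s s0; rewrite lt_min => /andP[s1 s2] x.
  have wa0 : 0 <= (1 + enorm x) `^ a by exact: powR_ge0.
  have main : `|mu s x - mu t x| <= L * W b x * `|s - t|.
    have sT : s <= T by move: s1; rewrite ltr_norml => /andP[_ ?]; rewrite /T; lra.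
    have tT : t <= T by rewrite lerDl.
    have [st|ts] := leP s t.
      by rewrite distrC (distrC s) (ger0_norm (x := t - s)) ?subr_ge0//; exact: lip.
    by rewrite (ger0_norm (x := s - t)) ?subr_ge0 ?(ltW ts)//; apply: lip => //; exact: ltW.
  apply: le_trans main _.
  apply: (@le_trans _ _ (L * (n.+1%:R `^ b * (1 + enorm x) `^ a) * (eps / Z))).
    apply: ler_pM => //; [by rewrite mulr_ge0// ltW// W_gt0| |exact: ltW].
    by rewrite ler_wpM2l.
  have -> : L * (n.+1%:R `^ b * (1 + enorm x) `^ a) * (eps / Z) =
    eps * (1 + enorm x) `^ a * (L * n.+1%:R `^ b / Z) by field; rewrite gt_eqF.
  rewrite ler_piMr//; first by rewrite mulr_ge0// ltW.
  by rewrite ler_pdivrMr// mul1r /Z lerDl.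
- by move=> t x t0; rewrite -(muE t x t0) mulrA expRxMexpNx_1 mul1r.
Qed.

Lemma s_solution_init u x : s_solution V p a u -> u 0 x = 0.
Proof.
move=> /s_solution_Phi[_ _ uE]; have := uE 0 x (lexx _).
by rewrite Phi0 expR0 mul1r => -[].
Qed.

Lemma shift_s_solution (k : R) us u : 0 <= k -> s_solution V p a us ->
  (forall t x, 0 <= t -> 0 <= u t x) -> Zinf a u ->
  (forall t x, 0 <= t -> u t x = us (Num.max (t - k) 0) x) -> s_solution V p a u.
Proof.
move=> k0 uss u0 uZ uE; have us00 x := s_solution_init x uss.
have /s_solution_Phi[us0 _ usE] := uss.
apply/s_solution_Phi; split; [exact: u0|exact: Zinf_expR|].
set mu := fun t x => expR t * u t x.
set nu := fun t x => expR t * us t x in usE.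
have shift t x : 0 <= t -> Phi V p mu (t + k) x = ((expR k)%:E * Phi V p nu t x)%E.
  move=> t0; apply: Phi_shift => //.
  - by move=> tau y /andP[tau0 _]; rewrite /nu mulr_ge0 ?expR_ge0 ?us0.
  - move=> tau y /andP[tau0 _]; rewrite /mu /nu uE ?addr_ge0// addrK max_l// expRD; ring.
  - move=> tau y /andP[tau0 tauk]; rewrite /mu uE// max_r ?us00 ?mulr0//.
    by rewrite subr_le0 ltW.
move=> t x t0; rewrite -/(mu t x); have [kt|tk] := leP k t.
  have tk0 : 0 <= t - k by rewrite subr_ge0.
  have := shift (t - k) x tk0; rewrite subrK => ->.
  by rewrite -usE// -EFinM /mu /nu uE// max_l// mulrA -expRD (addrC k) subrK.
have -> : mu t x = 0.
  by rewrite /mu uE// max_r ?us00 ?mulr0// subr_le0 ltW.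
have mu0 tau y : 0 <= tau <= k -> 0 <= mu tau y.
  by move=> /andP[tau0 _]; rewrite mulr_ge0 ?expR_ge0 ?u0.
(* Before the delay k, Phi mu lies between 0 and its value at time k, which by the shift formula is
   a multiple of Phi nu at time 0, that is 0. *)
apply/esym/eqP; rewrite eq_le; apply/andP; split; last first.
  apply: Phi_ge0 => // tau y /andP[tau0 taut]; apply: mu0.
  by rewrite tau0 (le_trans taut)// ltW.
apply: le_trans (@Phi_nondecreasing _ _ _ p V_ge0 mu t k x (ltW tk) mu0) _.
by have := shift 0 x (lexx _); rewrite add0r Phi0 mule0 => ->.
Qed.

Lemma s_solution_shift_back (k : R) u : 0 <= k -> s_solution V p a u ->
  (forall t x, 0 <= t < k -> u t x = 0) -> s_solution V p a (fun t x => u (t + k) x).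
Proof.
move=> k0 /s_solution_Phi[u0 uZ uE] uk; apply/s_solution_Phi.
set mu := fun t x => expR t * u t x in uZ uE.
(* The factor e^{-k} turns e^{t+k} u(t+k) into e^t u(t+k). *)
pose nu t x := expR (- k) * mu (t + k) x.
have -> : (fun t x => expR t * u (t + k) x) = nu.
  apply/funext => t; apply/funext => x.
  by rewrite /nu /mu mulrA -expRD addrCA addNr addr0.
have u0' t x : 0 <= t -> 0 <= u (t + k) x by move=> t0; apply: u0; rewrite addr_ge0.
have nu0 t x : 0 <= t -> 0 <= nu t x.
  by move=> t0; rewrite !mulr_ge0 ?expR_ge0 ?u0'.
split; first exact: u0'.
  by apply: Zinf_shift uZ => //; rewrite expR_ge0 expR_le1 oppr_le0.
move=> t x t0.
have E : Phi V p mu (t + k) x = ((expR k)%:E * Phi V p nu t x)%E.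
  apply: Phi_shift => //.
  - by move=> tau y /andP[tau0 _]; exact: nu0.
  - by move=> tau y _; rewrite /nu mulrA expRxMexpNx_1 mul1r.
  - by move=> tau y tk; rewrite /mu uk ?mulr0.
have tk0 : 0 <= t + k by rewrite addr_ge0.
have muk : (mu (t + k) x)%:E = Phi V p mu (t + k) x by exact: uE.
transitivity ((expR (- k))%:E * (mu (t + k) x)%:E)%E.
  have -> : expR t * u (t + k) x = expR (- k) * mu (t + k) x; last by rewrite EFinM.
  by rewrite /mu mulrA -expRD addrCA addNr addr0.
have ee : ((expR (- k))%:E * (expR k)%:E = 1 :> \bar R)%E by rewrite -EFinM mulrC expRxMexpNx_1.
rewrite muk E muleA ee; exact: mul1e.
Qed.

(** The lower bound is needed for u only, while us merely has to be O(t^r), which [apriori] gives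
    for every solution. With us maximal the two functions coincide. *)
Lemma positive_s_solution_ge us u : s_solution V p a us -> s_solution V p a u ->
  (forall t, 0 < t -> exists s z, [/\ 0 <= s, s < t & 0 < u s z]) ->
  forall t x, 0 <= t -> us t x <= u t x.
Proof.
move=> /s_solution_Phi[us0 usZ usE] /s_solution_Phi[u0 uZ uE] upos T x T0.
set mu := fun t x => expR t * us t x in usZ usE.
set nu := fun t x => expR t * u t x in uZ uE.
have mu0 t y : 0 <= t -> 0 <= mu t y by move=> t0; rewrite mulr_ge0 ?expR_ge0 ?us0.
have nu0 t y : 0 <= t -> 0 <= nu t y by move=> t0; rewrite mulr_ge0 ?expR_ge0 ?u0.
have sub : forall t y, 0 <= t -> subsol p sigma vl eps0 t y <= nu t y.
  apply: (subsol_le_solution n_gt0 V_ge0 p_gt0 p_lt1 sigma_ge0 vl_gt0 eps0_gt0 V_ge eps0_le nu0 uE).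
    by move=> t t0; have [/(_ t t0)[]] := uZ.
  move=> t t0; have [s [z [s0 st uz]]] := upos t t0.
  by exists s, z; split => //; rewrite mulr_gt0 ?expR_gt0.
have [ep ep0 e1q] := exists_exponent n (ltW q_gt0) q_lt1.
have e1 : n%:R * ep ^+ 2 < 1 by apply: lt_trans e1q _; rewrite gtrBl.
(* Solutions are nondecreasing in time, so the growth bound at time T covers all of [0, T]. *)
have [C C0 CP] := BC_bound a_ge0 (usZ.1 T T0).
have [C1 C10 C1P] := @W_le_phi R n a ep a_ge0 ep0.
have M00 : 0 <= C * C1 by rewrite mulr_ge0// ltW.
have muM t y : 0 <= t <= T -> 0 <= mu t y <= C * C1 * phi ep y.
  move=> /andP[t0 tT]; rewrite mu0//=.
  apply: le_trans (solution_nondecreasing V_ge0 mu0 usE y t0 tT) _.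
  apply: le_trans (ler_norm _) _; apply: le_trans (CP y) _.
  rewrite -mulrA ler_wpM2l//; apply: le_trans (enorm_powR_le_Wa y a_ge0) _.
  exact: C1P.
have muE t y : 0 <= t <= T -> ((mu t y)%:E <= Phi V p mu t y)%E.
  by move=> /andP[t0 _]; rewrite -usE.
have [M M0 MP] := apriori V_ge0 p_gt0 p_lt1 sigma_ge0 vu_gt0 V_le e1 ep0 M00 muM muE.
have : mu T x <= nu T x.
  apply: (comparison V_ge0 p_gt0 p_lt1 vl_gt0 vu_gt0 eps0_gt0 V_le e1q M0 _ _ muE (T := T)).
  - by move=> t y /andP[t0 _]; exact: sub.
  - by move=> t y /andP[t0 _]; rewrite -uE.
  - by move=> t y tT; have /andP[h _] := muM t y tT; rewrite h MP.
  - by rewrite T0 lexx.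
by rewrite /mu /nu ler_pM2l// expR_gt0.
Qed.

Lemma maximal_shiftP us u : maximal_s_solution V p a us ->
  (forall t x, 0 <= t -> 0 <= u t x) -> Zinf a u ->
  ((s_solution V p a u /\ exists t x, 0 <= t /\ u t x <> 0) <->
   exists2 k, 0 <= k & forall t x, 0 <= t -> u t x = us (Num.max (t - k) 0) x).
Proof.
move=> [uss usmax] u0 uZ; split; last first.
  move=> [k k0 uE]; split; first exact: (shift_s_solution k0 uss).
  have [v vs [t [x [t0 vtx]]]] := exists_s_solution.
  exists (t + k), x; split; first by rewrite addr_ge0.
  rewrite uE ?addr_ge0// addrK max_l//; apply/eqP; rewrite gt_eqF//.
  exact: lt_le_trans vtx (usmax v vs t x t0).
move=> [uS [t1 [x1 [t10 /eqP ut1]]]].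
(* The delay is the infimum of the times at which u is somewhere positive; moved back by it, u is a
   solution that is positive right after 0. *)
pose A := [set t : R | 0 <= t /\ exists x, 0 < u t x].
have A0 : lbound A 0 by move=> t [].
have Ane : A !=set0 by exists t1; split => //; exists x1; rewrite lt_neqAle eq_sym ut1 u0.
have Alb : has_lbound A by exists 0.
pose k := inf A.
have k0 : 0 <= k by apply: lb_le_inf.
have ulow t x : 0 <= t < k -> u t x = 0.
  move=> /andP[t0 tk]; apply/eqP; rewrite eq_le u0// andbT leNgt; apply/negP => utx.
  have : k <= t by apply: ge_inf => //; split => //; exists x.
  by rewrite leNgt tk.
pose v t x := u (t + k) x.
have vS : s_solution V p a v by exact: s_solution_shift_back.
have vpos t : 0 < t -> exists s z, [/\ 0 <= s, s < t & 0 < v s z].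
  move=> t0.
  have [s [s0 [z uz]] st] : exists2 s, A s & s < k + t by apply: inf_lt; rewrite ?ltrDl.
  have ks : k <= s by apply: ge_inf => //; split => //; exists z.
  exists (s - k), z; rewrite subr_ge0 ks ltrBlDl; split => //.
  by rewrite /v subrK.
have vus t x : 0 <= t -> v t x = us t x.
  move=> t0; apply/eqP; rewrite eq_le usmax//=.
  exact: (positive_s_solution_ge uss vS vpos).
exists k => // t x t0; have [kt|tk] := leP k t.
  by rewrite max_l ?subr_ge0// -vus ?subr_ge0// /v subrK.
by rewrite max_r ?subr_le0 ?(ltW tk)// ulow ?t0// (s_solution_init x uss).
Qed.

End zero_data_problem.

Theorem mainTheorem6 (R : realType) (n : nat) (sigma : R) (Lambda : R -> R)
  (thl thu : R) (V : 'rV[R]_n -> R) (p eps0 a : R)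
  (ustar : R -> 'rV[R]_n -> R) (u : R -> 'rV[R]_n -> R) :
  (1 <= n)%N ->
  Jplus n sigma ->
  {within `[0, +oo[%classic, continuous Lambda} ->
  (forall t, 0 <= t -> 0 < Lambda t) ->
  0 < thl -> 0 < thu ->
  continuous V ->
  (forall x, 0 <= V x) ->
  (forall x t, 1 <= enorm x -> 0 < t -> thl * Lambda t * enorm x `^ sigma <= V x) ->
  (forall x t, 0 < t -> V x <= thu * Lambda t * enorm x `^ sigma) ->
  0 < eps0 ->
  (forall (x : 'rV[R]_n) d, 0 <= d -> d <= sigma * p / (1 - p) ->
     ((eps0 * enorm x `^ (sigma + d))%:E <=
      int_Rn (fun y => if (1 <= enorm (x - y))%R then
                         (Bker y * (enorm (x - y) `^ (sigma + d))%:E)%E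
                       else 0%E))%E) ->
  0 < p -> p < 1 -> p < eps0 * thl / thu ->
  sigma / (1 - p) <= a ->
  maximal_s_solution V p a ustar ->
  (forall t x, 0 <= t -> 0 <= u t x) ->
  Zinf a u ->
  ((s_solution V p a u /\ exists t x, 0 <= t /\ u t x <> 0)
   <->
   exists2 kappa, 0 <= kappa &
     forall t x, 0 <= t -> u t x = ustar (Num.max (t - kappa) 0) x).
Proof.
move=> n1 Js _ L0 thl0 thu0 Vc V0 Vl Vu e0 He p0 p1 pq ha umax u0 uZ.
have sigma0 : 0 <= sigma.
  by move: Js; rewrite /Jplus; case: ifP => // _ [->|/(le_trans ler01)].
(* As V does not depend on time, the bounds at t = 1 suffice, and [Lambda 1] cancels in the ratio
   that defines q. *)
have L1 : 0 < Lambda 1 by exact: L0.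
apply: (@maximal_shiftP R n V p sigma (thl * Lambda 1) (thu * Lambda 1) eps0 a) => //.
- exact: mulr_gt0.
- exact: mulr_gt0.
- by move=> x; exact: Vu.
- by move=> x x1; exact: Vl.
- move: pq; rewrite ltr_pdivlMr// => pq.
  rewrite ltr_pdivrMr ?mulr_gt0// mul1r !mulrA ltr_pM2r//.
Qed.
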